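(* Let $\tau\in\{1,2,4\}$, $n$, $N=2n$, $\mathbb{I}$, $q$, $\chi$ and the Hopf algebra $U^\natural_\chi$ be as in the context, and let $Z^\natural\in (U^{\natural,+}_\chi)_{s\delta}$ be the element defined in the context. (1) For all $i\in\mathbb{I}$, $$Z^\natural F^\natural_i-F^\natural_iZ^\natural=0\quad\text{and}\quad [\![Z^\natural,E^\natural_i]\!]=0 .$$ (2) Assume that $\chi(\alpha_i,\delta)=1$ for all $i\in\mathbb{I}$ if $\tau\in\{1,2\}$, and that $\chi(\alpha_i,2\delta)=1$ for all $i\in\mathbb{I}$ if $\tau=4$. Let $z_i,u_i\in\mathbb{K}^\times$ $(i\in\mathbb{I})$ and let $\Psi:U^\natural_\chi\to\mathrm{End}_{\mathbb{K}}(\mathbb{K}^{N'}\otimes_{\mathbb{K}}\mathbb{K}[t,t^{-1}])$ be the $\mathbb{K}$-algebra homomorphism given in the context. Then there is $b\in\mathbb{K}^\times$ with $\Psi(Z^\natural)=b\,(I\otimes t^s)$, where $I=\sum_{i=1}^{N'}e_{ii}$ is the unit matrix.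
   Context: **Data.** $\mathbb{K}$ is a field of characteristic $0$ containing an element $\sqrt{-1}$ with square $-1$; $\mathbb{K}^\times=\mathbb{K}\setminus\{0\}$. $\tau\in\{1,2,4\}$, $n\in\mathbb{N}$ with $n\ge 2$ if $\tau\in\{1,2\}$ and $n\ge1$ if $\tau=4$; $N:=2n$. $\hat N:=N-1$ if $\tau=1$, $\hat N:=N$ if $\tau\in\{2,4\}$; $\mathbb{I}:=\{0,1,\dots,\hat N\}$. $N':=N$, $2N$, $2N+2$ for $\tau=1,2,4$ respectively. $s:=1$ if $\tau\in\{1,2\}$, $s:=2$ if $\tau=4$. Signs: if $\tau\in\{1,2\}$, $d_i:=1$ for $1\le i\le n$ and $d_i:=-1$ for $n+1\le i\le N$; if $\tau=4$, $d_i:=-1$ for $1\le i\le n$ and $d_i:=1$ for $n+1\le i\le N$. $V$ is the real vector space with basis $\varepsilon_1,\dots,\varepsilon_N,\delta,\partial$ and symmetric bilinear form $(\varepsilon_i,\varepsilon_j)=\delta_{ij}d_i$, $(\varepsilon_i,\delta)=(\varepsilon_i,\partial)=0$, $(\delta,\delta)=(\partial,\partial)=0$, $(\partial,\delta)=1$ (only values on the $\alpha_i$ below matter). Put $\alpha_0:=\delta-\varepsilon_1+\varepsilon_N$, $\delta-2\varepsilon_1$, $\delta-\varepsilon_1$ for $\tau=1,2,4$ respectively; $\alpha_i:=\varepsilon_i-\varepsilon_{i+1}$ for $1\le i\le N-1$; $\alpha_N:=2\varepsilon_N$ if $\tau=2$, $\alpha_N:=\varepsilon_N$ if $\tau=4$.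 (So $\delta=\sum_{i}\alpha_i$ if $\tau\in\{1,4\}$, and $\delta=\alpha_0+2\sum_{i=1}^{N-1}\alpha_i+\alpha_N$ if $\tau=2$.) $\hat V':=\bigoplus_{i\in\mathbb{I}}\mathbb{Z}\alpha_i$, $\hat V:=\hat V'\oplus\mathbb{Z}\partial\subset V$. $q\in\mathbb{K}^\times$ satisfies $q^m\ne1$ for all $m\in\mathbb{N}$. $\chi:\hat V\times\hat V\to\mathbb{K}^\times$ is a map with $\chi(a+b,c)=\chi(a,c)\chi(b,c)$, $\chi(a,b+c)=\chi(a,b)\chi(a,c)$; $\chi(\alpha_i,\alpha_i)=q^{(\alpha_i,\alpha_i)}$ if $(\alpha_i,\alpha_i)\ne0$, $\chi(\alpha_i,\alpha_i)=-1$ if $(\alpha_i,\alpha_i)=0$; $\chi(\alpha_i,\alpha_j)\chi(\alpha_j,\alpha_i)=q^{2(\alpha_i,\alpha_j)}$ for $i\ne j$; $\chi(\partial,\partial)=1$, $\chi(\partial,\alpha_i)=\chi(\alpha_i,\partial)=q^{\delta_{i0}}$ (here $\delta_{i0}$ is Kronecker's delta). $\chi^{\mathrm{op}}(a,b):=\chi(b,a)$. **The algebra $\tilde U_\chi$.** It is the unital associative $\mathbb{K}$-algebra with generators $\tilde K_a,\tilde L_a$ $(a\in\hat V)$, $\tilde E_i,\tilde F_i$ $(i\in\mathbb{I})$ and relations $\tilde K_0=\tilde L_0=1$, $\tilde K_a\tilde K_b=\tilde K_{a+b}$, $\tilde L_a\tilde L_b=\tilde L_{a+b}$, $\tilde K_a\tilde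 L_b=\tilde L_b\tilde K_a$, $\tilde K_a\tilde E_i\tilde K_a^{-1}=\chi(a,\alpha_i)\tilde E_i$, $\tilde K_a\tilde F_i\tilde K_a^{-1}=\chi(a,-\alpha_i)\tilde F_i$, $\tilde L_a\tilde E_i\tilde L_a^{-1}=\chi(-\alpha_i,a)\tilde E_i$, $\tilde L_a\tilde F_i\tilde L_a^{-1}=\chi(\alpha_i,a)\tilde F_i$, $\tilde E_i\tilde F_j-\tilde F_j\tilde E_i=\delta_{ij}(-\tilde K_{\alpha_i}+\tilde L_{\alpha_i})$. It is a Hopf algebra with $\tilde K_a,\tilde L_a$ group-like, $\Delta(\tilde E_i)=\tilde E_i\otimes1+\tilde K_{\alpha_i}\otimes\tilde E_i$, $\Delta(\tilde F_i)=\tilde F_i\otimes\tilde L_{\alpha_i}+1\otimes\tilde F_i$. It is $\hat V'$-graded with $\tilde K_a,\tilde L_a$ in degree $0$, $\tilde E_i$ in degree $\alpha_i$, $\tilde F_i$ in degree $-\alpha_i$. $\tilde U^0_\chi,\tilde U^+_\chi,\tilde U^-_\chi$ are the subalgebras generated by the $\tilde K_a,\tilde L_a$, by the $\tilde E_i$, by the $\tilde F_i$ respectively. For homogeneous $X,Y$ of degrees $\lambda,\mu$ put $$[\![X,Y]\!]:=XY-\chi(\mu,\lambda)^{-1}YX .$$ **The algebra $U^\natural_\chi$.** Let $\tilde I^{\natural,+}_\chi$ be the two-sided ideal of $\tilde U^+_\chi$ generated by: $[\![\tilde E_i,\tilde E_j]\!]$ for $(\alpha_i,\alpha_j)=0$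 (including $i=j$); $[\![\tilde E_i,[\![\tilde E_i,\tilde E_j]\!]]\!]$ for $i\ne j$, $-2(\alpha_i,\alpha_j)=(\alpha_i,\alpha_i)\ne0$; $[\![\tilde E_i,[\![\tilde E_i,[\![\tilde E_i,\tilde E_j]\!]]\!]]\!]$ for $i\neq j$, $-(\alpha_i,\alpha_j)=(\alpha_i,\alpha_i)\ne0$; $[\![[\![\tilde E_i,\tilde E_j]\!],[\![\tilde E_i,\tilde E_k]\!]]\!]$ for $i,j,k$ distinct, $(\alpha_i,\alpha_i)=(\alpha_j,\alpha_k)=0$, $-(\alpha_i,\alpha_j)=(\alpha_i,\alpha_k)\ne0$. Let $\tilde\Upsilon:\tilde U_{\chi^{\mathrm{op}}}\to\tilde U_\chi$ be the algebra isomorphism $\tilde K_a\mapsto\tilde L_a$, $\tilde L_a\mapsto\tilde K_a$, $\tilde E_i\mapsto\tilde F_i$, $\tilde F_i\mapsto\tilde E_i$, and $\tilde I^{\natural,-}_\chi:=\tilde\Upsilon(\tilde I^{\natural,+}_{\chi^{\mathrm{op}}})$. Then $\tilde J^\natural_\chi:=\mathrm{Span}(\tilde U^-_\chi\tilde U^0_\chi\tilde I^{\natural,+}_\chi)+\mathrm{Span}(\tilde I^{\natural,-}_\chi\tilde U^0_\chi\tilde U^+_\chi)$ is a Hopf ideal and $U^\natural_\chi:=\tilde U_\chi/\tilde J^\natural_\chi$. Images of generators are $K^\natural_a,L^\natural_a,E^\natural_i,F^\natural_i$; $U^{\natural,+}_\chi$ is the image of $\tilde U^+_\chi$; $U^\natural_\chi$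 inherits the grading (degree-$\lambda$ part denoted $(\cdot)_\lambda$) and the bracket $[\![\,,\,]\!]$ on homogeneous elements. **The element $Z^\natural$.** $B_{n-1}:=E^\natural_n$; for $i=n-2,\dots,0$, $B_i:=[\![E^\natural_{N-i-1},[\![B_{i+1},E^\natural_{i+1}]\!]]\!]$ (degree $\varepsilon_{i+1}-\varepsilon_{N-i}$). If $\tau\in\{2,4\}$, $B_{-1}:=[\![E^\natural_N,[\![B_0,E^\natural_0]\!]]\!]$. $A_0:=E^\natural_0$ if $\tau=1$, $A_0:=B_{-1}$ if $\tau=2$, $A_0:=[\![E^\natural_N,[\![B_{-1},E^\natural_0]\!]]\!]$ if $\tau=4$. For $1\le i\le n-1$, $A_i:=[\![E^\natural_{N-i},[\![A_{i-1},E^\natural_i]\!]]\!]$ (degree $s\delta-\varepsilon_{i+1}+\varepsilon_{N-i}$). Scalars: $a_0:=1$ and, for $1\le i\le n-1$, $$a_i:=a_{i-1}\,\chi(s\delta,\alpha_{N-i})\,\chi\Big(-\alpha_i,\sum_{t=i+1}^{N-i-1}\alpha_t\Big)\,\chi\Big(\sum_{t=i}^{N-i-1}\alpha_t,-\alpha_{N-i}\Big);$$ if $\tau=4$, $a_{-1}:=\chi(\alpha_N,\alpha_0)\chi(\alpha_0,\delta)\chi(\alpha_N,\delta)$. Then $$Z^\natural:=\sum_{i=0}^{n-1}a_i[\![A_i,B_i]\!]\ (\tau\in\{1,2\}),\qquad Z^\natural:=a_{-1}B_{-1}^2+\sum_{i=0}^{n-1}a_i[\![A_i,B_i]\!]\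 (\tau=4).$$ **The homomorphism $\Psi$** (used in (2), under the assumption stated there). $e_1,\dots,e_{N'}$ is the standard basis of $\mathbb{K}^{N'}$, $e_{ij}$ the matrix units, and $e_{ij}\otimes t^l$ acts on $\mathbb{K}^{N'}\otimes\mathbb{K}[t,t^{-1}]$ by $(e_{ij}\otimes t^l)(e_k\otimes t^m)=\delta_{jk}e_i\otimes t^{l+m}$; $e_{ij}$ means $e_{ij}\otimes1$. Put $x_{ij}:=\chi(\alpha_i,\alpha_j)$ and $t^*:=N'+1-t$; empty products are $1$. In all cases $\Psi(K^\natural_\partial)(e_k\otimes t^m)=q^me_k\otimes t^m$, $\Psi(L^\natural_\partial)(e_k\otimes t^m)=q^{-m}e_k\otimes t^m$. $\tau=1$: $\Psi(K^\natural_{\alpha_i})=z_i\sum_{t=1}^N(\prod_{s=0}^{t-1}x_{is}^{-1})e_{tt}$; $\Psi(L^\natural_{\alpha_i})=z_iq^{-2(\varepsilon_N,\alpha_i)}\sum_{t=1}^N(\prod_{s=0}^{t-1}x_{si})e_{tt}$; $\Psi(E^\natural_0)=z_0u_0d_1q^{d_1}(q-q^{-1})e_{N1}\otimes t$; $\Psi(F^\natural_0)=u_0^{-1}e_{1N}\otimes t^{-1}$; for $i\ne0$, $\Psi(E^\natural_i)=-z_iu_id_iq^{-d_i}(\prod_{s=0}^{i-1}x_{is}^{-1})(q-q^{-1})e_{i,i+1}$, $\Psi(F^\natural_i)=u_i^{-1}e_{i+1,i}$. $\tau=2$: $\Psi(K^\natural_{\alpha_i})=z_i\big(\sum_{t=1}^N(\prod_{s=0}^{t-1}x_{is}^{-1})e_{tt}+\sum_{t=1}^N(\prod_{s=1}^{t-1}x_{is})e_{t^*t^*}\big)$;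 $\Psi(L^\natural_{\alpha_i})=z_iq^{2(\varepsilon_1,\alpha_i)}\big(\sum_{t=1}^N(\prod_{s=0}^{t-1}x_{si})e_{tt}+\sum_{t=1}^N(\prod_{s=1}^{t-1}x_{si}^{-1})e_{t^*t^*}\big)$; $\Psi(E^\natural_0)=-z_0u_0d_1q^{-2d_1}(q^2-q^{-2})e_{1^*1}\otimes t$; $\Psi(F^\natural_0)=u_0^{-1}e_{1\,1^*}\otimes t^{-1}$; for $1\le i\le N-1$, $\Psi(E^\natural_i)=-z_iu_id_iq^{-d_i}(\prod_{s=0}^{i-1}x_{is}^{-1})(q-q^{-1})\big(e_{i,i+1}-q^{2d_i}x_{i0}(\prod_{s=1}^{i-1}x_{is}^2)e_{(i+1)^*i^*}\big)$, $\Psi(F^\natural_i)=u_i^{-1}(e_{i+1,i}-e_{i^*(i+1)^*})$; $\Psi(E^\natural_N)=-z_Nu_Nd_N(\prod_{s=0}^{N-1}x_{Ns}^{-1})q^{-2d_N}(q^2-q^{-2})e_{NN^*}$, $\Psi(F^\natural_N)=u_N^{-1}e_{N^*N}$. $\tau=4$: $\Psi(K^\natural_{\alpha_i})=z_i\big(\sum_{t=0}^{N+1}(\prod_{s=0}^{t-1}x_{is}^{-1})e_{t+1,t+1}+\sum_{t=1}^N(\prod_{s=0}^{t-1}x_{is})e_{t^*t^*}\big)$; $\Psi(L^\natural_{\alpha_i})=z_i\big(\sum_{t=0}^{N+1}(\prod_{s=0}^{t-1}x_{si})e_{t+1,t+1}+\sum_{t=1}^N(\prod_{s=0}^{t-1}x_{si}^{-1})e_{t^*t^*}\big)$;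 $\Psi(E^\natural_0)=-z_0u_0d_1(q-q^{-1})(e_{12}-e_{1^*1})\otimes t$; $\Psi(F^\natural_0)=u_0^{-1}(e_{21}-e_{1\,1^*})\otimes t^{-1}$; for $1\le i\le N$, $\Psi(E^\natural_i)=-z_iu_id_iq^{-d_i}(\prod_{s=0}^{i-1}x_{is}^{-1})(q-q^{-1})\big(e_{i+1,i+2}-q^{2d_i}(\prod_{s=0}^{i-1}x_{is}^2)e_{(i+1)^*i^*}\big)$, $\Psi(F^\natural_i)=u_i^{-1}(e_{i+2,i+1}-e_{i^*(i+1)^*})$. (For $\tau=4$, $(N+1)^*=N+2$.) *)

(* Defs.v *)
From HB Require Import structures.
From mathcomp Require Import all_boot all_order all_algebra.
From mathcomp Require Import generic_quotient ring_quotient.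
From mathcomp Require Import finmap zify.
From mathcomp.classical Require Import boolp.
From mathcomp.multinomials Require Import monalg.

Set Implicit Arguments.
Unset Strict Implicit.
Unset Printing Implicit Defensive.

Import GRing.Theory.
Local Open Scope ring_scope.
Local Open Scope quotient_scope.

(* Two-sided ideals of a possibly non-commutative ring and their quotients. *)

Record ideal2 (A : nzRingType) := Ideal2 {
  ideal2_mem :> A -> Prop;
  ideal2_0 : ideal2_mem 0;
  ideal2_D : forall x y, ideal2_mem x -> ideal2_mem y -> ideal2_mem (x + y);
  ideal2_Ml : forall a x, ideal2_mem x -> ideal2_mem (a * x);
  ideal2_Mr : forall a x, ideal2_mem x -> ideal2_mem (x * a);
  ideal2_proper : ~ ideal2_mem 1 }.

Section Quotient.
Variables (A : nzRingType) (I : ideal2 A).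

Definition ideal2_pred : {pred A} := fun x => `[< I x >].

Lemma ideal2_predP x : reflect (I x) (x \in ideal2_pred).
Proof. exact: asboolP. Qed.

Fact ideal2_zmod_closed : zmod_closed ideal2_pred.
Proof.
split=> [|x y /ideal2_predP Ix /ideal2_predP Iy]; apply/ideal2_predP.
  exact: ideal2_0.
by apply: ideal2_D => //; rewrite -mulN1r; apply: ideal2_Ml.
Qed.
HB.instance Definition _ :=
  GRing.isZmodClosed.Build A ideal2_pred ideal2_zmod_closed.

Definition quo := @Quotient.quot A ideal2_pred.
HB.instance Definition _ := GRing.Zmodule.on quo.

Definition pi_quo : A -> quo := \pi_(@Quotient.quot A ideal2_pred).

Lemma pi_quo_eq x y : pi_quo x = pi_quo y <-> I (x - y).
Proof.
rewrite /pi_quo; split.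
  by move/eqP; rewrite -Quotient.idealrBE => /ideal2_predP.
by move=> Ixy; apply/eqP; rewrite -Quotient.idealrBE; apply/ideal2_predP.
Qed.

Definition repr_quo (x : quo) : A := repr (x : @Quotient.quot A ideal2_pred).

Lemma repr_quoK x : pi_quo (repr_quo x) = x.
Proof. exact: reprK. Qed.

Lemma repr_pi_quo x : I (repr_quo (pi_quo x) - x).
Proof. by apply/pi_quo_eq; rewrite repr_quoK. Qed.

Lemma pi_quo_is_zmod_morphism : zmod_morphism pi_quo.
Proof. by move=> x y; exact: (raddfB \pi_(@Quotient.quot A ideal2_pred)). Qed.
HB.instance Definition _ :=
  GRing.isZmodMorphism.Build A quo pi_quo pi_quo_is_zmod_morphism.

Definition quo_one : quo := pi_quo 1.
Definition quo_mul (x y : quo) : quo := pi_quo (repr_quo x * repr_quo y).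

Lemma pi_quo_mul x y : quo_mul (pi_quo x) (pi_quo y) = pi_quo (x * y).
Proof.
apply/pi_quo_eq; set x' := repr_quo _; set y' := repr_quo _.
have -> : x' * y' - x * y = (x' - x) * y' + x * (y' - y).
  by rewrite mulrBl mulrBr addrA subrK.
by apply: ideal2_D; [apply: ideal2_Mr|apply: ideal2_Ml]; exact: repr_pi_quo.
Qed.

Lemma quo_mulA : associative quo_mul.
Proof.
move=> x y z; rewrite -[x]repr_quoK -[y]repr_quoK -[z]repr_quoK.
by rewrite !pi_quo_mul mulrA.
Qed.

Lemma quo_mul1l : left_id quo_one quo_mul.
Proof. by move=> x; rewrite -[x]repr_quoK !pi_quo_mul mul1r. Qed.

Lemma quo_mul1r : right_id quo_one quo_mul.
Proof. by move=> x; rewrite -[x]repr_quoK !pi_quo_mul mulr1. Qed.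

Lemma quo_mulDl : left_distributive quo_mul +%R.
Proof.
move=> x y z; rewrite -[x]repr_quoK -[y]repr_quoK -[z]repr_quoK.
by rewrite -raddfD !pi_quo_mul -raddfD mulrDl.
Qed.

Lemma quo_mulDr : right_distributive quo_mul +%R.
Proof.
move=> x y z; rewrite -[x]repr_quoK -[y]repr_quoK -[z]repr_quoK.
by rewrite -raddfD !pi_quo_mul -raddfD mulrDr.
Qed.

Lemma quo_one_neq0 : quo_one != 0.
Proof.
apply/eqP; rewrite -(raddf0 pi_quo) => /pi_quo_eq.
by rewrite subr0; exact: ideal2_proper.
Qed.

HB.instance Definition _ := GRing.Zmodule_isNzRing.Build quo
  quo_mulA quo_mul1l quo_mul1r quo_mulDl quo_mulDr quo_one_neq0.

Lemma pi_quo_is_monoid_morphism : monoid_morphism pi_quo.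
Proof. by split=> // x y; rewrite -pi_quo_mul. Qed.
HB.instance Definition _ :=
  GRing.isMonoidMorphism.Build A quo pi_quo pi_quo_is_monoid_morphism.

End Quotient.

Section QuotientAlgebra.
Variables (K : comNzRingType) (A : algType K) (I : ideal2 A).

Definition quo_scale (c : K) (x : quo I) : quo I := pi_quo I (c *: repr_quo x).

Lemma pi_quo_scale c x : quo_scale c (pi_quo I x) = pi_quo I (c *: x).
Proof.
apply/pi_quo_eq; rewrite -scalerBr -mulr_algl.
exact/ideal2_Ml/repr_pi_quo.
Qed.

Lemma quo_scaleA a b x : quo_scale a (quo_scale b x) = quo_scale (a * b) x.
Proof. by rewrite -[x]repr_quoK !pi_quo_scale scalerA. Qed.

Lemma quo_scale1 : left_id 1 quo_scale.
Proof. by move=> x; rewrite -[x]repr_quoK !pi_quo_scale scale1r. Qed.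

Lemma quo_scaleDr : right_distributive quo_scale +%R.
Proof.
move=> c x y; rewrite -[x]repr_quoK -[y]repr_quoK.
by rewrite -raddfD !pi_quo_scale -raddfD scalerDr.
Qed.

Lemma quo_scaleDl x : {morph quo_scale^~ x : a b / a + b}.
Proof.
move=> a b; rewrite -[x]repr_quoK.
by rewrite !pi_quo_scale -raddfD scalerDl.
Qed.

HB.instance Definition _ := GRing.Zmodule_isLmodule.Build K (quo I)
  quo_scaleA quo_scale1 quo_scaleDr quo_scaleDl.

Lemma pi_quo_is_scalable : scalable (pi_quo I).
Proof. by move=> c x; rewrite -pi_quo_scale. Qed.
HB.instance Definition _ :=
  GRing.isScalable.Build K A (quo I) *:%R (pi_quo I) pi_quo_is_scalable.

Lemma quo_scaleAl (c : K) (x y : quo I) : c *: (x * y) = c *: x * y.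
Proof.
rewrite -[x]repr_quoK -[y]repr_quoK.
by rewrite -rmorphM -!linearZ -rmorphM /= scalerAl.
Qed.
HB.instance Definition _ :=
  GRing.Lmodule_isLalgebra.Build K (quo I) quo_scaleAl.

Lemma quo_scaleAr (c : K) (x y : quo I) : c *: (x * y) = x * (c *: y).
Proof.
rewrite -[x]repr_quoK -[y]repr_quoK.
by rewrite -rmorphM -!linearZ -rmorphM /= scalerAr.
Qed.
HB.instance Definition _ := GRing.Lalgebra_isAlgebra.Build K (quo I) quo_scaleAr.

Variables (B : algType K) (f : {lrmorphism A -> B}).
Hypothesis fI : forall x, I x -> f x = 0.

Definition quo_lift (x : quo I) : B := f (repr_quo x).

Lemma quo_liftE x : quo_lift (pi_quo I x) = f x.
Proof.
apply/eqP; rewrite -subr_eq0 /quo_lift -rmorphB; apply/eqP.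
exact/fI/repr_pi_quo.
Qed.

Lemma quo_lift_is_linear : linear quo_lift.
Proof.
move=> c x y; rewrite -[x]repr_quoK -[y]repr_quoK.
by rewrite -linearP !quo_liftE linearP.
Qed.

Lemma quo_lift_is_monoid_morphism : monoid_morphism quo_lift.
Proof.
split=> [|x y]; first by rewrite -(rmorph1 (pi_quo I)) quo_liftE rmorph1.
rewrite -[x]repr_quoK -[y]repr_quoK.
by rewrite -rmorphM !quo_liftE rmorphM.
Qed.

End QuotientAlgebra.

Section GeneratedSets.
Variables (K : comNzRingType) (A : algType K).
Implicit Types (S B : A -> Prop).

Inductive subalg_gen S : A -> Prop :=
| SubalgGen s of S s : subalg_gen S s
| Subalg1 : subalg_gen S 1
| SubalgP c x y of subalg_gen S x & subalg_gen S y : subalg_gen S (c *: x + y)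
| SubalgM x y of subalg_gen S x & subalg_gen S y : subalg_gen S (x * y).

Inductive lin_span S : A -> Prop :=
| LinSpan0 : lin_span S 0
| LinSpanP c s x of S s & lin_span S x : lin_span S (c *: s + x).

(* The two-sided ideal of the subalgebra B generated by S. *)
Inductive ideal_gen B S : A -> Prop :=
| IdealGen0 : ideal_gen B S 0
| IdealGenD x y of ideal_gen B S x & ideal_gen B S y : ideal_gen B S (x + y)
| IdealGenM a s b of B a & S s & B b : ideal_gen B S (a * s * b).

Definition in_alg_full : A -> Prop := fun=> True.

Lemma ideal_gen_Ml S a x :
  ideal_gen in_alg_full S x -> ideal_gen in_alg_full S (a * x).
Proof.
elim=> [|y z _ IHy _ IHz|b s c _ Ss _].
- by rewrite mulr0; apply: IdealGen0.
- by rewrite mulrDr; apply: IdealGenD.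
- by rewrite !mulrA; apply: IdealGenM.
Qed.

Lemma ideal_gen_Mr S a x :
  ideal_gen in_alg_full S x -> ideal_gen in_alg_full S (x * a).
Proof.
elim=> [|y z _ IHy _ IHz|b s c _ Ss _].
- by rewrite mul0r; apply: IdealGen0.
- by rewrite mulrDl; apply: IdealGenD.
- by rewrite -mulrA; apply: IdealGenM.
Qed.

Lemma ideal_gen_vanish (C : nzRingType) (f : {rmorphism A -> C}) B S :
  (forall s, S s -> f s = 0) -> forall x, ideal_gen B S x -> f x = 0.
Proof.
move=> fS x; elim=> [|y z _ fy _ fz|a s b _ Ss _].
- exact: rmorph0.
- by rewrite rmorphD fy fz addr0.
- by rewrite !rmorphM (fS _ Ss) mulr0 mul0r.
Qed.

Variables (S : A -> Prop) (C : nzRingType) (f : {rmorphism A -> C}).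
Hypothesis fS : forall s, S s -> f s = 0.

Lemma ideal_gen_proper : ~ ideal_gen in_alg_full S 1.
Proof.
by move/(ideal_gen_vanish fS); rewrite rmorph1 => /eqP; rewrite oner_eq0.
Qed.

(* The ideal of A generated by S; the ring morphism f, which kills S, only
   serves to show that it is proper, so that the quotient is non-trivial. *)
Definition ideal2_gen : ideal2 A :=
  @Ideal2 A (ideal_gen in_alg_full S) (IdealGen0 _ _) (@IdealGenD _ _)
    (@ideal_gen_Ml S) (@ideal_gen_Mr S) ideal_gen_proper.

End GeneratedSets.

(* The free associative algebra on a set of generators, as the monoid algebra
   of the free monoid. *)

Definition word (X : Type) := seq X.
HB.instance Definition _ (X : choiceType) := Choice.on (word X).

Fact word_unit (X : choiceType) (v w : word X) :
  v ++ w = [::] -> v = [::] /\ w = [::].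
Proof. by case: v => //= ->. Qed.

HB.instance Definition _ (X : choiceType) := Choice_isMonomialDef.Build (word X)
  (@catA X) (@cat0s X) (@cats0 X) (@word_unit X).

Definition free_alg (K : comNzRingType) (X : choiceType) := {malg K[word X]}.

Section FreeAlgebra.
Variables (K : comNzRingType) (X : choiceType).

HB.instance Definition _ := GRing.Lalgebra.on (free_alg K X).

Fact free_alg_scaleAr (c : K) (x y : free_alg K X) :
  c *: (x * y) = x * (c *: y).
Proof.
have mulC (z : free_alg K X) : c%:MP * z = z * c%:MP.
  rewrite !malgM_def fgmulUg fgmulgU; apply: eq_bigr => w _.
  by rewrite mul1m mulm1 mulrC.
by rewrite -!mul_malgC !mulrA mulC.
Qed.
HB.instance Definition _ :=
  GRing.Lalgebra_isAlgebra.Build K (free_alg K X) free_alg_scaleAr.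

End FreeAlgebra.

HB.lock Definition free_gen (K : comNzRingType) (X : choiceType) (x : X) :
  free_alg K X := << [:: x] : word X >>.

Section FreeLift.
Variables (K : comNzRingType) (X : choiceType) (B : algType K) (phi : X -> B).

Definition word_eval (w : word X) : B := \prod_(x <- w) phi x.

Fact word_eval_mmorphism : mmorphism word_eval.
Proof. by split=> [v w|]; rewrite /word_eval ?big_nil // big_cat. Qed.
HB.instance Definition _ :=
  isMultiplicative.Build (word X) B word_eval word_eval_mmorphism.

Definition free_lift : free_alg K X -> B := mmap (in_alg B) word_eval.

Lemma free_lift_gen x : free_lift (free_gen K x) = phi x.
Proof.
by rewrite /free_lift free_gen.unlock mmapU /= scale1r mul1r /word_eval big_seq1.
Qed.

Lemma free_lift_is_linear : linear free_lift.
Proof.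
move=> c x y; rewrite /free_lift raddfD /= mmapZ.
by rewrite /= mulr_algl.
Qed.
HB.instance Definition _ :=
  GRing.isLinear.Build K (free_alg K X) B *:%R free_lift free_lift_is_linear.

Lemma free_lift_is_monoid_morphism : monoid_morphism free_lift.
Proof.
have commf (g : {malg K[word X]}) v w :
    GRing.comm (in_alg B g@_v) (word_eval w).
  by rewrite /GRing.comm mulr_algl mulr_algr.
by have [] := commr_mmap_is_multiplicative commf.
Qed.
HB.instance Definition _ := GRing.isMonoidMorphism.Build (free_alg K X) B
  free_lift free_lift_is_monoid_morphism.

End FreeLift.

(* The root datum.  The roots epsilon_k and alpha_k are indexed by natural
   numbers as on paper; alpha_k is defined for k <= Nhat. *)

Inductive affine_type := Tau1 | Tau2 | Tau4.

Section RootDatum.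
Variables (ty : affine_type) (n : nat).

Definition rkN : nat := n.*2.
Definition rkNhat : nat := if ty is Tau1 then rkN.-1 else rkN.
Definition idx := 'I_rkNhat.+1.
Definition rkN' : nat :=
  match ty with Tau1 => rkN | Tau2 => rkN.*2 | Tau4 => rkN.*2.+2 end.
Definition delta_mult : nat := if ty is Tau4 then 2 else 1.

Definition sgn_d (i : nat) : int :=
  if ty is Tau4 then (if (i <= n)%N then -1 else 1)
  else (if (i <= n)%N then 1 else -1).

(* Vectors of V with integral coordinates in the basis epsilon, delta, partial;
   integral coordinates make (alpha_i, alpha_j) usable as an exponent of q. *)
Definition latV : Type := ({ffun 'I_rkN -> int} * int * int)%type.
HB.instance Definition _ := GRing.Zmodule.on latV.

Definition form (x y : latV) : int :=
  \sum_(k < rkN) x.1.1 k * y.1.1 k * sgn_d k.+1 + x.1.2 * y.2 + x.2 * y.1.2.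

Definition epsV (i : nat) : latV := ([ffun k : 'I_rkN => (k.+1 == i)%:Z], 0, 0).
Definition deltaV : latV := (0, 1, 0).

Definition rootV (i : nat) : latV :=
  if i == 0%N then
    match ty with
    | Tau1 => deltaV - epsV 1 + epsV rkN
    | Tau2 => deltaV - epsV 1 *+ 2
    | Tau4 => deltaV - epsV 1
    end
  else if (i < rkN)%N then epsV i - epsV i.+1
  else if ty is Tau2 then epsV rkN *+ 2 else epsV rkN.

Definition bil (i j : nat) : int := form (rootV i) (rootV j).

(* The direct sum of the Z alpha_i, i in idx, and of Z partial. *)
Definition Vhat : Type := ({ffun idx -> int} * int)%type.
HB.instance Definition _ := GRing.Zmodule.on Vhat.

Definition alpha (i : nat) : Vhat := ([ffun j : idx => (j == i :> nat)%:Z], 0).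
Definition partial : Vhat := (0, 1).
Definition delta : Vhat :=
  if ty is Tau2 then alpha 0 + (\sum_(1 <= i < rkN) alpha i) *+ 2 + alpha rkN
  else \sum_(i : idx) alpha i.
Definition sdelta : Vhat := delta *+ delta_mult.

Record bichar (K : fieldType) (q : K) (chi : Vhat -> Vhat -> K) : Prop := Bichar {
  bichar_neq0 : forall a b, chi a b != 0;
  bichar_Dl : forall a b c, chi (a + b) c = chi a c * chi b c;
  bichar_Dr : forall a b c, chi a (b + c) = chi a b * chi a c;
  bichar_even : forall i : idx,
    bil i i != 0 -> chi (alpha i) (alpha i) = q ^ bil i i;
  bichar_odd : forall i : idx, bil i i = 0 -> chi (alpha i) (alpha i) = -1;
  bichar_sym : forall i j : idx, i != j ->
    chi (alpha i) (alpha j) * chi (alpha j) (alpha i) = q ^ (2 * bil i j);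
  bichar_pp : chi partial partial = 1;
  bichar_pa : forall i : idx,
    chi partial (alpha i) = if i == 0%N :> nat then q else 1;
  bichar_ap : forall i : idx,
    chi (alpha i) partial = if i == 0%N :> nat then q else 1 }.

Inductive gen := GK of Vhat | GL of Vhat | GE of idx | GF of idx.

Definition gen_encode (g : gen) : Vhat + Vhat + (idx + idx) :=
  match g with
  | GK a => inl (inl a) | GL a => inl (inr a)
  | GE i => inr (inl i) | GF i => inr (inr i)
  end.
Definition gen_decode (s : Vhat + Vhat + (idx + idx)) : gen :=
  match s with
  | inl (inl a) => GK a | inl (inr a) => GL a
  | inr (inl i) => GE i | inr (inr i) => GF i
  end.
Lemma gen_encodeK : cancel gen_encode gen_decode.
Proof. by case. Qed.
HB.instance Definition _ := Choice.copy gen (can_type gen_encodeK).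

Lemma rkNhat_ge k : (k < rkN)%N -> (k <= rkNhat)%N.
Proof. by rewrite /rkNhat; case: ty => kN; lia. Qed.

Lemma rkNhat_Tau24 : ty <> Tau1 -> rkNhat = rkN.
Proof. by rewrite /rkNhat; case: ty. Qed.

Lemma sum_alpha m : m = rkNhat.+1 ->
  \sum_(j : idx) alpha j = \sum_(0 <= t < m) alpha t.
Proof. by move=> ->; rewrite big_mkord. Qed.

Lemma sdeltaE : (0 < n)%N -> sdelta =
  match ty with
  | Tau1 => alpha 0 + \sum_(1 <= t < rkN) alpha t
  | Tau2 => alpha 0 + (\sum_(1 <= t < rkN) alpha t) *+ 2 + alpha rkN
  | Tau4 => (alpha 0 + \sum_(1 <= t < rkN) alpha t + alpha rkN) *+ 2
  end.
Proof.
move=> n_gt0; have N_gt0 : (0 < rkN)%N by rewrite /rkN; lia.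
have aux (V : zmodType) (t : affine_type) (S a s b : V) :
    (t = Tau1 -> S = a + s) -> (t = Tau4 -> S = a + s + b) ->
    (if t is Tau2 then a + s *+ 2 + b else S) *+ (if t is Tau4 then 2 else 1) =
    match t with
    | Tau1 => a + s | Tau2 => a + s *+ 2 + b | Tau4 => (a + s + b) *+ 2
    end.
  by case: t => S1 S4 //; [rewrite S1 | rewrite S4].
apply: aux => tyE; have Nhat : rkNhat = (if ty is Tau1 then rkN.-1 else rkN) by [].
  have m1 : rkN = rkNhat.+1 by rewrite Nhat tyE prednK.
  rewrite (sum_alpha m1).
  exact: big_ltn.
have m4 : rkN.+1 = rkNhat.+1 by rewrite Nhat tyE.
rewrite (sum_alpha m4).
rewrite big_nat_recr //.
congr (_ + _).
exact: big_ltn.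
Qed.

End RootDatum.


Section Utilde.
Variables (K : fieldType) (ty : affine_type) (n : nat).
Notation Vh := (Vhat ty n).
Notation ix := (idx ty n).
Notation al := (alpha ty n).
Notation freeU := (free_alg K (gen ty n)).
Notation fK a := (free_gen K (GK (a : Vh))).
Notation fL a := (free_gen K (GL (a : Vh))).
Notation fE i := (free_gen K (GE (i : ix))).
Notation fF i := (free_gen K (GF (i : ix))).

Section Chi.
Variable chi : Vh -> Vh -> K.

(* The inverses of K_a and L_a are written K_(-a) and L_(-a). *)
Inductive Ut_rel : freeU -> freeU -> Prop :=
| Ut_K0 : Ut_rel (fK 0) 1
| Ut_L0 : Ut_rel (fL 0) 1
| Ut_KK a b : Ut_rel (fK a * fK b) (fK (a + b))
| Ut_LL a b : Ut_rel (fL a * fL b) (fL (a + b))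
| Ut_KL a b : Ut_rel (fK a * fL b) (fL b * fK a)
| Ut_KE a i : Ut_rel (fK a * fE i * fK (- a)) (chi a (al i) *: fE i)
| Ut_KF a i : Ut_rel (fK a * fF i * fK (- a)) (chi a (- al i) *: fF i)
| Ut_LE a i : Ut_rel (fL a * fE i * fL (- a)) (chi (- al i) a *: fE i)
| Ut_LF a i : Ut_rel (fL a * fF i * fL (- a)) (chi (al i) a *: fF i)
| Ut_EF i j : Ut_rel (fE i * fF j - fF j * fE i)
    (if i == j then - fK (al i) + fL (al i) else 0).

Definition Ut_relator (x : freeU) : Prop :=
  exists y z, Ut_rel y z /\ x = y - z.

Definition counit_gen (B : algType K) (g : gen ty n) : B :=
  match g with GK _ | GL _ => 1 | GE _ | GF _ => 0 end.



Fact counit_rel (B : algType K) (f : {lrmorphism freeU -> B}) y z :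
  (forall g, f (free_gen K g) = counit_gen B g) -> Ut_rel y z -> f y = f z.
Proof.
move=> fg; case=> [||a b|a b|a b|a i|a i|a i|a i|i j].
- by rewrite fg rmorph1.
- by rewrite fg rmorph1.
- by rewrite rmorphM /= !fg /= mulr1.
- by rewrite rmorphM /= !fg /= mulr1.
- by rewrite !rmorphM /= !fg.
- by rewrite linearZ !rmorphM /= !fg /= mulr0 mul0r scaler0.
- by rewrite linearZ !rmorphM /= !fg /= mulr0 mul0r scaler0.
- by rewrite linearZ !rmorphM /= !fg /= mulr0 mul0r scaler0.
- by rewrite linearZ !rmorphM /= !fg /= mulr0 mul0r scaler0.
- rewrite rmorphB !rmorphM /= !fg /= mulr0 subrr.
  by case: ifP; rewrite ?rmorph0 // rmorphD rmorphN /= !fg /= addNr.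
Qed.

Fact counit_relator x :
  Ut_relator x -> free_lift (counit_gen K^o) x = 0.
Proof.
case=> y [z [yz ->]]; rewrite rmorphB; apply/eqP; rewrite subr_eq0; apply/eqP.
exact: (counit_rel (@free_lift_gen _ _ _ _)).
Qed.

Definition Utilde := quo (ideal2_gen counit_relator).
HB.instance Definition _ := GRing.Algebra.on Utilde.

Definition Ut_proj : freeU -> Utilde := pi_quo (ideal2_gen counit_relator).
HB.instance Definition _ := GRing.LRMorphism.on Ut_proj.

Lemma Ut_proj_rel y z : Ut_rel y z -> Ut_proj y = Ut_proj z.
Proof.
move=> yz; apply/pi_quo_eq => /=; rewrite -[y - z]mul1r -[1 * _]mulr1.
by apply: IdealGenM => //; exists y, z.
Qed.

Definition tK (a : Vh) : Utilde := Ut_proj (fK a).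
Definition tL (a : Vh) : Utilde := Ut_proj (fL a).
Definition tE (i : ix) : Utilde := Ut_proj (fE i).
Definition tF (i : ix) : Utilde := Ut_proj (fF i).

Lemma tK0 : tK 0 = 1.
Proof. by rewrite /tK (Ut_proj_rel Ut_K0) rmorph1. Qed.
Lemma tL0 : tL 0 = 1.
Proof. by rewrite /tL (Ut_proj_rel Ut_L0) rmorph1. Qed.
Lemma tKK a b : tK a * tK b = tK (a + b).
Proof. by have := Ut_proj_rel (Ut_KK a b); rewrite !rmorphM. Qed.
Lemma tLL a b : tL a * tL b = tL (a + b).
Proof. by have := Ut_proj_rel (Ut_LL a b); rewrite !rmorphM. Qed.
Lemma tKL a b : tK a * tL b = tL b * tK a.
Proof. by have := Ut_proj_rel (Ut_KL a b); rewrite !rmorphM. Qed.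
Lemma tKE a i : tK a * tE i * tK (- a) = chi a (al i) *: tE i.
Proof. by have := Ut_proj_rel (Ut_KE a i); rewrite linearZ !rmorphM. Qed.
Lemma tKF a i : tK a * tF i * tK (- a) = chi a (- al i) *: tF i.
Proof. by have := Ut_proj_rel (Ut_KF a i); rewrite linearZ !rmorphM. Qed.
Lemma tLE a i : tL a * tE i * tL (- a) = chi (- al i) a *: tE i.
Proof. by have := Ut_proj_rel (Ut_LE a i); rewrite linearZ !rmorphM. Qed.
Lemma tLF a i : tL a * tF i * tL (- a) = chi (al i) a *: tF i.
Proof. by have := Ut_proj_rel (Ut_LF a i); rewrite linearZ !rmorphM. Qed.
Lemma tEF i j :
  tE i * tF j - tF j * tE i = if i == j then - tK (al i) + tL (al i) else 0.
Proof.
have := Ut_proj_rel (Ut_EF i j); rewrite rmorphB !rmorphM /= => ->.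
by case: ifP; rewrite ?rmorph0 // rmorphD rmorphN.
Qed.

Section Lift.
Variables (B : algType K) (phi : gen ty n -> B).
Hypothesis phiP : forall y z, Ut_rel y z -> free_lift phi y = free_lift phi z.

Fact Ut_lift_vanish x :
  ideal2_gen counit_relator x -> free_lift phi x = 0.
Proof.
move=> Ix; apply: (ideal_gen_vanish _ Ix) => s [y [z [yz ->]]].
by rewrite rmorphB /= (phiP yz) subrr.
Qed.

Definition Ut_lift : Utilde -> B :=
  quo_lift (I := ideal2_gen counit_relator) (free_lift phi).

Lemma Ut_lift_gen g : Ut_lift (Ut_proj (free_gen K g)) = phi g.
Proof.
by rewrite /Ut_lift /Ut_proj (quo_liftE Ut_lift_vanish) /= free_lift_gen.
Qed.

Lemma Ut_lift_is_linear : linear Ut_lift.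
Proof. exact: (quo_lift_is_linear Ut_lift_vanish). Qed.
Lemma Ut_lift_is_monoid_morphism : monoid_morphism Ut_lift.
Proof. exact: (quo_lift_is_monoid_morphism Ut_lift_vanish). Qed.
End Lift.

End Chi.
End Utilde.

Section UpsilonMap.
Variables (K : fieldType) (ty : affine_type) (n : nat).
Notation Vh := (Vhat ty n).
Variable chi : Vh -> Vh -> K.

Definition chi_op : Vh -> Vh -> K := fun a b => chi b a.

Definition Upsilon_gen (g : gen ty n) : Utilde chi :=
  match g with
  | GK a => tL chi a | GL a => tK chi a
  | GE i => tF chi i | GF i => tE chi i
  end.

Fact Upsilon_rel (f : {lrmorphism free_alg K (gen ty n) -> Utilde chi}) y z :
  (forall g, f (free_gen K g) = Upsilon_gen g) ->
  Ut_rel chi_op y z -> f y = f z.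
Proof.
move=> fg; case=> [||a b|a b|a b|a i|a i|a i|a i|i j].
- by rewrite fg rmorph1; exact: tL0.
- by rewrite fg rmorph1; exact: tK0.
- by rewrite rmorphM /= !fg; exact: tLL.
- by rewrite rmorphM /= !fg; exact: tKK.
- by rewrite !rmorphM /= !fg; exact/esym/tKL.
- by rewrite linearZ !rmorphM /= !fg; exact: tLF.
- by rewrite linearZ !rmorphM /= !fg; exact: tLE.
- by rewrite linearZ !rmorphM /= !fg; exact: tKF.
- by rewrite linearZ !rmorphM /= !fg; exact: tKE.
- rewrite rmorphB !rmorphM /= !fg /= -[_ - _]opprB tEF eq_sym.
  case: eqP => [->|_]; last by rewrite rmorph0 oppr0.
  by rewrite rmorphD rmorphN /= !fg /= opprD opprK addrC.
Qed.

Fact Upsilon_relP y z : Ut_rel chi_op y z ->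
  free_lift Upsilon_gen y = free_lift Upsilon_gen z.
Proof. exact: (Upsilon_rel (@free_lift_gen _ _ _ _)). Qed.

Definition Upsilon : Utilde chi_op -> Utilde chi := Ut_lift Upsilon_gen.
HB.instance Definition _ := GRing.isLinear.Build K _ _ *:%R Upsilon
  (Ut_lift_is_linear Upsilon_relP).
HB.instance Definition _ := GRing.isMonoidMorphism.Build _ _ Upsilon
  (Ut_lift_is_monoid_morphism Upsilon_relP).

Lemma UpsilonK a : Upsilon (tK chi_op a) = tL chi a.
Proof. exact: (Ut_lift_gen Upsilon_relP). Qed.
Lemma UpsilonL a : Upsilon (tL chi_op a) = tK chi a.
Proof. exact: (Ut_lift_gen Upsilon_relP). Qed.
Lemma UpsilonE i : Upsilon (tE chi_op i) = tF chi i.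
Proof. exact: (Ut_lift_gen Upsilon_relP). Qed.
Lemma UpsilonF i : Upsilon (tF chi_op i) = tE chi i.
Proof. exact: (Ut_lift_gen Upsilon_relP). Qed.

End UpsilonMap.

Section Bracket.
Variables (K : fieldType) (ty : affine_type) (n : nat).
Notation Vh := (Vhat ty n).
Variables (chi : Vh -> Vh -> K) (A : algType K).

(* A homogeneous element is handled together with its degree, because the
   bracket of X and Y depends on the degrees of X and Y. *)
Definition homog : Type := (Vh * A)%type.

Definition qbr (X Y : homog) : homog :=
  (X.1 + Y.1, X.2 * Y.2 - (chi Y.1 X.1)^-1 *: (Y.2 * X.2)).

End Bracket.

Section Unatural.
Variables (K : fieldType) (ty : affine_type) (n : nat).
Notation Vh := (Vhat ty n).
Notation ix := (idx ty n).
Notation al := (alpha ty n).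
Notation bl := (bil ty n).

Section TriangularParts.
Variable chi : Vh -> Vh -> K.

Definition Ut_zero : Utilde chi -> Prop :=
  subalg_gen (fun x => exists a, x = tK chi a \/ x = tL chi a).
Definition Ut_plus : Utilde chi -> Prop :=
  subalg_gen (fun x => exists i, x = tE chi i).
Definition Ut_minus : Utilde chi -> Prop :=
  subalg_gen (fun x => exists i, x = tF chi i).

Notation br := (qbr chi).
Definition tEh (i : ix) : homog ty n (Utilde chi) := (al i, tE chi i).

Inductive serre : Utilde chi -> Prop :=
| Serre2 (i j : ix) of bl i j = 0 : serre (br (tEh i) (tEh j)).2
| Serre3 (i j : ix) of i != j & - (2 * bl i j) = bl i i & bl i i != 0 :
    serre (br (tEh i) (br (tEh i) (tEh j))).2
| Serre4 (i j : ix) of i != j & - bl i j = bl i i & bl i i != 0 :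
    serre (br (tEh i) (br (tEh i) (br (tEh i) (tEh j)))).2
| SerreSuper (i j k : ix) of [/\ i != j, i != k & j != k]
    & bl i i = 0 & bl j k = 0 & - bl i j = bl i k & bl i k != 0 :
    serre (br (br (tEh i) (tEh j)) (br (tEh i) (tEh k))).2.

Definition Inat_plus : Utilde chi -> Prop := ideal_gen Ut_plus serre.

End TriangularParts.

Variable chi : Vh -> Vh -> K.
Notation U := (Utilde chi).

Definition Inat_minus (y : U) : Prop :=
  exists2 x : Utilde (chi_op chi), Inat_plus x & y = Upsilon x.

Definition prod3 (P Q R : U -> Prop) (x : U) : Prop :=
  exists u v w, [/\ P u, Q v, R w & x = u * v * w].

Definition Jnat (x : U) : Prop :=
  exists y z,
    [/\ lin_span (prod3 (@Ut_minus chi) (@Ut_zero chi) (@Inat_plus chi)) y,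
        lin_span (prod3 Inat_minus (@Ut_zero chi) (@Ut_plus chi)) z
      & x = y + z].

Definition counit : U -> K^o := Ut_lift (counit_gen K^o).

Fact counit_relP y z : Ut_rel chi y z ->
  free_lift (counit_gen K^o) y = free_lift (counit_gen K^o) z.
Proof. exact: (counit_rel (@free_lift_gen _ _ _ _)). Qed.

HB.instance Definition _ := GRing.isLinear.Build K _ _ *:%R counit
  (Ut_lift_is_linear counit_relP).
HB.instance Definition _ := GRing.isMonoidMorphism.Build _ _ counit
  (Ut_lift_is_monoid_morphism counit_relP).

Lemma counit_tE i : counit (tE chi i) = 0.
Proof. exact: (Ut_lift_gen counit_relP). Qed.
Lemma counit_tF i : counit (tF chi i) = 0.
Proof. exact: (Ut_lift_gen counit_relP). Qed.


Fact serre_vanish (chi' : Vh -> Vh -> K) (B : algType K)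
    (f : {lrmorphism Utilde chi' -> B}) x :
  (forall i, f (tE chi' i) = 0) -> Inat_plus x -> f x = 0.
Proof.
move=> fE; apply: ideal_gen_vanish => s.
have fbr X Y : f X.2 = 0 -> f (qbr chi' X Y).2 = 0.
  by move=> fX; rewrite /= rmorphB /= linearZ !rmorphM /= fX mul0r mulr0 scaler0 subrr.
by case=> *; do ?apply: (fbr); exact: fE.
Qed.

Fact lin_span_vanish (B : algType K) (f : {lrmorphism U -> B}) S x :
  (forall s, S s -> f s = 0) -> lin_span S x -> f x = 0.
Proof.
move=> fS; elim=> [|c s y Ss _ fy]; first exact: rmorph0.
by rewrite rmorphD /= linearZ /= (fS _ Ss) fy scaler0 addr0.
Qed.

Fact counit_Jnat x : Jnat x -> counit x = 0.
Proof.
case=> y [z [Jy Jz ->]]; rewrite rmorphD /=.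
rewrite (lin_span_vanish (f := counit) _ Jy) => [|_ [u [v [w [_ _ Iw ->]]]]].
  rewrite add0r (lin_span_vanish (f := counit) _ Jz) //.
  move=> _ [_ [v [w [[u Iu ->] _ _ ->]]]].
  rewrite !rmorphM /=; suff -> : counit (Upsilon u) = 0 by rewrite !mul0r.
  apply: (serre_vanish (f := counit \o @Upsilon K ty n chi) _ Iu) => i /=.
  by rewrite UpsilonE; exact: counit_tF.
rewrite rmorphM /= (serre_vanish (f := counit) _ Iw) ?mulr0 //.
exact: counit_tE.
Qed.

(* Jnat is an ideal of Utilde, so that it is the ideal it generates. *)
Definition Unat := quo (ideal2_gen counit_Jnat).
HB.instance Definition _ := GRing.Algebra.on Unat.

Definition nat_proj : U -> Unat := pi_quo (ideal2_gen counit_Jnat).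
HB.instance Definition _ := GRing.LRMorphism.on nat_proj.

Definition nK (a : Vh) : Unat := nat_proj (tK chi a).
Definition nL (a : Vh) : Unat := nat_proj (tL chi a).
Definition nE (i : ix) : Unat := nat_proj (tE chi i).
Definition nF (i : ix) : Unat := nat_proj (tF chi i).

Lemma Jnat_eq0 x : Jnat x -> nat_proj x = 0.
Proof.
move=> Jx; rewrite -(rmorph0 nat_proj); apply/pi_quo_eq => /=.
rewrite subr0 -[x]mul1r -[1 * _]mulr1.
by apply: IdealGenM.
Qed.

Notation br := (qbr chi).
Definition nEh (k : nat) : homog ty n Unat := (al k, nE (inord k)).
Local Notation N := (rkN n).

(* B_down k is B_(n-1-k). *)
Fixpoint B_down (k : nat) : homog ty n Unat :=
  if k is k'.+1 then
    let i := (n - 1 - k)%N in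
    br (nEh (N - i - 1)) (br (B_down k') (nEh i.+1))
  else nEh n.
Definition Bn (i : nat) := B_down (n - 1 - i).
Definition Bminus1 := br (nEh N) (br (Bn 0) (nEh 0)).

Definition A0 : homog ty n Unat :=
  match ty with
  | Tau1 => nEh 0
  | Tau2 => Bminus1
  | Tau4 => br (nEh N) (br Bminus1 (nEh 0))
  end.
Fixpoint An (i : nat) : homog ty n Unat :=
  if i is i'.+1 then br (nEh (N - i)) (br (An i') (nEh i)) else A0.

Local Notation dl := (delta ty n).
Local Notation sdl := (sdelta ty n).

Fixpoint a_coef (i : nat) : K :=
  if i is i'.+1 then
    a_coef i' * chi sdl (al (N - i))
      * chi (- al i) (\sum_(i.+1 <= t < N - i) al t)
      * chi (\sum_(i <= t < N - i) al t) (- al (N - i))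
  else 1.
Definition a_minus1 : K := chi (al N) (al 0) * chi (al 0) dl * chi (al N) dl.

Definition Znat : Unat :=
  (if ty is Tau4 then a_minus1 *: Bminus1.2 ^+ 2 else 0)
    + \sum_(i < n) a_coef i *: (br (An i) (Bn i)).2.

Definition Znath : homog ty n Unat := (sdl, Znat).

(* The homogeneous components of the subalgebra generated by the nE i. *)
Inductive nat_plus_part : Vh -> Unat -> Prop :=
| NatPlus1 : nat_plus_part 0 1
| NatPlusE (i : ix) : nat_plus_part (al i) (nE i)
| NatPlusP l c x y of nat_plus_part l x & nat_plus_part l y :
    nat_plus_part l (c *: x + y)
| NatPlusM l m x y of nat_plus_part l x & nat_plus_part m y :
    nat_plus_part (l + m) (x * y).

Lemma nat_plus0 l x : nat_plus_part l x -> nat_plus_part l 0.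
Proof. by move=> Px; rewrite -(addNr x) -scaleN1r; exact: NatPlusP. Qed.

Lemma nat_plusZ l c x : nat_plus_part l x -> nat_plus_part l (c *: x).
Proof.
by move=> Px; rewrite -[c *: x]addr0; apply: NatPlusP => //; exact: nat_plus0 Px.
Qed.

Lemma nat_plusD l x y :
  nat_plus_part l x -> nat_plus_part l y -> nat_plus_part l (x + y).
Proof. by move=> Px Py; rewrite -[x]scale1r; exact: NatPlusP. Qed.

Definition homogeneous (X : homog ty n Unat) := nat_plus_part X.1 X.2.

Lemma homogeneous_br X Y : homogeneous X -> homogeneous Y -> homogeneous (br X Y).
Proof.
move=> hX hY; rewrite /homogeneous /= -scaleNr.
apply: nat_plusD; first exact: NatPlusM.
by apply: nat_plusZ; rewrite addrC; exact: NatPlusM.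
Qed.

Lemma homogeneous_E k : (k <= rkNhat ty n)%N -> homogeneous (nEh k).
Proof.
by move=> kN; rewrite /homogeneous -{1}(inordK kN); exact: NatPlusE.
Qed.

Lemma homogeneous_E_lt k : (k < N)%N -> homogeneous (nEh k).
Proof. by move=> kN; apply/homogeneous_E/rkNhat_ge. Qed.

Lemma homogeneous_EN : ty <> Tau1 -> homogeneous (nEh N).
Proof. by move=> ty1; apply: homogeneous_E; rewrite rkNhat_Tau24. Qed.

Hypothesis n_gt0 : (0 < n)%N.

Lemma homogeneous_B_down k : (k < n)%N -> homogeneous (B_down k).
Proof.
elim: k => [_|k IHk kn] /=.
  by apply: homogeneous_E_lt; rewrite /rkN -addnn -[X in (X < _)%N]addn0 ltn_add2l.
apply: homogeneous_br.
  by apply: homogeneous_E_lt; rewrite /rkN; lia.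
apply: homogeneous_br; first by apply: IHk; lia.
by apply: homogeneous_E_lt; rewrite /rkN; lia.
Qed.

Lemma homogeneous_Bminus1 : ty <> Tau1 -> homogeneous Bminus1.
Proof.
move=> ty1; apply: homogeneous_br.
  exact: homogeneous_EN.
apply: homogeneous_br; first by apply: homogeneous_B_down; lia.
by apply: homogeneous_E_lt; rewrite /rkN; lia.
Qed.

Lemma homogeneous_A k : (k < n)%N -> homogeneous (An k).
Proof.
elim: k => [_|k IHk kn] /=.
  rewrite /A0; have E0 : homogeneous (nEh 0).
    by apply: homogeneous_E_lt; rewrite /rkN; lia.
  have aux t : ty = t -> homogeneous
      match t with
      | Tau1 => nEh 0
      | Tau2 => Bminus1
      | Tau4 => br (nEh N) (br Bminus1 (nEh 0))
      end.
    case: t => tyE //; first by apply: homogeneous_Bminus1; rewrite tyE.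
    apply: homogeneous_br; first by apply: homogeneous_EN; rewrite tyE.
    by apply: homogeneous_br => //; apply: homogeneous_Bminus1; rewrite tyE.
  exact: aux.
apply: homogeneous_br.
  by apply: homogeneous_E_lt; rewrite /rkN; lia.
apply: homogeneous_br; first by apply: IHk; lia.
by apply: homogeneous_E_lt; rewrite /rkN; lia.
Qed.

Lemma deg_B_down k : (k < n)%N ->
  (B_down k).1 = \sum_((n - 1 - k).+1 <= t < N - (n - 1 - k)) al t.
Proof.
elim: k => [_|k IHk kn] /=.
  rewrite subn0 (_ : (N - (n - 1) = n.+1)%N) ?/rkN; last by lia.
  by rewrite subn1 prednK // big_nat1.
rewrite IHk; last by lia.
set i := (n - 1 - k.+1)%N; have -> : (n - 1 - k = i.+1)%N by rewrite /i; lia.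
have iN : (i.+1 < N - i.+1)%N by rewrite /i /rkN; lia.
rewrite [RHS]big_ltn; last by lia.
have -> : (N - i - 1 = N - i.+1)%N by lia.
have -> : (N - i = (N - i.+1).+1)%N by lia.
rewrite big_nat_recr /=; last by lia.
by rewrite [LHS](AC (1*2) (3*(2*1))).
Qed.

Lemma deg_B i : (i < n)%N -> (Bn i).1 = \sum_(i.+1 <= t < N - i) al t.
Proof.
move=> ilt; rewrite deg_B_down; last by lia.
by have -> : (n - 1 - (n - 1 - i) = i)%N by lia.
Qed.

Lemma deg_A i : (i < n)%N ->
  (An i).1 = A0.1 + \sum_(1 <= t < i.+1) al t + \sum_(N - i <= t < N) al t.
Proof.
elim: i => [_|i IHi ilt].
  by rewrite subn0 !big_geq // !addr0.
rewrite /= IHi; last by lia.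
rewrite [in RHS](big_ltn (m := (N - i.+1)%N)); last by rewrite /rkN; lia.
have -> : ((N - i.+1).+1 = N - i)%N by rewrite /rkN; lia.
rewrite [in RHS]big_nat_recr //=.
by rewrite [LHS](AC (1*4) ((2*(3*5))*(1*4))).
Qed.

Lemma deg_AB i : (i < n)%N -> (br (An i) (Bn i)).1 = sdl.
Proof.
move=> ilt /=; rewrite deg_A // deg_B //.
have -> : A0.1 + \sum_(1 <= t < i.+1) al t + \sum_(N - i <= t < N) al t +
    \sum_(i.+1 <= t < N - i) al t = A0.1 + \sum_(1 <= t < N) al t.
  rewrite -!addrA; congr (_ + _).
  rewrite [in RHS](big_cat_nat (n := i.+1)) /=; [|lia|rewrite /rkN; lia].
  congr (_ + _); rewrite addrC -big_cat_nat //=; rewrite /rkN; lia.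
have aux (t : affine_type) :
    (match t with
     | Tau1 => nEh 0
     | Tau2 => Bminus1
     | Tau4 => br (nEh N) (br Bminus1 (nEh 0))
     end).1 + \sum_(1 <= t < N) al t =
    match t with
    | Tau1 => al 0 + \sum_(1 <= t < N) al t
    | Tau2 => al 0 + (\sum_(1 <= t < N) al t) *+ 2 + al N
    | Tau4 => (al 0 + \sum_(1 <= t < N) al t + al N) *+ 2
    end.
  have B1 : Bminus1.1 = al N + (al 0 + \sum_(1 <= t < N) al t).
    by rewrite /Bminus1 /= deg_B // subn0; congr (_ + _); rewrite addrC.
  move: Bminus1 B1 => B B1; case: t; rewrite //= B1 mulr2n.
    by rewrite [LHS](AC ((1*2)*1) ((2*(3*4))*1)).
  by rewrite [LHS](AC ((1*((1*2)*1))*1) ((3*4*1)*(5*6*2))).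
by rewrite sdeltaE // -aux.
Qed.

Lemma Znat_homogeneous : homogeneous Znath.
Proof.
have Z0 : nat_plus_part sdl (br (An 0) (Bn 0)).2.
  rewrite -(deg_AB n_gt0); apply: homogeneous_br; first exact: homogeneous_A.
  by apply: homogeneous_B_down; lia.
apply: nat_plusD; last first.
  apply: (big_ind (nat_plus_part sdl)); first exact: nat_plus0 Z0.
    exact: nat_plusD.
  move=> i _; apply: nat_plusZ; rewrite -(deg_AB (ltn_ord i)).
  apply: homogeneous_br; first exact: homogeneous_A.
  by apply: homogeneous_B_down; have := ltn_ord i; lia.
have aux t : ty = t -> nat_plus_part sdl
    (if t is Tau4 then a_minus1 *: Bminus1.2 ^+ 2 else 0).
  case: t => tyE; [exact: nat_plus0 Z0 | exact: nat_plus0 Z0 | ].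
  have m4 (T : Type) (x y z : T) :
      match ty with Tau1 => x | Tau2 => y | Tau4 => z end = z by rewrite tyE.
  have -> : sdl = Bminus1.1 + Bminus1.1.
    rewrite sdeltaE // m4 -mulr2n /Bminus1 /= deg_B // subn0; congr (_ *+ 2).
    by rewrite [RHS](AC (1*2) (3*2*1)).
  have hB : homogeneous Bminus1 by apply: homogeneous_Bminus1; rewrite tyE.
  by apply: nat_plusZ; rewrite expr2; exact: NatPlusM.
exact: aux.
Qed.

End Unatural.

(* Algebra homomorphisms A -> End_K W. *)
Record alg_rep (K : fieldType) (A : algType K) (W : lmodType K) := AlgRep {
  rep_map :> A -> {linear W -> W};
  rep_linear : forall c x y w, rep_map (c *: x + y) w = c *: rep_map x w + rep_map y w;
  rep_one : forall w, rep_map 1 w = w;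
  rep_mul : forall x y w, rep_map (x * y) w = rep_map x (rep_map y w) }.

Section LoopModule.
Variables (K : fieldType) (d : nat).

(* K^d (x) K[t, 1/t], as the free module on the vectors e_k (x) t^m. *)
Definition loop_module := {malg K[('I_d * int)%type]}.
HB.instance Definition _ := GRing.Lmodule.on loop_module.

Definition loop_vec (k : 'I_d) (m : int) : loop_module := << (k, m) >>.

(* f = M (x) t^l *)
Definition acts_as (f : {linear loop_module -> loop_module})
    (M : 'M[K]_d) (l : int) : Prop :=
  forall k m, f (loop_vec k m) = \sum_(i < d) M i k *: loop_vec i (l + m).

(* The matrix unit e_ij, with i and j counted from 1. *)
Definition munit (i j : nat) : 'M[K]_d :=
  \matrix_(a, b) ((a.+1 == i) && (b.+1 == j))%:R.

End LoopModule.

Section PsiMap.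
Variables (K : fieldType) (ty : affine_type) (n : nat).
Variables (q : K) (chi : Vhat ty n -> Vhat ty n -> K) (z u : idx ty n -> K).
Local Notation ix := (idx ty n).
Local Notation N := (rkN n).
Local Notation N' := (rkN' ty n).
Local Notation e := (munit K N').
Local Notation x i j := (chi (alpha ty n i) (alpha ty n j)).
Local Notation star t := (N'.+1 - t)%N.
Local Notation dq i := (q ^ sgn_d ty n i).
Local Notation dK i := ((sgn_d ty n i)%:~R : K).
Local Notation eps_form k i := (form ty (epsV n k) (rootV ty n i)).

Definition psiK (i : ix) : 'M[K]_N' :=
  z i *:
  match ty with
  | Tau1 => \sum_(1 <= t < N.+1) (\prod_(0 <= s < t) (x i s)^-1) *: e t t
  | Tau2 =>
      \sum_(1 <= t < N.+1) (\prod_(0 <= s < t) (x i s)^-1) *: e t t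
      + \sum_(1 <= t < N.+1) (\prod_(1 <= s < t) x i s) *: e (star t) (star t)
  | Tau4 =>
      \sum_(0 <= t < N.+2) (\prod_(0 <= s < t) (x i s)^-1) *: e t.+1 t.+1
      + \sum_(1 <= t < N.+1) (\prod_(0 <= s < t) x i s) *: e (star t) (star t)
  end.

Definition psiL (i : ix) : 'M[K]_N' :=
  match ty with
  | Tau1 => (z i * q ^ (- (2 * eps_form N i))) *:
      \sum_(1 <= t < N.+1) (\prod_(0 <= s < t) x s i) *: e t t
  | Tau2 => (z i * q ^ (2 * eps_form 1 i)) *:
      (\sum_(1 <= t < N.+1) (\prod_(0 <= s < t) x s i) *: e t t
       + \sum_(1 <= t < N.+1) (\prod_(1 <= s < t) (x s i)^-1) *: e (star t) (star t))
  | Tau4 => z i *: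
      (\sum_(0 <= t < N.+2) (\prod_(0 <= s < t) x s i) *: e t.+1 t.+1
       + \sum_(1 <= t < N.+1) (\prod_(0 <= s < t) (x s i)^-1) *: e (star t) (star t))
  end.

Definition psiE (i : ix) : 'M[K]_N' :=
  match ty with
  | Tau1 =>
      if i == 0%N :> nat then
        (z i * u i * dK 1 * dq 1 * (q - q^-1)) *: e N 1
      else
        (- (z i * u i * dK i * (dq i)^-1 * (\prod_(0 <= s < i) (x i s)^-1)
            * (q - q^-1))) *: e i i.+1
  | Tau2 =>
      if i == 0%N :> nat then
        (- (z i * u i * dK 1 * (dq 1) ^- 2 * (q ^+ 2 - q ^- 2))) *: e (star 1) 1
      else if i == N :> nat then
        (- (z i * u i * dK i * (\prod_(0 <= s < i) (x i s)^-1) * (dq i) ^- 2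
            * (q ^+ 2 - q ^- 2))) *: e i (star i)
      else
        (- (z i * u i * dK i * (dq i)^-1 * (\prod_(0 <= s < i) (x i s)^-1)
            * (q - q^-1))) *:
        (e i i.+1 - ((dq i) ^+ 2 * x i 0 * \prod_(1 <= s < i) (x i s) ^+ 2) *:
                    e (star i.+1) (star i))
  | Tau4 =>
      if i == 0%N :> nat then
        (- (z i * u i * dK 1 * (q - q^-1))) *: (e 1 2 - e (star 1) 1)
      else
        (- (z i * u i * dK i * (dq i)^-1 * (\prod_(0 <= s < i) (x i s)^-1)
            * (q - q^-1))) *:
        (e i.+1 i.+2 - ((dq i) ^+ 2 * \prod_(0 <= s < i) (x i s) ^+ 2) *:
                       e (star i.+1) (star i))
  end.

Definition psiF (i : ix) : 'M[K]_N' :=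
  (u i)^-1 *:
  match ty with
  | Tau1 => if i == 0%N :> nat then e 1 N else e i.+1 i
  | Tau2 =>
      if i == 0%N :> nat then e 1 (star 1)
      else if i == N :> nat then e (star i) i
      else e i.+1 i - e (star i) (star i.+1)
  | Tau4 =>
      if i == 0%N :> nat then e 2 1 - e 1 (star 1)
      else e i.+2 i.+1 - e (star i) (star i.+1)
  end.

Record is_Psi (Psi : alg_rep (Unat chi) (loop_module K N')) : Prop := IsPsi {
  Psi_K : forall i : ix, acts_as (Psi (nK chi (alpha ty n i))) (psiK i) 0;
  Psi_L : forall i : ix, acts_as (Psi (nL chi (alpha ty n i))) (psiL i) 0;
  Psi_E : forall i : ix,
    acts_as (Psi (nE chi i)) (psiE i) (if i == 0%N :> nat then 1 else 0);
  Psi_F : forall i : ix,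
    acts_as (Psi (nF chi i)) (psiF i) (if i == 0%N :> nat then -1 else 0);
  Psi_Kp : forall k m,
    Psi (nK chi (partial ty n)) (loop_vec K k m) = q ^ m *: loop_vec K k m;
  Psi_Lp : forall k m,
    Psi (nL chi (partial ty n)) (loop_vec K k m) = q ^ (- m) *: loop_vec K k m }.

End PsiMap.

(* Main.v *)
Require Import Defs.
From mathcomp Require Import all_boot all_order all_algebra.
From mathcomp Require Import ring zify.
From mathcomp.multinomials Require monalg.
Set Implicit Arguments.
Unset Strict Implicit.
Unset Printing Implicit Defensive.
Import GRing.Theory.
Local Open Scope ring_scope.

(* Let D_k be the derivation x |-> [x, F_k].  Only D_(i+1) and D_(N-i-1) act nontrivially
   on B_i and (for the indices shifted by one) on A_i, so that in Z at most two adjacent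
   summands contribute to D_k Z; the scalars a_i are chosen so that they cancel.  Hence Z
   commutes with every F_k.  Moreover chi(alpha_k, s delta) chi(s delta, alpha_k) = 1, so
   that Z is a lowest weight vector of weight 0 for the k-th rank one subalgebra.  If
   alpha_k is not isotropic, the Serre relations make the bracket with E_k nilpotent on Z,
   and a lowest weight vector of weight 0 on which it is nilpotent is killed by it.  If
   alpha_k is isotropic, [[Z, E_k]] = 0 is checked on each summand, using E_k^2 = 0 and
   the Serre relation of degree four.

   In the loop module the basis vectors form a cycle along which the E_k step backwards
   and the F_k forwards.  By degree, Z maps each e_c t^m to a multiple of e_c t^(m+s); as
   Z commutes with the F_k this multiple does not depend on c.  It is nonzero because only
   one path around the cycle contributes to the image of e_1 t^m. *)

(** The twisted bracket is not antisymmetric and satisfies only a twisted Jacobi identity, so most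
    commutation relations are not obtained by rearranging brackets. At a non-isotropic root they
    come from one principle: an ad-nilpotent element killed by [D_k] and of weight g at alpha_k is
    annihilated by the m-th iterated bracket with E_k as soon as g + m > 0. Weight 0 gives
    commutation, weight -1 a relation of Serre type such as [[[[B_j, E_j]], E_j]] = 0. The values of
    the [D_k] and the commutation relations are therefore established in alternation along the
    recursions. At an isotropic root, E_k^2 = 0 and the Serre relation of degree four take over, and
    they are applied to the innermost layer only.

    Cancellation between adjacent summands concerns k different from 0, n and N. At n, and at 0 for
    tau = 1, a single summand remains, with a coefficient that vanishes because the weight is 0. At
    0 and N for tau = 2 what remains is a combination of multiples of B_0^2 = 0. For tau = 4 it is
    cancelled by the term with B_(-1)^2, and this determines a_(-1). *)

(** * Equations in noncommutative algebras by normal forms *)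

Section NcNormalForm.
Variables (K : comNzRingType) (A : algType K).

Inductive nc_exp :=
| NcVar of nat | NcZero | NcOne | NcAdd of nc_exp & nc_exp | NcOpp of nc_exp
| NcMul of nc_exp & nc_exp | NcScale of K & nc_exp.

Fixpoint nc_denote (env : seq A) (e : nc_exp) : A :=
  match e with
  | NcVar i => nth 0 env i
  | NcZero => 0
  | NcOne => 1
  | NcAdd a b => nc_denote env a + nc_denote env b
  | NcOpp a => - nc_denote env a
  | NcMul a b => nc_denote env a * nc_denote env b
  | NcScale c a => c *: nc_denote env a
  end.

Definition nc_poly := seq (K * seq nat).

Definition nc_scale (c : K) (v : seq nat) (p : nc_poly) : nc_poly :=
  map (fun m => (c * m.1, v ++ m.2)) p.

Fixpoint nc_mul (p r : nc_poly) : nc_poly :=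
  if p is m :: p' then nc_scale m.1 m.2 r ++ nc_mul p' r else [::].

Fixpoint nc_norm (e : nc_exp) : nc_poly :=
  match e with
  | NcVar i => [:: (1, [:: i])]
  | NcZero => [::]
  | NcOne => [:: (1, [::])]
  | NcAdd a b => nc_norm a ++ nc_norm b
  | NcOpp a => nc_scale (-1) [::] (nc_norm a)
  | NcMul a b => nc_mul (nc_norm a) (nc_norm b)
  | NcScale c a => nc_scale c [::] (nc_norm a)
  end.

Definition nc_mon (env : seq A) (w : seq nat) : A := \prod_(i <- w) nth 0 env i.
Definition nc_eval (env : seq A) (p : nc_poly) : A :=
  \sum_(m <- p) m.1 *: nc_mon env m.2.

Lemma nc_eval_scale env c v p :
  nc_eval env (nc_scale c v p) = c *: (nc_mon env v * nc_eval env p).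
Proof.
rewrite /nc_eval big_map mulr_sumr scaler_sumr; apply: eq_bigr => m _ /=.
by rewrite /nc_mon big_cat /= -scalerAr scalerA.
Qed.

Lemma nc_eval_norm env e : nc_eval env (nc_norm e) = nc_denote env e.
Proof.
have mon0 : nc_mon env [::] = 1 by rewrite /nc_mon big_nil.
elim: e => [i|||a IHa b IHb|a IHa|a IHa b IHb|c a IHa] /=.
- by rewrite /nc_eval big_seq1 /nc_mon big_seq1 scale1r.
- by rewrite /nc_eval big_nil.
- by rewrite /nc_eval big_seq1 /= mon0 scale1r.
- by rewrite -IHa -IHb /nc_eval big_cat.
- by rewrite -IHa nc_eval_scale mon0 mul1r scaleN1r.
- rewrite -IHa -IHb; elim: (nc_norm a) => [|m p IHp] /=.
    by rewrite /nc_eval !big_nil mul0r.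
  rewrite /nc_eval big_cat -!/(nc_eval _ _) IHp nc_eval_scale.
  by rewrite [in RHS]/nc_eval big_cons mulrDl -scalerAl.
- by rewrite -IHa nc_eval_scale mon0 mul1r.
Qed.

(** Plain recursive tests, so that the fixed list of constants unfolded by [nc_coefs] decides
    equality of words while the coefficients in [K] stay untouched. *)
Fixpoint nc_eqn (m n : nat) : bool :=
  match m, n with 0, 0 => true | S m', S n' => nc_eqn m' n' | _, _ => false end.
Fixpoint nc_eqw (v w : seq nat) : bool :=
  match v, w with
  | [::], [::] => true
  | i :: v', j :: w' => if nc_eqn i j then nc_eqw v' w' else false
  | _, _ => false
  end.

Lemma nc_eqwP v w : nc_eqw v w = (v == w).
Proof.
have eqnP m n : nc_eqn m n = (m == n) by elim: m n => [|m IHm] [|n] //=.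
elim: v w => [|i v IHv] [|j w] //=; rewrite eqnP eqseq_cons -IHv.
by case: (i == j).
Qed.

Fixpoint nc_coef (w : seq nat) (p : nc_poly) : K :=
  if p is m :: p' then
    if nc_eqw m.2 w then m.1 + nc_coef w p' else nc_coef w p'
  else 0.
Fixpoint nc_remove (w : seq nat) (p : nc_poly) : nc_poly :=
  if p is m :: p' then
    if nc_eqw m.2 w then nc_remove w p' else m :: nc_remove w p'
  else [::].

(** Each round collects all occurrences of the first word, so the length of [p] is enough fuel [k];
    exhausted fuel gives [False], which keeps the test sound. The value is a conjunction of scalar
    equations, left to [ring] or [field]. *)
Fixpoint nc_zero (k : nat) (p : nc_poly) : Prop :=
  match k, p with
  | _, [::] => True
  | S k', m :: _ => nc_coef m.2 p = 0 /\ nc_zero k' (nc_remove m.2 p)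
  | 0, _ => False
  end.

Lemma nc_zeroP env k p : nc_zero k p -> nc_eval env p = 0.
Proof.
have split w r : nc_eval env r =
    nc_coef w r *: nc_mon env w + nc_eval env (nc_remove w r).
  elim: r => [|m r IHr] /=; first by rewrite /nc_eval !big_nil scale0r addr0.
  rewrite /nc_eval !big_cons -!/(nc_eval _ _) IHr nc_eqwP.
  case: eqP => [->|_]; first by rewrite scalerDl addrA.
  by rewrite /nc_eval big_cons addrCA.
elim: k p => [|k IHk] [|m p] //=; try by rewrite /nc_eval big_nil.
case=> cm /IHk; rewrite (split m.2 (m :: p)) /= => ->.
by rewrite cm scale0r addr0.
Qed.

Lemma nc_eq env e1 e2 :
  (let p := nc_norm (NcAdd e1 (NcOpp e2)) in nc_zero (size p) p) ->
  nc_denote env e1 = nc_denote env e2.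
Proof.
move=> /= /(nc_zeroP env) /=.
rewrite -/(nc_norm (NcAdd e1 (NcOpp e2))) nc_eval_norm /= => /eqP.
by rewrite subr_eq0 => /eqP.
Qed.

End NcNormalForm.

Ltac nc_index x env :=
  match env with
  | x :: _ => constr:(0%N)
  | _ :: ?env' => let i := nc_index x env' in constr:(S i)
  end.
Ltac nc_mem x env :=
  match env with
  | x :: _ => constr:(true)
  | _ :: ?env' => nc_mem x env'
  | _ => constr:(false)
  end.
Ltac nc_atoms env t :=
  lazymatch t with
  | @GRing.zero _ => env
  | @GRing.one _ => env
  | @GRing.add _ ?a ?b => let env' := nc_atoms env a in nc_atoms env' b
  | @GRing.opp _ ?a => nc_atoms env a
  | @GRing.mul _ ?a ?b => let env' := nc_atoms env a in nc_atoms env' b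
  | @GRing.scale _ _ _ ?a => nc_atoms env a
  | _ => lazymatch nc_mem t env with
         | true => env | false => constr:(t :: env) end
  end.
Ltac nc_reify K env t :=
  lazymatch t with
  | @GRing.zero _ => constr:(@NcZero K)
  | @GRing.one _ => constr:(@NcOne K)
  | @GRing.add _ ?a ?b =>
      let a' := nc_reify K env a in let b' := nc_reify K env b in
      constr:(NcAdd a' b')
  | @GRing.opp _ ?a => let a' := nc_reify K env a in constr:(NcOpp a')
  | @GRing.mul _ ?a ?b =>
      let a' := nc_reify K env a in let b' := nc_reify K env b in
      constr:(NcMul a' b')
  | @GRing.scale _ _ ?c ?a =>
      let a' := nc_reify K env a in constr:(@NcScale K c a')
  | _ => let i := nc_index t env in constr:(@NcVar K i)
  end.

(* Reduces an equation in an algebra to the equality of the coefficients of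
   the noncommutative monomials. *)
Ltac nc_coefs K A :=
  lazymatch goal with
  | |- ?l = ?r =>
      let env := nc_atoms (@nil A) l in
      let env := nc_atoms env r in
      let e1 := nc_reify K env l in
      let e2 := nc_reify K env r in
      apply: (@nc_eq K A env e1 e2);
      cbv [nc_norm nc_mul nc_scale nc_zero nc_coef nc_remove nc_eqw nc_eqn
           size map cat fst snd];
      repeat match goal with |- _ /\ _ => split | |- True => exact I end
  end.

(** * Bicharacters and the twisted bracket *)

Section Bichar.
Variables (K : fieldType) (ty : affine_type) (n : nat) (q : K).
Variables (chi : Vhat ty n -> Vhat ty n -> K) (chiP : bichar q chi).

Lemma chi_neq0 a b : chi a b != 0. Proof. exact: (bichar_neq0 chiP). Qed.
Lemma chiDl a b c : chi (a + b) c = chi a c * chi b c.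
Proof. exact: (bichar_Dl chiP). Qed.
Lemma chiDr a b c : chi a (b + c) = chi a b * chi a c.
Proof. exact: (bichar_Dr chiP). Qed.
Lemma chi0l c : chi 0 c = 1.
Proof. by apply: (mulfI (chi_neq0 0 c)); rewrite -chiDl addr0 mulr1. Qed.
Lemma chi0r c : chi c 0 = 1.
Proof. by apply: (mulfI (chi_neq0 c 0)); rewrite -chiDr addr0 mulr1. Qed.
Lemma chiNl a c : chi (- a) c = (chi a c)^-1.
Proof.
by apply: (mulfI (chi_neq0 a c)); rewrite -chiDl subrr chi0l divff // chi_neq0.
Qed.
Lemma chiNr a c : chi c (- a) = (chi c a)^-1.
Proof.
by apply: (mulfI (chi_neq0 c a)); rewrite -chiDr subrr chi0r divff // chi_neq0.
Qed.
Lemma chiMnl a c m : chi (a *+ m) c = chi a c ^+ m.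
Proof. by elim: m => [|m IHm]; rewrite ?chi0l // mulrS exprS chiDl IHm. Qed.
Lemma chiMnr a c m : chi c (a *+ m) = chi c a ^+ m.
Proof. by elim: m => [|m IHm]; rewrite ?chi0r // mulrS exprS chiDr IHm. Qed.

(** Conjugation by K_a L_a^-1 acts on elements of degree b as this scalar, so it plays the role of
    the weight of b at a. On simple roots it equals q^(2 (alpha_i, alpha_j)) and thus depends on the
    form only, which [chi] itself does not. *)
Definition chi2 (a b : Vhat ty n) : K := chi a b * chi b a.

Lemma chi2E a b : chi2 a b = chi a b * chi b a. Proof. by []. Qed.
Lemma chi2_neq0 a b : chi2 a b != 0.
Proof. by rewrite mulf_neq0 // chi_neq0. Qed.
Lemma chi2C a b : chi2 a b = chi2 b a. Proof. exact: mulrC. Qed.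
Lemma chi2Dr a b c : chi2 a (b + c) = chi2 a b * chi2 a c.
Proof. by rewrite /chi2 chiDl chiDr mulrACA. Qed.
Variable A : algType K.
Local Notation hom := (homog ty n A).
Local Notation br := (qbr chi).
Implicit Types X Y Z T : hom.

Lemma br_deg X Y : (br X Y).1 = X.1 + Y.1. Proof. by []. Qed.

Lemma brE X Y : (br X Y).2 = X.2 * Y.2 - (chi Y.1 X.1)^-1 *: (Y.2 * X.2).
Proof. by []. Qed.

Lemma br_eq0 X Y : (br X Y).2 = 0 <-> X.2 * Y.2 = (chi Y.1 X.1)^-1 *: (Y.2 * X.2).
Proof. by rewrite brE; split => [/eqP|->]; rewrite ?subrr // subr_eq0 => /eqP. Qed.

(** Both correction terms contain [[X, Z]]. When that bracket vanishes, X can be moved inside, which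
    is the form in which the identity is applied ([br_assoc]). *)
Lemma br_jacobi X Y Z :
  (br X (br Y Z)).2 = (br (br X Y) Z).2 + (chi Y.1 X.1)^-1 *: (Y.2 * (br X Z).2)
                      - (chi Z.1 Y.1)^-1 *: ((br X Z).2 * Y.2).
Proof.
case: X Y Z => [dx x] [dy y] [dz z]; rewrite /= !(chiDl, chiDr) !invfM.
by nc_coefs K A; ring.
Qed.

Lemma br_assoc X Y Z : (br X Z).2 = 0 -> (br X (br Y Z)).2 = (br (br X Y) Z).2.
Proof.
by move=> XZ; rewrite br_jacobi XZ mulr0 mul0r !scaler0 subr0 addr0.
Qed.

(* In general [[X, Y]] and [[Y, X]] are not proportional. *)
Lemma br_sym0 X Y : chi2 X.1 Y.1 = 1 -> (br X Y).2 = 0 -> (br Y X).2 = 0.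
Proof.
move=> c1 /br_eq0 XY; apply/br_eq0; rewrite XY scalerA -invfM.
by rewrite -/(chi2 X.1 Y.1) c1 invr1 scale1r.
Qed.

Lemma br_brl0 X Y Z : (br X Z).2 = 0 -> (br Y Z).2 = 0 -> (br (br X Y) Z).2 = 0.
Proof.
move=> /br_eq0 XZ /br_eq0 YZ; apply/br_eq0; rewrite /= chiDr.
rewrite mulrBl mulrBr -!scalerAl -!scalerAr -(mulrA X.2) YZ -(mulrA Y.2) XZ.
rewrite -!scalerAr !mulrA XZ YZ -!scalerAl scalerBr !scalerA invfM.
by congr (_ *: _ - _ *: _); ring.
Qed.

Lemma br_brr0 X Y Z : (br Z X).2 = 0 -> (br Z Y).2 = 0 -> (br Z (br X Y)).2 = 0.
Proof.
move=> /br_eq0 XZ /br_eq0 YZ; apply/br_eq0; rewrite /= chiDl.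
rewrite mulrBl mulrBr -!scalerAl -!scalerAr !mulrA XZ YZ -!scalerAl.
rewrite -(mulrA X.2) YZ -(mulrA Y.2) XZ -!scalerAr !mulrA scalerBr !scalerA invfM.
by congr (_ *: _ - _ *: _); ring.
Qed.

Lemma br0l X Y : X.2 = 0 -> (br X Y).2 = 0.
Proof. by rewrite /= => ->; rewrite mul0r mulr0 scaler0 subr0. Qed.
Lemma br0r X Y : Y.2 = 0 -> (br X Y).2 = 0.
Proof. by rewrite /= => ->; rewrite mul0r mulr0 scaler0 subr0. Qed.

End Bichar.

(** * One simple root: derivation, ad-nilpotency and lowest weight vectors *)

Section SimpleRoot.
Variables (K : fieldType) (ty : affine_type) (n : nat) (q : K).
Variables (chi : Vhat ty n -> Vhat ty n -> K) (chiP : bichar q chi).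
Variable A : algType K.
Local Notation hom := (homog ty n A).
Local Notation br := (qbr chi).
Local Notation chi2 := (chi2 chi).
Implicit Types X Y Z T : hom.
Variables (a : Vhat ty n) (e f k l k' l' : A).

Definition weightv X :=
  k * X.2 = chi a X.1 *: (X.2 * k) /\ l * X.2 = (chi X.1 a)^-1 *: (X.2 * l).
Definition der (x : A) : A := x * f - f * x.
Definition simE : hom := (a, e).

Hypothesis ef : e * f - f * e = - k + l.
Hypothesis kk' : k * k' = 1.
Hypothesis ll' : l * l' = 1.
Hypothesis wE : weightv simE.

Lemma weightv_br X Y : weightv X -> weightv Y -> weightv (br X Y).
Proof.
move=> [kX lX] [kY lY]; rewrite /weightv /=.
rewrite !mulrBr !mulrBl -!scalerAr -!scalerAl !mulrA kX kY lX lY -!scalerAl.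
rewrite -!(mulrA X.2) -!(mulrA Y.2) kX kY lX lY -!scalerAr !mulrA.
rewrite !scalerA (chiDl chiP) (chiDr chiP) !scalerBr !scalerA invfM.
by split; congr (_ *: _ - _ *: _); ring.
Qed.

Lemma weightvD d x y : weightv (d, x) -> weightv (d, y) -> weightv (d, x + y).
Proof.
rewrite /weightv /= => -[kx lx] [ky ly].
by rewrite !mulrDr !mulrDl kx ky lx ly !scalerDr.
Qed.

Lemma weightvZ d c x : weightv (d, x) -> weightv (d, c *: x).
Proof.
rewrite /weightv /= => -[kx lx].
by rewrite -!scalerAr -!scalerAl kx lx !scalerA ![c * _]mulrC.
Qed.

Lemma weightvM X Y : weightv X -> weightv Y -> weightv (X.1 + Y.1, X.2 * Y.2).
Proof.
move=> [kX lX] [kY lY]; rewrite /weightv /=.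
rewrite !mulrA kX lX -!scalerAl -!mulrA kY lY -!scalerAr !scalerA.
by rewrite (chiDl chiP) (chiDr chiP) invfM !mulrA.
Qed.

Lemma derM x y : der (x * y) = der x * y + x * der y.
Proof. by rewrite /der; nc_coefs K A; ring. Qed.
Lemma derD x y : der (x + y) = der x + der y.
Proof. by rewrite /der; nc_coefs K A; ring. Qed.
Lemma derZ c x : der (c *: x) = c *: der x.
Proof. by rewrite /der; nc_coefs K A; ring. Qed.
Lemma der_sum (I : Type) (r : seq I) (P : pred I) (G : I -> A) :
  der (\sum_(i <- r | P i) G i) = \sum_(i <- r | P i) der (G i).
Proof.
by apply: (big_morph der derD); rewrite /der mul0r mulr0 subrr.
Qed.
Lemma der_br X Y : der (br X Y).2 =
  (der X.2 * Y.2 - (chi Y.1 X.1)^-1 *: (Y.2 * der X.2))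
  + (X.2 * der Y.2 - (chi Y.1 X.1)^-1 *: (der Y.2 * X.2)).
Proof. by rewrite brE -scaleNr derD derZ !derM; nc_coefs K A; ring. Qed.

Lemma der_br0 X Y : der X.2 = 0 -> der Y.2 = 0 -> der (br X Y).2 = 0.
Proof. by rewrite der_br => -> ->; rewrite !(mul0r, mulr0, scaler0, subrr, addr0). Qed.

(** Four rules for brackets one of whose entries has derivative T l or T k. With l in the left
    entry, or k in the right one, moving it past Y produces exactly the twist of the bracket of T
    and Y. In the two other cases the twist is off by the inverse of [chi2 a Y.1], which is harmless
    when Y has weight 0. *)
Lemma der_brl_L c T X Y : X.1 = T.1 + a -> der X.2 = c *: (T.2 * l) ->
  der Y.2 = 0 -> weightv Y ->
  der (br X Y).2 = (c * (chi Y.1 a)^-1) *: ((br T Y).2 * l).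
Proof.
move=> dX DX DY [_ lY]; rewrite der_br DX DY dX (chiDr chiP).
rewrite -!scalerAl -!mulrA lY -!scalerAr !brE.
have := chi_neq0 chiP Y.1 T.1; have := chi_neq0 chiP Y.1 a.
move: (chi _ _) (chi _ _) => u v u0 v0.
by nc_coefs K A; field; rewrite ?u0 ?v0.
Qed.

Lemma der_brr_L c T X Y : X.1 = T.1 + a -> der X.2 = c *: (T.2 * l) ->
  der Y.2 = 0 -> weightv Y ->
  der (br Y X).2 = c *: ((Y.2 * T.2
     - ((chi T.1 Y.1)^-1 * (chi2 a Y.1)^-1) *: (T.2 * Y.2)) * l).
Proof.
move=> dX DX DY [_ lY]; rewrite der_br DX DY dX (chiDl chiP) /chi2.
rewrite -!scalerAl -!mulrA lY -!scalerAr.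
have := chi_neq0 chiP T.1 Y.1; have := chi_neq0 chiP Y.1 a.
have := chi_neq0 chiP a Y.1.
move: (chi _ _) (chi _ _) (chi _ _) => u v w u0 v0 w0.
by nc_coefs K A; field; rewrite ?u0 ?v0 ?w0.
Qed.

Lemma der_brr_K c T X Y : X.1 = T.1 + a -> der X.2 = c *: (T.2 * k) ->
  der Y.2 = 0 -> weightv Y -> der (br Y X).2 = c *: ((br Y T).2 * k).
Proof.
move=> dX DX DY [kY _]; rewrite der_br DX DY dX (chiDl chiP).
rewrite -!scalerAl -!mulrA kY -!scalerAr !brE.
have := chi_neq0 chiP T.1 Y.1; have := chi_neq0 chiP a Y.1.
move: (chi _ _) (chi _ _) => u v u0 v0.
by nc_coefs K A; field; rewrite ?u0 ?v0.
Qed.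

Lemma der_brl_K c T X Y : X.1 = T.1 + a -> der X.2 = c *: (T.2 * k) ->
  der Y.2 = 0 -> weightv Y ->
  der (br X Y).2 = (c * chi a Y.1) *: ((T.2 * Y.2
     - ((chi Y.1 T.1)^-1 * (chi2 a Y.1)^-1) *: (Y.2 * T.2)) * k).
Proof.
move=> dX DX DY [kY _]; rewrite der_br DX DY dX (chiDr chiP) /chi2.
rewrite -!scalerAl -!mulrA kY -!scalerAr.
have := chi_neq0 chiP Y.1 T.1; have := chi_neq0 chiP Y.1 a.
have := chi_neq0 chiP a Y.1.
move: (chi _ _) (chi _ _) (chi _ _) => u v w u0 v0 w0.
by nc_coefs K A; field; rewrite ?u0 ?v0 ?w0.
Qed.

(** The twist of the bracket with e is such that the k-part of der e = -k + l cancels and only l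
    survives, with a factor that is 0 when X has weight 0. For the left bracket k and l exchange
    roles. *)
Lemma der_brE_L c T X : X.1 = T.1 + a -> der X.2 = c *: (T.2 * l) -> weightv X ->
  der (br X simE).2 = (c * (chi a a)^-1) *: ((br T simE).2 * l)
                      + (1 - (chi2 a X.1)^-1) *: (X.2 * l).
Proof.
move=> dX DX [kX lX]; have [_ lE] := wE; rewrite der_br DX !brE /=.
have -> : der e = - k + l by [].
rewrite mulrDr mulrDl mulrN mulNr kX lX dX /chi2 !(chiDr chiP) !(chiDl chiP).
rewrite -!scalerAl -!mulrA lE /= -!scalerAr.
have := chi_neq0 chiP a T.1; have := chi_neq0 chiP T.1 a.
have := chi_neq0 chiP a a.
move: (chi _ _) (chi _ _) (chi _ _) => u v w u0 v0 w0.
by nc_coefs K A; field; rewrite ?u0 ?v0 ?w0.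
Qed.

Lemma der_Ebr_K c T X : X.1 = T.1 + a -> der X.2 = c *: (T.2 * k) -> weightv X ->
  der (br simE X).2 = c *: ((br simE T).2 * k)
                      + ((1 - chi2 a X.1) / chi X.1 a) *: (X.2 * k).
Proof.
move=> dX DX [kX lX]; have [kE _] := wE; rewrite der_br DX !brE /=.
have -> : der e = - k + l by [].
rewrite mulrDr mulrDl mulrN mulNr kX lX dX /chi2 !(chiDr chiP) !(chiDl chiP).
rewrite -!scalerAl -!mulrA kE /= -!scalerAr.
have := chi_neq0 chiP a T.1; have := chi_neq0 chiP T.1 a.
have := chi_neq0 chiP a a.
move: (chi _ _) (chi _ _) (chi _ _) => u v w u0 v0 w0.
by nc_coefs K A; field; rewrite ?u0 ?v0 ?w0.
Qed.

Lemma der_brE X : der X.2 = 0 -> weightv X ->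
  der (br X simE).2 = (1 - (chi2 a X.1)^-1) *: (X.2 * l).
Proof.
move=> DX wX; rewrite (@der_brE_L 0 (X.1 - a, 0)) ?mul0r ?scale0r ?add0r //=.
by rewrite subrK.
Qed.

Lemma der_Ebr X : der X.2 = 0 -> weightv X ->
  der (br simE X).2 = ((1 - chi2 a X.1) / chi X.1 a) *: (X.2 * k).
Proof.
move=> DX wX; rewrite (@der_Ebr_K 0 (X.1 - a, 0)) ?scale0r ?add0r //=.
by rewrite subrK.
Qed.

Definition adR X := br X simE.
Definition adL X := br simE X.

Lemma iter_adR_deg m X : (iter m adR X).1 = X.1 + a *+ m.
Proof. by elim: m => [|m IHm] /=; rewrite ?addr0 // IHm mulrSr addrA. Qed.
Lemma iter_adL_deg m X : (iter m adL X).1 = X.1 + a *+ m.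
Proof. by elim: m => [|m IHm] /=; rewrite ?addr0 // IHm mulrS addrCA. Qed.

Lemma iter_adR_lin m d c x y :
  (iter m adR (d, c *: x + y)).2 = c *: (iter m adR (d, x)).2 + (iter m adR (d, y)).2.
Proof.
elim: m => //= m IHm; rewrite IHm !iter_adR_deg /=.
by nc_coefs K A; ring.
Qed.
Lemma iter_adL_lin m d c x y :
  (iter m adL (d, c *: x + y)).2 = c *: (iter m adL (d, x)).2 + (iter m adL (d, y)).2.
Proof.
elim: m => //= m IHm; rewrite IHm !iter_adL_deg /=.
by nc_coefs K A; ring.
Qed.

Lemma iter_adR0 m d : (iter m adR (d, 0)).2 = 0.
Proof. by elim: m => // m IHm; rewrite iterS /adR br0l. Qed.
Lemma iter_adL0 m d : (iter m adL (d, 0)).2 = 0.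
Proof. by elim: m => // m IHm; rewrite iterS /adL br0r. Qed.

Lemma iter_adR_S m X : (iter m.+1 adR X).2 = (iter m adR (adR X)).2.
Proof. by rewrite iterSr. Qed.
Lemma iter_adL_S m X : (iter m.+1 adL X).2 = (iter m adL (adL X)).2.
Proof. by rewrite iterSr. Qed.

(* The q-Leibniz rule makes the ad-nilpotent elements a subalgebra. *)
Lemma iter_adR_mul s t X Y : (iter s adR X).2 = 0 -> (iter t adR Y).2 = 0 ->
  (iter (s + t) adR (X.1 + Y.1, X.2 * Y.2)).2 = 0.
Proof.
move: {2}(s + t)%N (erefl (s + t)%N) => m; elim: m s t X Y => [|m IHm] s t X Y.
  by move/eqP; rewrite addn_eq0 => /andP[/eqP-> /eqP->] /= -> _; rewrite mul0r.
case: s => [|s]; first by move=> _ /= -> _; rewrite mul0r iter_adR0.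
case: t => [|t]; first by move=> _ _ Y0; rewrite [Y.2]Y0 mulr0 iter_adR0.
move=> st Xs Yt; rewrite addSn iter_adR_S.
have -> : adR (X.1 + Y.1, X.2 * Y.2) = (X.1 + Y.1 + a,
    (chi a Y.1)^-1 *: ((adR X).2 * Y.2) + X.2 * (adR Y).2).
  rewrite /adR /qbr /= (chiDr chiP) invfM; congr (_, _).
  by move: (chi _ _)^-1 (chi _ _)^-1 => u v; nc_coefs K A; ring.
rewrite iter_adR_lin.
have -> : X.1 + Y.1 + a = (adR X).1 + Y.1 by rewrite /= addrAC.
rewrite IHm ?addSn -?iter_adR_S //; last by lia.
have -> : (adR X).1 + Y.1 = X.1 + (adR Y).1 by rewrite /= addrAC addrA.
by rewrite addnS -addSn IHm ?scaler0 ?addr0 -?iter_adR_S //; lia.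
Qed.

Lemma iter_adL_mul s t X Y : (iter s adL X).2 = 0 -> (iter t adL Y).2 = 0 ->
  (iter (s + t) adL (X.1 + Y.1, X.2 * Y.2)).2 = 0.
Proof.
move: {2}(s + t)%N (erefl (s + t)%N) => m; elim: m s t X Y => [|m IHm] s t X Y.
  by move/eqP; rewrite addn_eq0 => /andP[/eqP-> /eqP->] /= -> _; rewrite mul0r.
case: s => [|s]; first by move=> _ /= -> _; rewrite mul0r iter_adL0.
case: t => [|t]; first by move=> _ _ Y0; rewrite [Y.2]Y0 mulr0 iter_adL0.
move=> st Xs Yt; rewrite addSn iter_adL_S.
have -> : adL (X.1 + Y.1, X.2 * Y.2) = (a + X.1 + Y.1,
    (chi X.1 a)^-1 *: (X.2 * (adL Y).2) + (adL X).2 * Y.2).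
  rewrite /adL /qbr /= (chiDl chiP) invfM addrA; congr (_, _).
  by move: (chi _ _)^-1 (chi _ _)^-1 => u v; nc_coefs K A; ring.
rewrite iter_adL_lin.
have -> : a + X.1 + Y.1 = X.1 + (adL Y).1 by rewrite /= addrAC addrC.
rewrite addnS -addSn IHm ?scaler0 ?add0r -?iter_adL_S //; last by lia.
have -> : X.1 + (adL Y).1 = (adL X).1 + Y.1 by rewrite /= addrCA addrA.
by rewrite addSn -addnS IHm -?iter_adL_S //; lia.
Qed.

Definition nilR X := exists m, (iter m adR X).2 = 0.
Definition nilL X := exists m, (iter m adL X).2 = 0.

Lemma nilR_le s t X : (s <= t)%N -> (iter s adR X).2 = 0 -> (iter t adR X).2 = 0.
Proof.
move/subnK <-; elim: (t - s)%N => // m IHm Xs.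
by rewrite addSn iterS /adR br0l // IHm.
Qed.
Lemma nilL_le s t X : (s <= t)%N -> (iter s adL X).2 = 0 -> (iter t adL X).2 = 0.
Proof.
move/subnK <-; elim: (t - s)%N => // m IHm Xs.
by rewrite addSn iterS /adL br0r // IHm.
Qed.

Lemma nilR_lin d c x y : nilR (d, x) -> nilR (d, y) -> nilR (d, c *: x + y).
Proof.
move=> [s xs] [t yt]; exists (s + t)%N; rewrite iter_adR_lin.
by rewrite (nilR_le _ xs) ?leq_addr // (nilR_le _ yt) ?leq_addl // scaler0 addr0.
Qed.
Lemma nilL_lin d c x y : nilL (d, x) -> nilL (d, y) -> nilL (d, c *: x + y).
Proof.
move=> [s xs] [t yt]; exists (s + t)%N; rewrite iter_adL_lin.
by rewrite (nilL_le _ xs) ?leq_addr // (nilL_le _ yt) ?leq_addl // scaler0 addr0.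
Qed.

Lemma nilRM X Y : nilR X -> nilR Y -> nilR (X.1 + Y.1, X.2 * Y.2).
Proof. by move=> [s Xs] [t Yt]; exists (s + t)%N; exact: iter_adR_mul. Qed.
Lemma nilLM X Y : nilL X -> nilL Y -> nilL (X.1 + Y.1, X.2 * Y.2).
Proof. by move=> [s Xs] [t Yt]; exists (s + t)%N; exact: iter_adL_mul. Qed.

Lemma nilR_br X Y : nilR X -> nilR Y -> nilR (br X Y).
Proof.
move=> nX nY; rewrite /qbr [X in (_, X)]addrC -scaleNr.
apply: nilR_lin; last exact: nilRM.
by rewrite addrC; exact: nilRM.
Qed.
Lemma nilL_br X Y : nilL X -> nilL Y -> nilL (br X Y).
Proof.
move=> nX nY; rewrite /qbr [X in (_, X)]addrC -scaleNr.
apply: nilL_lin; last exact: nilLM.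
by rewrite addrC; exact: nilLM.
Qed.

Local Notation Q := (chi a a).
Hypothesis Q_not_root1 : forall m, (0 < m)%N -> Q ^+ m != 1.

Lemma Q_exprz_neq1 (g : int) : g != 0 -> Q ^ g != 1.
Proof.
case: g => m g0; last by rewrite NegzE -invr_expz invr_eq1 -exprnP Q_not_root1.
by rewrite -exprnP Q_not_root1 // lt0n.
Qed.

(* For a lowest weight vector X of weight g, the vectors ad^m X generate a
   Verma-like string: der (ad^(m+1) X) is a nonzero multiple of ad^m X as long
   as g + m > 0. *)
Lemma lowest_nilR (g : int) (m : nat) X :
  weightv X -> der X.2 = 0 -> chi2 a X.1 = Q ^ g -> nilR X -> (0 < g + m%:Z) ->
  (iter m adR X).2 = 0.
Proof.
move=> wX DX sX [t Xt] gm.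
have Q0 : Q != 0 := chi_neq0 chiP a a.
have Q1 : Q != 1 by have := Q_not_root1 (isT : (0 < 1)%N); rewrite expr1.
(* With s = [chi2 a X.1], this is the closed form of the recursion c_0 = 1 - s^-1, c_(j+1) = c_j
   Q^-1 + 1 - (s Q^(2j+2))^-1 provided by [der_brE_L]. *)
set c := fun j : nat => (1 - Q ^- j.+1) * (1 - (chi2 a X.1)^-1 * Q ^- j) / (1 - Q^-1).
have w_iter j : weightv (iter j adR X).
  by elim: j => // j IHj; rewrite iterS; apply: weightv_br.
have D_iter j : der (iter j.+1 adR X).2 = c j *: ((iter j adR X).2 * l).
  have s0 := chi2_neq0 chiP a X.1.
  elim: j => [|j IHj].
    rewrite /= der_brE // /c expr1 expr0 invr1 mulr1; congr (_ *: _).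
    by rewrite mulrAC mulfV ?mul1r // subr_eq0 eq_sym invr_eq1.
  rewrite iterS (der_brE_L _ IHj) //.
  rewrite -/(adR _) -iterS -scalerDl; congr (_ *: _).
  rewrite iter_adR_deg (chi2Dr chiP) {2}/chi2 (chiMnl chiP) (chiMnr chiP) /c.
  rewrite !exprS; move: (chi2 _ _) s0 => s s0; set u := Q ^+ j.
  have u0 : u != 0 by rewrite expf_neq0.
  by field; rewrite u0 s0 Q0 /= subr_eq0 Q1.
have c0 j : (m <= j)%N -> c j != 0.
  move=> mj; rewrite /c !mulf_neq0 // ?invr_eq0 subr_eq0 eq_sym.
  - by rewrite invr_eq1 Q_not_root1.
  - rewrite sX -invfM invr_eq1 exprnP -expfzDr // Q_exprz_neq1 //; lia.
  - by rewrite invr_eq1.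
(* Descent from the known nilpotency order: if ad^(t+1) X = 0, then applying [der] gives c_t ad^t X
   l = 0, and for t >= m both c_t and l can be removed. *)
elim: t Xt => [|t IHt] Xt.
  exact: (nilR_le (leq0n m) Xt).
case: (leqP m t) => [mt|]; last by move=> tm; exact: (nilR_le tm Xt).
apply: IHt; have := D_iter t; rewrite Xt /der mul0r mulr0 subrr => /esym/eqP.
rewrite scaler_eq0 (negPf (c0 _ mt)) /= => /eqP Dl.
by rewrite -[LHS]mulr1 -ll' mulrA Dl mul0r.
Qed.

Lemma lowest_nilL (g : int) (m : nat) X :
  weightv X -> der X.2 = 0 -> chi2 a X.1 = Q ^ g -> nilL X -> (0 < g + m%:Z) ->
  (iter m adL X).2 = 0.
Proof.
move=> wX DX sX [t Xt] gm.
have Q0 : Q != 0 := chi_neq0 chiP a a.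
have Q1 : Q != 1 by have := Q_not_root1 (isT : (0 < 1)%N); rewrite expr1.
set c := fun j : nat =>
  (1 - Q ^+ j.+1) * (1 - chi2 a X.1 * Q ^+ j) / (1 - Q) * Q ^- j / chi X.1 a.
have w_iter j : weightv (iter j adL X).
  by elim: j => // j IHj; rewrite iterS; apply: weightv_br.
have D_iter j : der (iter j.+1 adL X).2 = c j *: ((iter j adL X).2 * k).
  have s0 := chi2_neq0 chiP a X.1; have x0 := chi_neq0 chiP X.1 a.
  elim: j => [|j IHj].
    rewrite /= der_Ebr // /c expr1 expr0 invr1 !mulr1; congr (_ *: _).
    by rewrite [_ * _ / (1 - Q)]mulrAC mulfV ?mul1r // subr_eq0 eq_sym.
  rewrite iterS (der_Ebr_K _ IHj) //; last by rewrite !iter_adL_deg mulrSr addrA.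
  rewrite -/(adL _) -iterS -scalerDl; congr (_ *: _).
  rewrite iter_adL_deg (chi2Dr chiP) {2}/chi2 (chiDl chiP) !(chiMnl chiP).
  rewrite (chiMnr chiP) /c !exprS.
  move: (chi2 _ _) (chi X.1 a) s0 x0 => s x s0 x0; set u := Q ^+ j.
  have u0 : u != 0 by rewrite expf_neq0.
  by field; rewrite u0 x0 Q0 /= subr_eq0 eq_sym Q1.
have c0 j : (m <= j)%N -> c j != 0.
  move=> mj; rewrite /c !mulf_neq0 // ?invr_eq0 ?expf_neq0 ?(chi_neq0 chiP) //.
  - by rewrite subr_eq0 eq_sym Q_not_root1.
  - by rewrite subr_eq0 eq_sym sX exprnP -expfzDr // Q_exprz_neq1 //; lia.
  - by rewrite subr_eq0 eq_sym.
elim: t Xt => [|t IHt] Xt.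
  exact: (nilL_le (leq0n m) Xt).
case: (leqP m t) => [mt|]; last by move=> tm; exact: (nilL_le tm Xt).
apply: IHt; have := D_iter t; rewrite Xt /der mul0r mulr0 subrr => /esym/eqP.
rewrite scaler_eq0 (negPf (c0 _ mt)) /= => /eqP Dl.
by rewrite -[LHS]mulr1 -kk' mulrA Dl mul0r.
Qed.

End SimpleRoot.

(** * Values of the form on the simple roots *)

Section RootForms.
Variables (ty : affine_type) (n : nat).
Local Notation N := (rkN n).
Local Notation form := (@Defs.form ty n).
Local Notation eps := (epsV n).
Local Notation d := (sgn_d ty n).

Lemma formDl x y z : form (x + y : latV n) z = form x z + form y z.
Proof.
rewrite /Defs.form -!/GRing.add /= !mulrDl.
under eq_bigr => k _ do rewrite ffunE !mulrDl.
by rewrite big_split /=; ring.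
Qed.
Lemma formC (x y : latV n) : form x y = form y x.
Proof.
rewrite /Defs.form; under eq_bigr => k _ do rewrite (mulrC (x.1.1 k)).
by rewrite [x.1.2 * _]mulrC [x.2 * _]mulrC -!addrA [_ * _ + _ * _]addrC.
Qed.
Lemma formDr x y z : form z (x + y : latV n) = form z x + form z y.
Proof. by rewrite formC formDl !(formC z). Qed.
Lemma form0r z : form z (0 : latV n) = 0.
Proof. by apply: (addrI (form z 0)); rewrite -formDr !addr0. Qed.
Lemma formNr x z : form z (- x : latV n) = - form z x.
Proof. by apply: (addrI (form z x)); rewrite -formDr !subrr form0r. Qed.
Lemma formNl x z : form (- x : latV n) z = - form x z.
Proof. by rewrite formC formNr formC. Qed.

Lemma form_eps a b : (0 < a <= N)%N -> form (eps a) (eps b) = if a == b then d a else 0.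
Proof.
move=> aN; rewrite /Defs.form /= ?mulr0 ?mul0r ?addr0.
have a1 : (a.-1 < N)%N by lia.
rewrite (bigD1 (Ordinal a1)) //= big1 => [|k].
  rewrite !ffunE /= prednK; last by case/andP: aN.
  by rewrite eqxx mul1r addr0; case: (eqVneq a b) => _; rewrite ?mul1r ?mul0r.
rewrite -val_eqE /= ffunE => ka; have -> : (k.+1 == a) = false by lia.
by rewrite !mul0r.
Qed.
Lemma form_delta a : form (deltaV n) (eps a) = 0.
Proof.
rewrite /Defs.form /= ?mulr0 ?mul0r ?addr0 big1 // => k _.
by rewrite ffunE !mul0r.
Qed.
Lemma form_deltadelta : form (deltaV n) (deltaV n) = 0.
Proof.
rewrite /Defs.form /= ?mulr0 ?mul0r ?addr0 big1 // => k _.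
by rewrite ffunE !mul0r.
Qed.

End RootForms.

Section RootCoef.
Variables (ty : affine_type) (n : nat).
Local Notation N := (rkN n).
Local Notation form := (@Defs.form ty n).
Local Notation eps := (epsV n).
Local Notation d := (sgn_d ty n).

(* The coefficient of epsilon_a in alpha_i. *)
Definition root_coef (i a : nat) : int :=
  if i == 0%N then
    match ty with
    | Tau1 => (if a == N then 1 else 0) - (if a == 1%N then 1 else 0)
    | Tau2 => if a == 1%N then - 2 else 0
    | Tau4 => if a == 1%N then - 1 else 0
    end
  else if (i < N)%N then (if a == i then 1 else 0) - (if a == i.+1 then 1 else 0)
  else if ty is Tau2 then (if a == N then 2 else 0) else (if a == N then 1 else 0).

Lemma form_root i a : (0 < a <= N)%N -> form (rootV ty n i) (eps a) = root_coef i a * d a.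
Proof.
move=> aN; rewrite /root_coef /rootV.
have fe b : form (eps b) (eps a) = if a == b then d a else 0.
  by rewrite formC form_eps.
case: eqP => _; [|case: ifP => _]; case: ty fe => fe;
  rewrite ?mulr2n ?opprD ?(formDl, formNl, form_delta, fe) ?add0r ?addr0;
  by do ?case: eqP => _; ring.
Qed.

Lemma form_root_delta i : form (rootV ty n i) (deltaV n) = 0.
Proof.
rewrite formC /rootV; case: eqP => _; [|case: ifP => _]; case: ty;
  by rewrite ?mulr2n ?opprD ?(formDr, formNr, form_delta, form_deltadelta)
             ?oppr0 ?addr0.
Qed.

End RootCoef.

(** Turns each value of the form into a small expression in integer conditionals, so that [bil_lia]
    can settle it by splitting on the index comparisons. *)
Lemma bilE ty n i j : (0 < n)%N -> bil ty n i j =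
  let c := root_coef ty n i in let d := sgn_d ty n in let N := rkN n in
  if j == 0%N then
    match ty with
    | Tau1 => c N * d N - c 1%N * d 1%N
    | Tau2 => - (2 * (c 1%N * d 1%N))
    | Tau4 => - (c 1%N * d 1%N)
    end
  else if (j < N)%N then c j * d j - c j.+1 * d j.+1
  else if ty is Tau2 then 2 * (c N * d N) else c N * d N.
Proof.
move=> n0; have N1 : (0 < 1 <= rkN n)%N by rewrite /rkN; lia.
have NN : (0 < rkN n <= rkN n)%N by rewrite /rkN; lia.
rewrite /bil {2}/rootV; case: eqP => [_|j0].
  by case: ty; rewrite ?mulr2n ?opprD ?(formDr, formNr) ?form_root_delta !form_root //;
     ring.
case: ifP => jN'; first by rewrite formDr formNr !form_root //; lia.
by case: ty; rewrite ?mulr2n ?formDr form_root //; ring.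
Qed.

Ltac bil_lia :=
  rewrite ?bilE /root_coef /sgn_d //; unfold rkN in *; try lia;
  repeat (match goal with |- context [if ?b then _ else _] => case: (boolP b) => ? end;
          try lia).

Section RootValues.
Variables (ty : affine_type) (n : nat).
Hypothesis n_ge : (if ty is Tau4 then 1 <= n else 2 <= n)%N.
Local Notation N := (rkN n).
Local Notation Nh := (rkNhat ty n).
Local Notation bl := (bil ty n).

Lemma n_gt0 : (0 < n)%N. Proof. by case: ty n_ge => /=; lia. Qed.

(** Even stands for non-isotropic: the isotropic simple roots are alpha_n and, for tau = 1, also
    alpha_0. *)
Definition even_root (k : nat) : bool :=
  (k != n) && (if ty is Tau1 then k != 0%N else true).

Lemma even_rootE k :
  even_root k = (k != n) && (if ty is Tau1 then k != 0%N else true).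
Proof. by []. Qed.

Lemma rkNhat_le : (Nh <= N)%N.
Proof. by rewrite /rkNhat; case: ty => //; lia. Qed.

Lemma bil_far i j : (i.+1 < j)%N -> (j <= Nh)%N ->
  (if ty is Tau1 then ~~ ((i == 0%N) && (j == N.-1)) else true) -> bl i j = 0.
Proof.
have n0 := n_gt0; have := rkNhat_le; rewrite /rkNhat /rkN; case: ty n_ge => n1 _ ij jN far;
bil_lia.
Qed.

Lemma bilC i j : bl i j = bl j i. Proof. exact: formC. Qed.

Lemma bil_even k : (k <= Nh)%N -> even_root k -> bl k k != 0.
Proof.
have n0 := n_gt0; rewrite /even_root /rkNhat /rkN; case: ty n_ge => n1 kN ek; bil_lia.
Qed.

Lemma bil_odd k : (k <= Nh)%N -> ~~ even_root k -> bl k k = 0.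
Proof.
have n0 := n_gt0; rewrite /even_root /rkNhat /rkN; case: ty n_ge => n1 kN ek; bil_lia.
Qed.

Lemma bil_serre k j : (k <= Nh)%N -> (j <= Nh)%N -> even_root k -> j != k ->
  [\/ bl k j = 0, - (2 * bl k j) = bl k k | - bl k j = bl k k].
Proof.
have n0 := n_gt0; move=> kN jN ek jk.
suff: [|| bl k j == 0, - (2 * bl k j) == bl k k | - bl k j == bl k k].
  by case/or3P => /eqP; [constructor 1|constructor 2|constructor 3].
move: kN jN ek jk; rewrite /even_root /rkNhat /rkN.
case: ty n_ge => n1 kN jN ek jk; bil_lia.
Qed.

(** These are the hypotheses of the degree-four Serre relation at alpha_n. For n = 1, which occurs
    for tau = 4 only, the two neighbours are alpha_0 and alpha_N. *)
Lemma bil_n_neighbours : [/\ bl n.+1 n.-1 = 0, - bl n n.+1 = bl n n.-1 & bl n n.-1 != 0].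
Proof.
have n0 := n_gt0; case: ty n_ge => n1; split; bil_lia.
Qed.

(* The pairing of alpha_k with epsilon_(i+1) - epsilon_(N-i), the degree of B_i. *)
Definition wB (k i : nat) : int :=
  root_coef ty n k i.+1 * sgn_d ty n i.+1 - root_coef ty n k (N - i) * sgn_d ty n (N - i).

Lemma wBE k i : wB k i =
  root_coef ty n k i.+1 * sgn_d ty n i.+1 - root_coef ty n k (N - i) * sgn_d ty n (N - i).
Proof. by []. Qed.

Lemma wB_mid k i : (0 < k < N)%N -> k != i -> k != i.+1 -> k != (N - i)%N ->
  k != (N - i.+1)%N -> wB k i = 0.
Proof. by move=> k0 k1 k2 k3 k4; rewrite /wB; case: ty; bil_lia. Qed.

Lemma wB_pair j : (0 < j < n)%N ->
  [/\ wB j j.-1 = - wB j j, wB (N - j) j.-1 = wB j j & wB (N - j) j = - wB j j].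
Proof.
have n0 := n_gt0; move=> jn; rewrite /wB; case: ty n_ge => n1; split; bil_lia.
Qed.

(** In units of (alpha, alpha)/2 per [chi2]-exponent this is what makes B_j of weight -1 at alpha_j
    and, through [wB_pair], also at alpha_(N-j): the case in which the square of the bracket
    operator vanishes. *)
Lemma wB_diag j : (0 < j < n)%N ->
  2 * wB j j = - bl j j /\ 2 * wB j j = bl (N - j) (N - j).
Proof.
have n0 := n_gt0; move=> jn; rewrite /wB; case: ty n_ge => n1; split; bil_lia.
Qed.

Lemma wB_n : wB n n.-1 = 0.
Proof. have n0 := n_gt0; rewrite /wB; case: ty n_ge => n1; bil_lia. Qed.

Lemma wB_0N : ty <> Tau1 -> wB N 0 = - wB 0 0.
Proof. have n0 := n_gt0; rewrite /wB; case: ty n_ge => n1 n2; bil_lia. Qed.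

Lemma wB_00_Tau1 : ty = Tau1 -> wB 0 0 = 0.
Proof. move=> tE; have n0 := n_gt0; move: n_ge; rewrite /wB tE => n1; bil_lia. Qed.

Lemma bil_0N_Tau4 : ty = Tau4 -> bl 0 0 = - bl N N.
Proof. move=> tE; have n0 := n_gt0; move: n_ge; rewrite tE => n1; bil_lia. Qed.

(** The sum is the pairing of alpha_k with the degree of B_(-1). For tau = 2 that degree is delta -
    epsilon_1 + epsilon_N, which is not orthogonal to alpha_1 and alpha_(N-1); for tau = 4 it is
    delta, and no range restriction arises. *)
Lemma wW_mid k : ty = Tau2 -> (1 < k < N.-1)%N -> bl k N + wB k 0 + bl k 0 = 0.
Proof. move=> tE; have n0 := n_gt0; move: n_ge; rewrite /wB tE => n1 k1; bil_lia. Qed.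

Lemma wW4 k : ty = Tau4 -> (k <= N)%N -> bl k N + wB k 0 + bl k 0 = 0.
Proof. move=> tE; have n0 := n_gt0; move: n_ge; rewrite /wB tE => n1 k1; bil_lia. Qed.

Lemma bil_0_neighbours : ty = Tau1 ->
  [/\ bl N.-1 1 = 0, - bl 0 N.-1 = bl 0 1 & bl 0 1 != 0].
Proof.
move=> tE; have n0 := n_gt0; move: n_ge; rewrite tE => n1; split; bil_lia.
Qed.

End RootValues.

(** * The defining relations in the quotient algebra *)

Section NatRelations.
Variables (K : fieldType) (ty : affine_type) (n : nat) (q : K).
Variables (chi : Vhat ty n -> Vhat ty n -> K) (chiP : bichar q chi).
Local Notation N := (rkN n).
Local Notation Nh := (rkNhat ty n).
Local Notation U := (Unat chi).
Local Notation hom := (homog ty n U).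
Local Notation br := (qbr chi).
Local Notation al := (alpha ty n).
Local Notation bl := (bil ty n).
Local Notation E := (nEh chi).
Implicit Types X Y Z T : hom.

Definition nFk (k : nat) : U := nF chi (inord k).
Definition nKk (k : nat) : U := nK chi (al k).
Definition nLk (k : nat) : U := nL chi (al k).

Lemma nKV k : nKk k * nK chi (- al k) = 1.
Proof. by rewrite /nKk /nK -rmorphM tKK subrr tK0 rmorph1. Qed.
Lemma nLV k : nLk k * nL chi (- al k) = 1.
Proof. by rewrite /nLk /nL -rmorphM tLL subrr tL0 rmorph1. Qed.

Lemma nKE a (i : idx ty n) : nK chi a * nE chi i = chi a (al i) *: (nE chi i * nK chi a).
Proof.
rewrite /nK /nE -rmorphM -[in LHS](mulr1 (_ * _)) -(tK0 chi) -(addNr a) -tKK mulrA tKE.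
by rewrite -scalerAl /= linearZ rmorphM.
Qed.
Lemma nLE a (i : idx ty n) : nL chi a * nE chi i = (chi (al i) a)^-1 *: (nE chi i * nL chi a).
Proof.
rewrite /nL /nE -rmorphM -[in LHS](mulr1 (_ * _)) -(tL0 chi) -(addNr a) -tLL mulrA tLE.
by rewrite -scalerAl /= linearZ rmorphM (chiNl chiP).
Qed.

Lemma nEF (i j : idx ty n) : nE chi i * nF chi j - nF chi j * nE chi i =
  if i == j then - nK chi (al i) + nL chi (al i) else 0.
Proof.
have := congr1 (@nat_proj K ty n chi) (tEF chi i j); rewrite rmorphB !rmorphM /= => ->.
by case: eqP => _; rewrite ?rmorph0 // rmorphD rmorphN.
Qed.

Definition nat_hom (X : homog ty n (Utilde chi)) : hom := (X.1, nat_proj X.2).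

Lemma nat_hom_br (X Y : homog ty n (Utilde chi)) : nat_hom (br X Y) = br (nat_hom X) (nat_hom Y).
Proof.
by case: X Y => [dx x] [dy y]; rewrite /nat_hom /qbr /= rmorphB /= linearZ !rmorphM.
Qed.

Lemma nat_serre x : serre (chi := chi) x -> nat_proj x = 0.
Proof.
move=> sx; apply: Jnat_eq0; exists x, 0; split; last by rewrite addr0.
  rewrite -[x]scale1r -[_ *: _]addr0; apply: LinSpanP; last exact: LinSpan0.
  exists 1, 1, x; split; rewrite ?mul1r //; try exact: Subalg1.
  by rewrite -[x]mul1r -[1 * x]mulr1; apply: IdealGenM => //; exact: Subalg1.
exact: LinSpan0.
Qed.

Lemma inord_neq i j : (i <= Nh)%N -> (j <= Nh)%N -> i != j ->
  inord i != inord j :> idx ty n.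
Proof. by move=> iN jN; rewrite -val_eqE /= !inordK. Qed.

Lemma E_inord k : (k <= Nh)%N -> E k = nat_hom (tEh chi (inord k)).
Proof. by move=> kN; rewrite /nat_hom /= inordK. Qed.

Lemma E_commute i j : (i <= Nh)%N -> (j <= Nh)%N -> bl i j = 0 -> (br (E i) (E j)).2 = 0.
Proof.
move=> iN jN b0; rewrite !E_inord // -nat_hom_br; apply: nat_serre.
by apply: Serre2; rewrite !inordK.
Qed.

Lemma E_serre3 i j : (i <= Nh)%N -> (j <= Nh)%N -> i != j ->
  - (2 * bl i j) = bl i i -> bl i i != 0 -> (br (E i) (br (E i) (E j))).2 = 0.
Proof.
move=> iN jN ij b2 b0; rewrite !E_inord //.
have S3 := @Serre3 _ _ _ chi (inord i) (inord j); rewrite !inordK // in S3.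
have := nat_serre (S3 (inord_neq iN jN ij) b2 b0).
by move: (tEh _ _) (tEh _ _) => X Y; rewrite -!nat_hom_br.
Qed.

Lemma E_serre4 i j : (i <= Nh)%N -> (j <= Nh)%N -> i != j ->
  - bl i j = bl i i -> bl i i != 0 -> (br (E i) (br (E i) (br (E i) (E j)))).2 = 0.
Proof.
move=> iN jN ij b2 b0; rewrite !E_inord //.
have S3 := @Serre4 _ _ _ chi (inord i) (inord j); rewrite !inordK // in S3.
have := nat_serre (S3 (inord_neq iN jN ij) b2 b0).
by move: (tEh _ _) (tEh _ _) => X Y; rewrite -!nat_hom_br.
Qed.

Lemma E_super i j k : (i <= Nh)%N -> (j <= Nh)%N -> (k <= Nh)%N ->
  [/\ i != j, i != k & j != k] -> bl i i = 0 -> bl j k = 0 -> - bl i j = bl i k ->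
  bl i k != 0 -> (br (br (E i) (E j)) (br (E i) (E k))).2 = 0.
Proof.
move=> iN jN kN [ij ik jk] bi bjk bij b0; rewrite !E_inord //.
have S3 := @SerreSuper _ _ _ chi (inord i) (inord j) (inord k).
rewrite !inordK // in S3.
have := nat_serre (S3 (And3 (inord_neq iN jN ij) (inord_neq iN kN ik)
                            (inord_neq jN kN jk)) bi bjk bij b0).
by move: (tEh _ _) (tEh _ _) (tEh _ _) => X Y Z; rewrite -!nat_hom_br.
Qed.

Lemma nEF_eq i j : (i <= Nh)%N -> (j <= Nh)%N ->
  (E i).2 * nFk j - nFk j * (E i).2 = if i == j then - nKk i + nLk i else 0.
Proof.
move=> iN jN; rewrite nEF -val_eqE /= !inordK //.
Qed.

End NatRelations.

(** * The loop module as a labelled cycle *)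

Lemma loop_vec_neq0 (K : fieldType) (d : nat) (c : 'I_d) (m : int) : loop_vec K c m != 0.
Proof.
apply/eqP => /(congr1 (monalg.mcoeff (c, m))).
by rewrite /loop_vec monalg.mcoeffU eqxx monalg.mcoeff0 => /eqP; rewrite oner_eq0.
Qed.

Lemma val_iter_ord_pred d h (c : 'I_d) :
  iter h (@ord_pred d) c = ((c + h * d.-1) %% d)%N :> nat.
Proof.
have d0 : (0 < d)%N by case: d c => // -[].
elim: h => [|h IHh]; first by rewrite mul0n addn0 modn_small.
rewrite iterS /= IHh -subn1 -addnBA // subn1 modnDml; congr (_ %% _)%N.
by rewrite mulSn; lia.
Qed.

Lemma iter_ord_pred_period d (c : 'I_d) : iter d (@ord_pred d) c = c.
Proof.
apply: val_inj; rewrite /= val_iter_ord_pred addnC mulnC modnMDl modn_small //.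
Qed.

Lemma val_iter_ord_pred_le d h (c : 'I_d) : (h <= c)%N -> iter h (@ord_pred d) c = (c - h)%N :> nat.
Proof.
move=> hc; rewrite val_iter_ord_pred; have d0 : (0 < d)%N by case: d c hc => // -[].
have -> : (c + h * d.-1 = h * d + (c - h))%N.
  by case: d c hc d0 => // d c hc _; rewrite mulnS /=; lia.
by rewrite modnMDl modn_small //; apply: leq_ltn_trans (leq_subr _ _) (ltn_ord c).
Qed.

Lemma val_iter_ord_pred_gt d h (c : 'I_d) : (c < h <= d)%N ->
  iter h (@ord_pred d) c = (d + c - h)%N :> nat.
Proof.
case/andP=> ch hd; rewrite val_iter_ord_pred; have d0 : (0 < d)%N by case: d c ch hd => // -[].
have -> : (c + h * d.-1 = h.-1 * d + (d + c - h))%N.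
  case: d c ch hd d0 => // d c ch hd _; case: h ch hd => // h ch hd.
  by rewrite /= mulnS mulSn; lia.
by rewrite modnMDl modn_small //; lia.
Qed.

(* The basis vectors of K^N' lie on a cycle on which every E_i steps backwards and
   every F_i forwards; the label of c is the index i for which E_i sends e_(c+1) to
   a nonzero multiple of e_c (or of e_N' when c = 0). *)
Definition path_label (ty : affine_type) (n c : nat) : nat :=
  match ty with
  | Tau1 => c
  | Tau2 => if (c <= rkN n)%N then c else ((rkN n).*2 - c)%N
  | Tau4 => if c == 0%N then 0%N else
            if (c <= (rkN n).+1)%N then c.-1 else ((rkN n).*2.+2 - c)%N
  end.

Lemma path_label0 ty n : path_label ty n 0 = 0%N.
Proof. by case: ty. Qed.

Lemma path_label1 ty n : (0 < n)%N -> path_label ty n 1 = (if ty is Tau4 then 0 else 1)%N.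
Proof. by move=> n0; case: ty; rewrite //= /rkN; case: ifP => //; lia. Qed.

Lemma path_label_asc ty n t : ty <> Tau1 -> (0 < t <= rkN n)%N ->
  path_label ty n (rkN' ty n - t) = t.
Proof.
case: ty => // _ tN; rewrite /path_label /rkN'; first by case: ifP => ?; lia.
by do 2?[case: ifP => ?]; lia.
Qed.

Lemma path_label_desc ty n t : ty <> Tau4 -> (t < (rkN n).-1)%N ->
  path_label ty n ((rkN n).-1 - t) = ((rkN n).-1 - t)%N.
Proof. by case: ty => // _ tN; rewrite /path_label; case: ifP => ?; lia. Qed.

Lemma path_label_desc4 n t : (t <= rkN n)%N ->
  path_label Tau4 n ((rkN n).+1 - t) = (rkN n - t)%N.
Proof. by move=> tN; rewrite /path_label; do 2?[case: ifP => ?]; lia. Qed.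

Lemma val_ord_pred d (c : 'I_d) : ord_pred c = (if c == 0%N :> nat then d.-1 else c.-1) :> nat.
Proof.
have d0 : (0 < d)%N by case: d c => // -[].
have cd := ltn_ord c; rewrite /=; case: eqP => [->|c0].
  by rewrite add0n modn_small //; lia.
have -> : ((c + d).-1 = d + c.-1)%N by lia.
by rewrite modnDl modn_small //; lia.
Qed.

Lemma path_label_le ty n (c : 'I_(rkN' ty n)) : (0 < n)%N -> (path_label ty n c <= rkNhat ty n)%N.
Proof.
move=> n0; case: ty c => -[c /=]; rewrite /rkN' /rkNhat /rkN; try lia.
  by case: ifP; lia.
by do 2?[case: ifP]; lia.
Qed.

Ltac munit_cases :=
  rewrite !mxE;
  repeat match goal with |- context [nat_of_bool (?b && ?b2)] =>
    case: (boolP (b && b2)) => ?; try lia end.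

Definition prevn (d c : nat) : nat := if c == 0%N then d.-1 else c.-1.

(** Every matrix unit occurring in E_i is an edge of the cycle with label i, and when there are two
    of them they sit in different columns. Hence each column has at most one nonzero entry, and E_i
    sends basis vectors to multiples of basis vectors; [psiF_off] is the same fact for F_i. *)
Lemma psiE_off (K : fieldType) ty n (q : K) chi z u (i : idx ty n) (a c : 'I_(rkN' ty n)) :
  (0 < n)%N -> ~~ ((path_label ty n c == i) && (a == prevn (rkN' ty n) c :> nat)) ->
  psiE q chi z u i a c = 0.
Proof.
have N_n : rkN n = n.*2 by [].
move=> n0; have := ltn_ord a; have := ltn_ord c; have := ltn_ord i; move: chi z u i a c.
case: ty => chi z u i a c; rewrite /path_label /prevn.
- have P_n : rkN' Tau1 n = n.*2 by [].
  have Nh_n : rkNhat Tau1 n = n.*2.-1 by [].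
  do 3?[case: ifP => ?]; rewrite /psiE; case: ifP => ? *; munit_cases; by rewrite ?mulr0.
- have P_n : rkN' Tau2 n = n.*2.*2 by [].
  have Nh_n : rkNhat Tau2 n = n.*2 by [].
  do 3?[case: ifP => ?]; rewrite /psiE; do 2?[case: ifP => ?] => *; munit_cases;
    by rewrite ?mulr0 ?subr0 ?mulr0.
- have P_n : rkN' Tau4 n = n.*2.*2.+2 by [].
  have Nh_n : rkNhat Tau4 n = n.*2 by [].
  do 3?[case: ifP => ?]; rewrite /psiE; do 2?[case: ifP => ?] => *; munit_cases;
    by rewrite ?mulr0 ?subr0 ?mulr0.
Qed.

Lemma psiF_off (K : fieldType) ty n (u : idx ty n -> K) (i : idx ty n) (a c : 'I_(rkN' ty n)) :
  (0 < n)%N -> ~~ ((path_label ty n a == i) && (c == prevn (rkN' ty n) a :> nat)) ->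
  psiF u i a c = 0.
Proof.
have N_n : rkN n = n.*2 by [].
move=> n0; have := ltn_ord a; have := ltn_ord c; have := ltn_ord i; move: u i a c.
case: ty => u i a c; rewrite /path_label /prevn.
- have P_n : rkN' Tau1 n = n.*2 by [].
  have Nh_n : rkNhat Tau1 n = n.*2.-1 by [].
  do 3?[case: ifP => ?]; rewrite /psiF; case: ifP => ? *; munit_cases; by rewrite ?mulr0.
- have P_n : rkN' Tau2 n = n.*2.*2 by [].
  have Nh_n : rkNhat Tau2 n = n.*2 by [].
  do 3?[case: ifP => ?]; rewrite /psiF; do 2?[case: ifP => ?] => *; munit_cases;
    by rewrite ?subr0 ?mulr0.
- have P_n : rkN' Tau4 n = n.*2.*2.+2 by [].
  have Nh_n : rkNhat Tau4 n = n.*2 by [].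
  do 3?[case: ifP => ?]; rewrite /psiF; do 2?[case: ifP => ?] => *; munit_cases;
    by rewrite ?subr0 ?mulr0.
Qed.

Lemma sgn_neq0 (K : fieldType) ty n i : (sgn_d ty n i)%:~R != 0 :> K.
Proof.
by rewrite /sgn_d; case: ty; case: ifP; rewrite ?rmorphN1 ?oppr_eq0 oner_neq0.
Qed.

Lemma sub_inv_neq0 (K : fieldType) (x : K) : x != 0 -> x ^+ 2 != 1 -> x - x^-1 != 0.
Proof.
move=> x0; apply: contra; rewrite subr_eq0 => /eqP xE.
by rewrite expr2 {2}xE mulfV.
Qed.

Lemma prod_neq0 (K : fieldType) (I : Type) (r : seq I) (P : pred I) (f : I -> K) :
  (forall i, f i != 0) -> \prod_(i <- r | P i) f i != 0.
Proof. by move=> f0; elim/big_ind: _ => [|x y x0 y0|i _]; rewrite ?oner_neq0 ?mulf_neq0. Qed.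

Lemma psiF_neq0 (K : fieldType) ty n (u : idx ty n -> K) (i : idx ty n) (a c : 'I_(rkN' ty n)) :
  (0 < n)%N -> (forall i, u i != 0) -> path_label ty n a = i -> c = prevn (rkN' ty n) a :> nat ->
  psiF u i a c != 0.
Proof.
have N_n : rkN n = n.*2 by [].
move=> n0; have := ltn_ord a; have := ltn_ord c; have := ltn_ord i; move: u i a c.
case: ty => u i a c ai ci ii u0; rewrite /path_label /prevn.
- have P_n : rkN' Tau1 n = n.*2 by [].
  have Nh_n : rkNhat Tau1 n = n.*2.-1 by [].
  do 3?[case: ifP => ?]; rewrite /psiF; case: ifP => ? *; munit_cases;
    by rewrite ?mulf_neq0 ?invr_neq0 ?u0 ?oner_neq0.
- have P_n : rkN' Tau2 n = n.*2.*2 by [].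
  have Nh_n : rkNhat Tau2 n = n.*2 by [].
  do 3?[case: ifP => ?]; rewrite /psiF; do 2?[case: ifP => ?] => *; munit_cases;
    by rewrite ?subr0 ?sub0r ?mulf_neq0 ?invr_neq0 ?oppr_eq0 ?u0 ?oner_neq0.
- have P_n : rkN' Tau4 n = n.*2.*2.+2 by [].
  have Nh_n : rkNhat Tau4 n = n.*2 by [].
  do 3?[case: ifP => ?]; rewrite /psiF; do 2?[case: ifP => ?] => *; munit_cases;
    by rewrite ?subr0 ?sub0r ?mulf_neq0 ?invr_neq0 ?oppr_eq0 ?u0 ?oner_neq0.
Qed.

Lemma psiE_neq0 (K : fieldType) ty n (q : K) (chi : Vhat ty n -> Vhat ty n -> K)
    (z u : idx ty n -> K) (i : idx ty n) (a c : 'I_(rkN' ty n)) :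
  (0 < n)%N -> q != 0 -> (forall m, (0 < m)%N -> q ^+ m != 1) -> (forall a b, chi a b != 0) ->
  (forall i, z i != 0) -> (forall i, u i != 0) ->
  path_label ty n c = i -> a = prevn (rkN' ty n) c :> nat ->
  psiE q chi z u i a c != 0.
Proof.
have N_n : rkN n = n.*2 by [].
move=> n0 q0 q1; have qq : q - q^-1 != 0 by rewrite sub_inv_neq0 ?q1.
have qq2 : q ^+ 2 - q ^- 2 != 0 by rewrite sub_inv_neq0 ?expf_neq0 // -exprM q1.
have := ltn_ord a; have := ltn_ord c; have := ltn_ord i; move: chi z u i a c.
case: ty => chi z u i a c ai ci ii chi0 z0 u0; rewrite /path_label /prevn.
- have P_n : rkN' Tau1 n = n.*2 by [].
  have Nh_n : rkNhat Tau1 n = n.*2.-1 by [].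
  do 3?[case: ifP => ?]; rewrite /psiE; case: ifP => ? *; munit_cases;
    by rewrite ?mulf_neq0 ?oppr_eq0 ?mulf_neq0 ?invr_neq0 ?expfz_neq0 ?prod_neq0 ?sgn_neq0
       ?oner_neq0 // => s; rewrite ?invr_neq0 ?chi0.
- have P_n : rkN' Tau2 n = n.*2.*2 by [].
  have Nh_n : rkNhat Tau2 n = n.*2 by [].
  do 3?[case: ifP => ?]; rewrite /psiE; do 2?[case: ifP => ?] => *; munit_cases;
    by rewrite ?mulr0 ?subr0 ?sub0r !(mulf_neq0, oppr_eq0, invr_neq0, expf_neq0, expfz_neq0,
        prod_neq0, sgn_neq0, oner_neq0, chi0, z0, u0) // => s;
       rewrite ?invr_neq0 ?expf_neq0 ?chi0.
- have P_n : rkN' Tau4 n = n.*2.*2.+2 by [].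
  have Nh_n : rkNhat Tau4 n = n.*2 by [].
  do 3?[case: ifP => ?]; rewrite /psiE; do 2?[case: ifP => ?] => *; munit_cases;
    by rewrite ?mulr0 ?subr0 ?sub0r !(mulf_neq0, oppr_eq0, invr_neq0, expf_neq0, expfz_neq0,
        prod_neq0, sgn_neq0, oner_neq0, chi0, z0, u0) // => s;
       rewrite ?invr_neq0 ?expf_neq0 ?chi0.
Qed.

(** * The relations in an abstract algebra *)

Section Relations.
Variables (K : fieldType) (ty : affine_type) (n : nat).
Variable chi : Vhat ty n -> Vhat ty n -> K.
Local Notation Nh := (rkNhat ty n).
Local Notation al := (alpha ty n).
Local Notation bl := (bil ty n).
Local Notation br := (qbr chi).

(** The part of the structure of the quotient algebra from which everything about Z is derived.
    Generators are indexed by natural numbers, so that indices such as N - i need no coercion to a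
    finite type, and each relation carries the bound on its indices. *)
Record nat_rels (A : algType K) (E F kk ll kk' ll' : nat -> A) : Prop := NatRels {
  rel_KV : forall k, kk k * kk' k = 1;
  rel_LV : forall k, ll k * ll' k = 1;
  rel_KE : forall k i, (k <= Nh)%N -> (i <= Nh)%N ->
    kk k * E i = chi (al k) (al i) *: (E i * kk k);
  rel_LE : forall k i, (k <= Nh)%N -> (i <= Nh)%N ->
    ll k * E i = (chi (al i) (al k))^-1 *: (E i * ll k);
  rel_EF : forall i j, (i <= Nh)%N -> (j <= Nh)%N ->
    E i * F j - F j * E i = if i == j then - kk i + ll i else 0;
  rel_E2 : forall i j, (i <= Nh)%N -> (j <= Nh)%N -> bl i j = 0 ->
    (br (al i, E i) (al j, E j)).2 = 0;
  rel_E3 : forall i j, (i <= Nh)%N -> (j <= Nh)%N -> i != j ->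
    - (2 * bl i j) = bl i i -> bl i i != 0 ->
    (br (al i, E i) (br (al i, E i) (al j, E j))).2 = 0;
  rel_E4 : forall i j, (i <= Nh)%N -> (j <= Nh)%N -> i != j ->
    - bl i j = bl i i -> bl i i != 0 ->
    (br (al i, E i) (br (al i, E i) (br (al i, E i) (al j, E j)))).2 = 0;
  rel_super : forall i j k, (i <= Nh)%N -> (j <= Nh)%N -> (k <= Nh)%N ->
    [/\ i != j, i != k & j != k] -> bl i i = 0 -> bl j k = 0 ->
    - bl i j = bl i k -> bl i k != 0 ->
    (br (br (al i, E i) (al j, E j)) (br (al i, E i) (al k, E k))).2 = 0 }.

End Relations.

(** * Folds, derivations and nilpotency *)

Section Generic.
Variables (K : fieldType) (ty : affine_type) (n : nat) (q : K).
Hypothesis char0 : [pchar K] =i pred0.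
Hypothesis n_ge : (if ty is Tau4 then 1 <= n else 2 <= n)%N.
Hypothesis q_neq0 : q != 0.
Hypothesis q_not_root1 : forall m : nat, (0 < m)%N -> q ^+ m != 1.
Variables (chi : Vhat ty n -> Vhat ty n -> K) (chiP : bichar q chi).
Variables (A : algType K) (E0 F kk ll kk' ll' : nat -> A).
Hypothesis rels : nat_rels chi E0 F kk ll kk' ll'.

Local Notation N := (rkN n).
Local Notation Nh := (rkNhat ty n).
Local Notation hom := (homog ty n A).
Local Notation br := (qbr chi).
Local Notation chi2 := (chi2 chi).
Local Notation al := (alpha ty n).
Local Notation bl := (bil ty n).
Local Notation even_root := (even_root ty n).
Implicit Types X Y Z T : hom.

Definition E (k : nat) : hom := (al k, E0 k).
Definition wt X := forall k, (k <= Nh)%N -> weightv chi (al k) (kk k) (ll k) X.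
Definition D (k : nat) : A -> A := der (F k).

Lemma q_exprz_neq1 (m : int) : m != 0 -> q ^ m != 1.
Proof.
case: m => m m0; last by rewrite NegzE -invr_expz invr_eq1 -exprnP q_not_root1.
by rewrite -exprnP q_not_root1 // lt0n.
Qed.

Lemma chi2_al i j : (i <= Nh)%N -> (j <= Nh)%N ->
  chi2 (al i) (al j) = q ^ (2 * bl i j).
Proof.
move=> iN jN; have [<-|ij] := eqVneq i j.
  have [b0|b0] := eqVneq (bl i i) 0.
    have := bichar_odd chiP (i := inord i); rewrite inordK // !chi2E => -> //.
    by rewrite b0 mulr0 expr0z mulrNN mulr1.
  have := bichar_even chiP (i := inord i); rewrite inordK // !chi2E => -> //.
  by rewrite -expfzDr // mulr_natl mulr2n.
have := bichar_sym chiP (i := inord i) (j := inord j).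
by rewrite -val_eqE /= !inordK // !chi2E => ->.
Qed.

Lemma chi_even k : (k <= Nh)%N -> even_root k -> chi (al k) (al k) = q ^ bl k k.
Proof.
move=> kN ek; have := bichar_even chiP (i := inord k); rewrite inordK // => -> //.
exact: bil_even.
Qed.

Lemma chi_odd k : (k <= Nh)%N -> ~~ even_root k -> chi (al k) (al k) = -1.
Proof.
move=> kN ok; have := bichar_odd chiP (i := inord k); rewrite inordK // => -> //.
exact: bil_odd.
Qed.

Lemma chi_even_not_root1 k : (k <= Nh)%N -> even_root k ->
  forall m, (0 < m)%N -> chi (al k) (al k) ^+ m != 1.
Proof.
move=> kN ek m m0; rewrite chi_even // exprnP exprz_exp q_exprz_neq1 //.
by rewrite mulf_neq0 ?bil_even // -lt0n.
Qed.

Lemma wt_E i : (i <= Nh)%N -> wt (E i).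
Proof.
by move=> iN k kN; split; [exact: (rel_KE rels)|exact: (rel_LE rels)].
Qed.

Lemma wt_br X Y : wt X -> wt Y -> wt (br X Y).
Proof. by move=> wX wY k kN; apply: (weightv_br chiP); [exact: wX|exact: wY]. Qed.

Lemma D_E i k : (i <= Nh)%N -> (k <= Nh)%N -> k != i -> D k (E i).2 = 0.
Proof.
by move=> iN kN ki; rewrite /D /der (rel_EF rels) // eq_sym (negPf ki).
Qed.

Lemma D_EE k : (k <= Nh)%N -> D k (E k).2 = - kk k + ll k.
Proof. by move=> kN; rewrite /D /der (rel_EF rels) // eqxx. Qed.

(** As chi(alpha_k, alpha_k) = -1, the bracket [[E_k, E_k]] is 2 E_k^2, and 2 is invertible in
    characteristic 0. *)
Lemma E_sq k : (k <= Nh)%N -> ~~ even_root k -> E0 k * E0 k = 0.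
Proof.
move=> kN ok; have := rel_E2 rels kN kN (bil_odd n_ge kN ok).
rewrite brE /= chi_odd // invrN invr1 scaleN1r opprK -mulr2n -scaler_nat => /eqP.
by move/pcharf0P: char0 => c0; rewrite scaler_eq0 c0 /= => /eqP.
Qed.

Definition Rz X k := (br X (E k)).2 = 0.
Definition Lz k X := (br (E k) X).2 = 0.
(** One step of all the recursions: B_i, B_(-1) and A_i arise by iterated folds from E_n or, in the
    case of A_i for tau = 1, from E_0. *)
Definition fold Y e f : hom := br (E f) (br Y (E e)).

Lemma Rz_fold Y e f k : Rz Y k -> Rz (E e) k -> Rz (E f) k -> Rz (fold Y e f) k.
Proof. by move=> RY Re Rf; apply: (br_brl0 chiP) => //; exact: (br_brl0 chiP). Qed.
Lemma Lz_fold Y e f k : Lz k Y -> Lz k (E e) -> Lz k (E f) -> Lz k (fold Y e f).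
Proof. by move=> LY Le Lf; apply: (br_brr0 chiP) => //; exact: (br_brr0 chiP). Qed.
Lemma wt_fold Y e f : (e <= Nh)%N -> (f <= Nh)%N -> wt Y -> wt (fold Y e f).
Proof. by move=> eN fN wY; do !apply: wt_br => //; exact: wt_E. Qed.

Lemma chi2_far e f : (e <= Nh)%N -> (f <= Nh)%N -> bl e f = 0 -> chi2 (al e) (al f) = 1.
Proof. by move=> eN fN b0; rewrite chi2_al // b0 mulr0 expr0z. Qed.

Lemma D_fold0 Y e f k : (e <= Nh)%N -> (f <= Nh)%N -> (k <= Nh)%N ->
  k != e -> k != f -> D k Y.2 = 0 -> D k (fold Y e f).2 = 0.
Proof. by move=> eN fN kN ke kf DY; do 2?apply: der_br0 => //; exact: D_E. Qed.

(** [D e] sees only the inner bracket; since alpha_e is orthogonal to alpha_f, L_e passes the outer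
    one and leaves [[E_f, Y]]. Dually, [D f] sees only the outer bracket and leaves [[Y, E_e]]
    K_f. *)
Lemma D_fold_e Y e f : (e <= Nh)%N -> (f <= Nh)%N -> e != f -> bl e f = 0 ->
  wt Y -> D e Y.2 = 0 ->
  D e (fold Y e f).2 = (1 - (chi2 (al e) Y.1)^-1) *: ((br (E f) Y).2 * ll e).
Proof.
move=> eN fN ef b0 wY DY.
have De := der_brE chiP (D_EE eN) (wt_E eN eN) DY (wY e eN).
rewrite /D (der_brr_L chiP (T := Y) (a := al e) (X := br Y (E e)) (erefl _) De
              (D_E fN eN ef) (wt_E fN eN)).
by rewrite chi2_far // invr1 mulr1 brE.
Qed.

Lemma D_fold_f Y e f : (e <= Nh)%N -> (f <= Nh)%N -> e != f -> wt Y -> D f Y.2 = 0 ->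
  D f (fold Y e f).2 =
    ((1 - chi2 (al f) (Y.1 + al e)) / chi (Y.1 + al e) (al f)) *: ((br Y (E e)).2 * kk f).
Proof.
move=> eN fN ef wY DY; apply: (der_Ebr chiP).
- exact: D_EE.
- exact: wt_E.
- by apply: der_br0 => //; apply: D_E => //; rewrite eq_sym.
- by apply: wt_br => //; exact: wt_E.
Qed.

(** A derivative T L_k of Y dies in the inner bracket, which turns T into [[T, E_e]] = 0. A
    derivative T K_k survives it, by orthogonality of alpha_k and alpha_e, but dies in the outer
    bracket if E_f commutes with T and E_e; this is [D_fold_K]. *)
Lemma D_fold_L c T Y e f k : (e <= Nh)%N -> (f <= Nh)%N -> (k <= Nh)%N ->
  k != e -> k != f -> Y.1 = T.1 + al k -> D k Y.2 = c *: (T.2 * ll k) -> Rz T e ->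
  D k (fold Y e f).2 = 0.
Proof.
move=> eN fN kN ke kf dY DY RT; apply: der_br0; first exact: D_E.
by rewrite /D (der_brl_L chiP dY DY (D_E eN kN ke) (wt_E eN kN)) RT mul0r scaler0.
Qed.

Lemma D_fold_K c T Y e f k : (e <= Nh)%N -> (f <= Nh)%N -> (k <= Nh)%N ->
  k != e -> k != f -> Y.1 = T.1 + al k -> D k Y.2 = c *: (T.2 * kk k) ->
  bl k e = 0 -> Lz f T -> Lz f (E e) ->
  D k (fold Y e f).2 = 0.
Proof.
move=> eN fN kN ke kf dY DY b0 LT Le.
have DYe : D k (br Y (E e)).2 = (c * chi (al k) (al e)) *: ((br T (E e)).2 * kk k).
  rewrite /D (der_brl_K chiP dY DY (D_E eN kN ke) (wt_E eN kN)).
  by rewrite chi2_far // invr1 mulr1 brE.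
have dYe : (br Y (E e)).1 = (br T (E e)).1 + al k by rewrite /= dY addrAC.
rewrite /D (der_brr_K chiP dYe DYe (D_E fN kN kf) (wt_E fN kN)).
by rewrite (br_brr0 chiP) ?mul0r ?scaler0.
Qed.

Lemma D_fold_E e f k : (e <= Nh)%N -> (f <= Nh)%N -> (k <= Nh)%N ->
  k != e -> k != f -> Lz f (E e) -> D k (fold (E k) e f).2 = 0.
Proof.
move=> eN fN kN ke kf Le.
have De := der_Ebr chiP (D_EE kN) (wt_E kN kN) (D_E eN kN ke) (wt_E eN kN).
have de : (br (E k) (E e)).1 = (E e).1 + al k by rewrite /= addrC.
rewrite /D (der_brr_K chiP de De (D_E fN kN kf) (wt_E fN kN)).
by rewrite Le mul0r scaler0.
Qed.

Definition nilR_at k X := nilR chi (al k) (E0 k) X.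
Definition nilL_at k X := nilL chi (al k) (E0 k) X.

Lemma nilL_E k j : (k <= Nh)%N -> (j <= Nh)%N -> even_root k -> j != k -> nilL_at k (E j).
Proof.
move=> kN jN ek jk; have b0 := bil_even n_ge kN ek.
have [bj|bj|bj] := bil_serre n_ge kN jN ek jk.
- by exists 1%N; exact: (rel_E2 rels).
- by exists 2%N; apply: (rel_E3 rels) => //; rewrite eq_sym.
- by exists 3%N; apply: (rel_E4 rels) => //; rewrite eq_sym.
Qed.

(* The Serre polynomials are symmetric, so that the right iterated bracket
   vanishes together with the left one. *)
Lemma nilR_E k j : (k <= Nh)%N -> (j <= Nh)%N -> even_root k -> j != k -> nilR_at k (E j).
Proof.
move=> kN jN ek jk; have b0 := bil_even n_ge kN ek.
have ckk := chi_even kN ek; have ckj := chi2_al kN jN.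
have u0 := chi_neq0 chiP (al j) (al k); have v0 := chi_neq0 chiP (al k) (al j).
have w0 := chi_neq0 chiP (al k) (al k).
have kj : k != j by rewrite eq_sym.
have [bj|bj|bj] := bil_serre n_ge kN jN ek jk.
- by exists 1%N; apply: (rel_E2 rels) => //; rewrite bilC.
- exists 2%N; have /= := rel_E3 rels kN jN kj bj b0.
  have : chi (al k) (al j) * chi (al j) (al k) * chi (al k) (al k) = 1.
    by rewrite ckk -/(chi2 (al k) (al j)) ckj -expfzDr // -bj addrN expr0z.
  rewrite /= !(chiDl chiP, chiDr chiP).
  move: (chi (al j) (al k)) (chi (al k) (al j)) (chi (al k) (al k)) u0 v0 w0 => u v w u0 v0 w0.
  (* This factor makes the coefficients of E_k E_k E_j in the right and the left bracket agree; once
     [v] is eliminated by u v w = 1, the other coefficients agree as well. *)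
  move=> uvw H; apply: (scalerI (a := (u ^+ 2 * w)^-1)).
    by rewrite invr_eq0 !mulf_neq0.
  rewrite scaler0 -[RHS]H.
  have -> : v = (u * w)^-1 by rewrite -[RHS]mulr1 -uvw; field; rewrite u0 w0.
  by nc_coefs K A; field; rewrite ?u0 ?w0 ?oner_eq0.
- exists 3%N; have /= := rel_E4 rels kN jN kj bj b0.
  have : chi (al k) (al j) * chi (al j) (al k) * chi (al k) (al k) ^+ 2 = 1.
    rewrite ckk -/(chi2 (al k) (al j)) ckj exprnP exprz_exp -expfzDr // -bj.
    by rewrite (_ : _ + _ = 0) ?expr0z //; ring.
  rewrite /= !(chiDl chiP, chiDr chiP).
  move: (chi (al j) (al k)) (chi (al k) (al j)) (chi (al k) (al k)) u0 v0 w0 => u v w u0 v0 w0.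
  move=> uvw H; apply: (scalerI (a := - (u ^+ 3 * w ^+ 3)^-1)).
    by rewrite oppr_eq0 invr_eq0 !mulf_neq0.
  rewrite scaler0 -[RHS]H.
  have -> : v = (u * w ^+ 2)^-1 by rewrite -[RHS]mulr1 -uvw; field; rewrite u0 w0.
  by nc_coefs K A; field; rewrite ?u0 ?w0 ?oner_eq0.
Qed.

Lemma nilR_fold k Y e f : (k <= Nh)%N -> (e <= Nh)%N -> (f <= Nh)%N -> even_root k ->
  k != f -> nilR_at k Y -> nilR_at k (fold Y e f).
Proof.
move=> kN eN fN ek kf [m Ym]; apply: (nilR_br chiP); first by apply: nilR_E; rewrite // eq_sym.
have [->|ke] := eqVneq e k; first by exists m; rewrite -iter_adR_S iterS /adR br0l.
by apply: (nilR_br chiP); [exists m|exact: nilR_E].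
Qed.

Lemma nilL_fold k Y e f : (k <= Nh)%N -> (e <= Nh)%N -> (f <= Nh)%N -> even_root k ->
  k != e -> nilL_at k Y -> nilL_at k (fold Y e f).
Proof.
move=> kN eN fN ek ke nY.
have [m Xm] : nilL_at k (br Y (E e)).
  by apply: (nilL_br chiP) => //; apply: nilL_E; rewrite // eq_sym.
have [->|kf] := eqVneq f k; first by exists m; rewrite -iter_adL_S iterS /adL br0r.
by apply: (nilL_br chiP); [exact: nilL_E|exists m].
Qed.

Lemma lowestR k g m X : (k <= Nh)%N -> even_root k -> wt X -> nilR_at k X -> D k X.2 = 0 ->
  chi2 (al k) X.1 = q ^ (bl k k * g) -> (0 < g + m%:Z) ->
  (iter m (adR chi (al k) (E0 k)) X).2 = 0.
Proof.
move=> kN ek wX nX DX sX gm.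
apply: (lowest_nilR chiP (D_EE kN) (rel_LV rels k) (wt_E kN kN)
          (chi_even_not_root1 kN ek) (wX k kN) DX _ nX gm).
by rewrite sX chi_even // -exprz_exp.
Qed.

Lemma lowestL k g m X : (k <= Nh)%N -> even_root k -> wt X -> nilL_at k X -> D k X.2 = 0 ->
  chi2 (al k) X.1 = q ^ (bl k k * g) -> (0 < g + m%:Z) ->
  (iter m (adL chi (al k) (E0 k)) X).2 = 0.
Proof.
move=> kN ek wX nX DX sX gm.
apply: (lowest_nilL chiP (D_EE kN) (rel_KV rels k) (wt_E kN kN)
          (chi_even_not_root1 kN ek) (wX k kN) DX _ nX gm).
by rewrite sX chi_even // -exprz_exp.
Qed.

(* In a fold of Y by e < n < f, a right bracket with E_e is nilpotent on [Y, E_e]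
   because it is so on Y, and a left bracket with E_f on [E_f, [Y, E_e]]; hence the
   side on which nilpotency is propagated depends on the half of the diagram. *)
Definition nil_at k X := if (k < n)%N then nilR_at k X else nilL_at k X.

(** The case g = 0, m = 1 of the lowest weight argument. Weight 0 also makes the vanishing of the
    bracket symmetric, so that one-sided nilpotency suffices for both conclusions. *)
Lemma commute_even k X : (k <= Nh)%N -> even_root k -> wt X -> nil_at k X -> D k X.2 = 0 ->
  chi2 (al k) X.1 = 1 -> Rz X k /\ Lz k X.
Proof.
rewrite /nil_at => kN ek wX nX DX sX; have sX0 : chi2 (al k) X.1 = q ^ (bl k k * 0).
  by rewrite mulr0 expr0z.
move: nX; case: ifP => _ nX.
  have RX : Rz X k by have := lowestR (m := 1) kN ek wX nX DX sX0 isT.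
  by split=> //; apply: (br_sym0 _ RX); rewrite chi2C.
have LX : Lz k X by have := lowestL (m := 1) kN ek wX nX DX sX0 isT.
by split=> //; apply: (br_sym0 _ LX).
Qed.

(* B_i, B_(-1), A_i and Z over an abstract algebra satisfying [nat_rels]: unification
   is intractable on terms of the quotient [Unat chi] itself. *)
Fixpoint gB_down (k : nat) : hom :=
  if k is k'.+1 then
    let i := (n - 1 - k)%N in
    br (E (N - i - 1)) (br (gB_down k') (E i.+1))
  else E n.
Definition gB (i : nat) : hom := gB_down (n - 1 - i).
Definition gBm1 : hom := br (E N) (br (gB 0) (E 0)).
Definition gA0 : hom :=
  match ty with
  | Tau1 => E 0
  | Tau2 => gBm1
  | Tau4 => br (E N) (br gBm1 (E 0))
  end.
Fixpoint gA (i : nat) : hom :=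
  if i is i'.+1 then br (E (N - i)) (br (gA i') (E i)) else gA0.

(** * The elements B_i *)

Lemma index_facts : [/\ (0 < n)%N, N = n.*2, (N.-1 <= Nh)%N & (Nh <= N)%N].
Proof.
have n0 := n_gt0 n_ge; have NhN := rkNhat_le n_ge; split=> //.
by rewrite /rkNhat; case: (ty); rewrite ?leq_pred.
Qed.
Ltac ilia := have [? ? ? ?] := index_facts; lia.

Lemma Nh_eq : ty <> Tau1 -> Nh = N. Proof. exact: rkNhat_Tau24. Qed.

Lemma gB_last : gB n.-1 = E n.
Proof. by rewrite /gB subn1 subnn. Qed.
Lemma gB_step i : (i.+1 < n)%N -> gB i = fold (gB i.+1) i.+1 (N - i.+1).
Proof.
move=> i_n; rewrite /gB; have -> : (n - 1 - i = (n - 1 - i.+1).+1)%N by lia.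
rewrite /fold /=; have -> : (n - 1 - (n - 1 - i.+1).+1 = i)%N by lia.
by rewrite -subnDA addn1.
Qed.
Lemma gA_step i : gA i.+1 = fold (gA i) i.+1 (N - i.+1). Proof. by []. Qed.
Lemma gBm1_fold : gBm1 = fold (gB 0) 0 N. Proof. by []. Qed.

(** Downward induction along the nest of folds; it is strong because [D_B] unfolds two layers at
    once. *)
Lemma gB_ind (P : nat -> Prop) : P n.-1 ->
  (forall i, (i.+1 < n)%N -> (forall j, (i < j < n)%N -> P j) -> P i) ->
  forall i, (i < n)%N -> P i.
Proof.
move=> Pn PS i i_n; move: {2}(n - i)%N (leqnn (n - i)) => m.
elim: m i i_n => [|m IHm] i i_n im; first by lia.
have [i1|i1] := ltnP i.+1 n; last by have -> : i = n.-1 by lia.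
by apply: PS => // j ij; apply: IHm; lia.
Qed.

(** The last hypothesis excludes the pair 0, N - 1: for tau = 1 the diagram is a circle and these
    two nodes are adjacent. *)
Lemma E_far t k : (t <= Nh)%N -> (k <= Nh)%N -> (t.+1 < k)%N || (k.+1 < t)%N ->
  (0 < t)%N && (0 < k)%N || (t + k != N.-1)%N -> Rz (E t) k /\ Lz k (E t).
Proof.
move=> tN kN tk wr; suff b0 : bl t k = 0.
  by split; apply: (rel_E2 rels) => //; rewrite bilC.
case/orP: tk => tk; [|rewrite bilC]; apply: (bil_far n_ge) => //; case: ty => //; lia.
Qed.

Lemma E_far24 t k : ty <> Tau1 -> (t <= N)%N -> (k <= N)%N ->
  (t.+1 < k)%N || (k.+1 < t)%N -> Rz (E t) k /\ Lz k (E t).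
Proof.
move=> tyE; rewrite -Nh_eq // => tN kN tk; suff b0 : bl t k = 0.
  by split; apply: (rel_E2 rels) => //; rewrite bilC.
by case/orP: tk => tk; [|rewrite bilC]; apply: (bil_far n_ge) => //; case: ty tyE.
Qed.

Lemma wt_B i : (i < n)%N -> wt (gB i).
Proof.
elim/gB_ind=> {i} [|i i_n IHi]; first by rewrite gB_last; apply: wt_E; ilia.
have wB : wt (gB i.+1) by apply: IHi; lia.
by rewrite gB_step //; apply: wt_fold => //; ilia.
Qed.

Lemma B_far i k : (i < n)%N -> (k <= Nh)%N -> (k < i)%N || (N - i < k)%N ->
  Rz (gB i) k /\ Lz k (gB i).
Proof.
move=> i_n kN; elim/gB_ind: i / i_n => [|i i_n IHi] ki.
  by rewrite gB_last; apply: E_far => //; ilia.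
have [||RB LB] := IHi i.+1; try by ilia.
have [||||Re Le] := @E_far i.+1 k; try by ilia.
have [||||Rf Lf] := @E_far (N - i.+1) k; try by ilia.
by rewrite gB_step //; split; [apply: Rz_fold|apply: Lz_fold].
Qed.

Lemma e_f_commute i : (0 < i < n)%N -> bl i (N - i) = 0.
Proof.
move=> i0; apply: (bil_far n_ge); [ilia|ilia|].
by case: ty => //; ilia.
Qed.

(** The inner fold leaves [[E_f2, T]] L_e2 or [[T, E_e2]] K_f2. The first commutes with E_e and the
    second with E_f, so the outer fold destroys both. This is why a nest of folds has nonzero
    derivatives only at its outermost indices. *)
Lemma D_fold_fold T e2 f2 e f k :
  [/\ (e2 <= Nh)%N, (f2 <= Nh)%N, (e <= Nh)%N & (f <= Nh)%N] ->
  (k == e2) || (k == f2) -> [/\ e2 != f2, k != e & k != f] ->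
  bl e2 f2 = 0 -> bl f2 e = 0 -> [/\ wt T, D e2 T.2 = 0 & D f2 T.2 = 0] ->
  [/\ Rz (E f2) e & Rz T e] -> [/\ Lz f T, Lz f (E e2) & Lz f (E e)] ->
  D k (fold (fold T e2 f2) e f).2 = 0.
Proof.
move=> [e2N f2N eN fN] k2 [e2f2 ke kf] b2 b0 [wT De2 Df2] [Rf RT] [LT Le2 Le].
case/orP: k2 => /eqP k2; rewrite k2 in ke kf *.
  apply: (D_fold_L (T := br (E f2) T) _ _ _ _ _ _ (D_fold_e e2N f2N e2f2 b2 wT De2)) => //.
    by rewrite /= addrA.
  exact: (br_brl0 chiP).
apply: (D_fold_K (T := br T (E e2)) _ _ _ _ _ _ (D_fold_f e2N f2N e2f2 wT Df2)) => //.
  by rewrite /= addrC.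
exact: (br_brr0 chiP).
Qed.

Lemma D_B i k : (i < n)%N -> (k <= Nh)%N -> k != i.+1 -> k != (N - i.+1)%N ->
  D k (gB i).2 = 0.
Proof.
move=> i_n; move: k; elim/gB_ind: i / i_n => [|i i_n IHi] k kN ke kf.
  by rewrite gB_last; apply: D_E => //; ilia.
have [||||Re Le] := @E_far i.+1 (N - i.+1); try by ilia.
rewrite gB_step //.
have [eN fN] : (i.+1 <= Nh)%N /\ (N - i.+1 <= Nh)%N by split; ilia.
have [k2|k2] := boolP ((k == i.+2) || (k == (N - i.+2)%N)); last first.
  by apply: D_fold0 => //; apply: IHi => //; ilia.
(* If i + 2 = n, the inner element is E_n itself, not a fold, and k = n; [D_fold_E] replaces
   [D_fold_fold]. *)
have [i2|i2] := ltnP i.+2 n; last first.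
  have -> : k = n by ilia.
  have -> : i.+1 = n.-1 by lia.
  rewrite gB_last; apply: D_fold_E => //; try by ilia.
  by have -> : n.-1 = i.+1 by lia.
have dB m : (m <= Nh)%N -> m != i.+3 -> m != (N - i.+3)%N ->
    D m (gB i.+2).2 = 0 by apply: IHi; lia.
have [||||_ Le2] := @E_far i.+2 (N - i.+1); try by ilia.
have [||||Rf2 _] := @E_far (N - i.+2) i.+1; try by ilia.
have [|||RBe _] := @B_far i.+2 i.+1; try by ilia.
have [|||_ LBf] := @B_far i.+2 (N - i.+1); try by ilia.
rewrite gB_step //; apply: D_fold_fold k2 _ _ _ _ _ _ => //.
- by split; ilia.
- by split; ilia.
- by apply: e_f_commute; lia.
- by rewrite bilC; apply: (bil_far n_ge); [ilia..|case: (ty) => //; ilia].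
- by split; [exact: wt_B|apply: dB; ilia..].
Qed.

Lemma gB_deg i : (gB i).1 = (Bn chi i).1.
Proof. by rewrite /gB /Bn; elim: (n - 1 - i)%N => //= j ->. Qed.
Lemma gBm1_deg : gBm1.1 = (Bminus1 chi).1.
Proof. by rewrite /gBm1 /Bminus1 /= gB_deg. Qed.
(* The type of chi depends on ty, so that a case analysis on ty has to go through an
   auxiliary statement in which it is replaced by a fresh variable. *)
Lemma gA0_deg : gA0.1 = (A0 chi).1.
Proof.
have := gBm1_deg; rewrite /gA0 /A0; move: gBm1 (Bminus1 chi) => X Y /= XY.
have aux t : (match t with
    | Tau1 => E 0 | Tau2 => X | Tau4 => br (E N) (br X (E 0)) end).1 =
    (match t with
    | Tau1 => nEh chi 0 | Tau2 => Y | Tau4 => br (nEh chi N) (br Y (nEh chi 0)) end).1.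
  by case: t; rewrite //= XY.
exact: aux.
Qed.
Lemma gA_deg i : (gA i).1 = (An chi i).1.
Proof. by elim: i => [|i /= ->] //; exact: gA0_deg. Qed.

Lemma deg_gAB i : (i < n)%N -> (gA i).1 + (gB i).1 = sdelta ty n.
Proof. by move=> i_n; rewrite gA_deg gB_deg -(deg_AB chi _ i_n) //; ilia. Qed.

Local Notation wB := (wB ty n).

Lemma chi2_B k i : (k <= Nh)%N -> (i < n)%N -> chi2 (al k) (gB i).1 = q ^ (2 * wB k i).
Proof.
move=> kN i_n; elim/gB_ind: i / i_n => [|i i_n IHi].
  rewrite gB_last chi2_al //; last by ilia.
  congr (q ^ (2 * _)); rewrite bilE ?(n_gt0 n_ge) //= !wBE.
  have [n0 NE _ _] := index_facts.
  have -> : (n == 0%N) = false by lia.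
  have -> : (n < N)%N by lia.
  have -> : n.-1.+1 = n by lia.
  by have -> : (N - n.-1 = n.+1)%N by lia.
rewrite gB_step // /= !(chi2Dr chiP) IHi; last by lia.
rewrite !chi2_al //; try by ilia.
rewrite -!expfzDr //; congr (q ^ _).
have [n0 NE _ _] := index_facts.
rewrite !bilE //= !wBE.
have -> : (N - i.+1 == 0)%N = false by lia.
have -> : (N - i.+1 < N)%N by lia.
have -> : (i.+1 < N)%N by lia.
have -> : (N - i = (N - i.+1).+1)%N by lia.
by ring.
Qed.

(** delta lies in the radical of the form on the root lattice; concretely, alpha_k has opposite
    pairings with the degrees of A_0 and B_0. *)
Lemma chi2_sdelta k : (k <= Nh)%N -> chi2 (al k) (sdelta ty n) = 1.
Proof.
move=> kN; have [n0 NE N1 NhN] := index_facts.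
have -> : 1 = q ^ (2 * 0 : int) by rewrite expr0z.
rewrite -(deg_gAB n0) (chi2Dr chiP) chi2_B //.
have BW : ty <> Tau1 -> chi2 (al k) gBm1.1 = q ^ (2 * (bl k N + wB k 0 + bl k 0)).
  move=> tyE; have NN : (N <= Nh)%N by rewrite Nh_eq.
  rewrite gBm1_fold /= !(chi2Dr chiP) chi2_B // !chi2_al //.
  by rewrite -!expfzDr //; congr (q ^ _); ring.
have -> : chi2 (al k) (gA 0).1 = q ^ (2 * - wB k 0); last first.
  by rewrite -expfzDr //; congr (q ^ _); ring.
rewrite /= /gA0.
have b t : ty = t -> bl k 0 = match t with
    | Tau1 => root_coef ty n k N * sgn_d ty n N - root_coef ty n k 1 * sgn_d ty n 1
    | Tau2 => - (2 * (root_coef ty n k 1 * sgn_d ty n 1))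
    | Tau4 => - (root_coef ty n k 1 * sgn_d ty n 1) end.
  by move=> <-; rewrite bilE.
have bN t : ty = t -> bl k N = match t with
    | Tau1 => root_coef ty n k N * sgn_d ty n N
    | Tau2 => 2 * (root_coef ty n k N * sgn_d ty n N)
    | Tau4 => root_coef ty n k N * sgn_d ty n N end.
  move=> <-; rewrite bilE //= ltnn; have -> : (N == 0)%N = false by lia.
  by case: (ty).
have wB0 : wB k 0 = root_coef ty n k 1 * sgn_d ty n 1 - root_coef ty n k N * sgn_d ty n N.
  by rewrite !wBE subn0.
have aux t : ty = t -> chi2 (al k) (match t with
    | Tau1 => E 0 | Tau2 => gBm1 | Tau4 => br (E N) (br gBm1 (E 0)) end).1 =
    q ^ (2 * - wB k 0); last exact: aux.
case: t => tE.
- by rewrite chi2_al // (b _ tE) wB0; congr (q ^ _); ring.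
- have n1 : ty <> Tau1 by rewrite tE.
  by rewrite BW // (b _ tE) (bN _ tE) wB0; congr (q ^ _); ring.
- have n1 : ty <> Tau1 by rewrite tE.
  have NN : (N <= Nh)%N by rewrite Nh_eq.
  move: (BW n1); move: gBm1 => W BW1.
  rewrite /= !(chi2Dr chiP) BW1 !chi2_al // -!expfzDr //.
  by rewrite (b _ tE) (bN _ tE) wB0; congr (q ^ _); ring.
Qed.

Lemma chi2_A k i : (k <= Nh)%N -> (i < n)%N -> chi2 (al k) (gA i).1 = q ^ (- (2 * wB k i)).
Proof.
move=> kN i_n; have := chi2_sdelta kN; rewrite -(deg_gAB i_n) (chi2Dr chiP) chi2_B //.
move=> H; apply: (mulIf (expfz_neq0 (2 * wB k i) q_neq0)).
by rewrite H -expfzDr // addNr expr0z.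
Qed.

Lemma nil_E k j : (k <= Nh)%N -> (j <= Nh)%N -> even_root k -> j != k -> nil_at k (E j).
Proof.
by move=> kN jN ek jk; rewrite /nil_at; case: ifP => _; [exact: nilR_E|exact: nilL_E].
Qed.

Lemma nil_br k X Y : nil_at k X -> nil_at k Y -> nil_at k (br X Y).
Proof.
by rewrite /nil_at; case: ifP => _ nX nY; [exact: (nilR_br chiP)|exact: (nilL_br chiP)].
Qed.

Lemma nil_fold k Y e f : (k <= Nh)%N -> even_root k -> (e < n < f)%N -> (f <= Nh)%N ->
  nil_at k Y -> nil_at k (fold Y e f).
Proof.
rewrite /nil_at => kN ek ef fN; case: ifP => kn nY.
  by apply: nilR_fold => //; lia.
have kn' : k != n by case/andP: (ek).
by apply: nilL_fold => //; lia.
Qed.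

Lemma even_neq k : even_root k -> k != n. Proof. by case/andP. Qed.

Lemma nil_B k i : (k <= Nh)%N -> even_root k -> (i < n)%N -> nil_at k (gB i).
Proof.
move=> kN ek; elim/gB_ind => {i} [|i i_n IHi].
  by rewrite gB_last; apply: nil_E => //; [ilia|rewrite eq_sym even_neq].
by rewrite gB_step //; apply: nil_fold => //; [ilia..|apply: IHi; lia].
Qed.

(** E_s^2 = 0 gives [[E_s, [[E_s, E_e]]]] = 0, so [br_assoc] rewrites [[E_s, [[E_f, [[E_s, E_e]]]]]]
    as the degree-four Serre element [[[[E_s, E_f]], [[E_s, E_e]]]]. The fold has weight 0 at
    alpha_s, which gives the other side. *)
Lemma super_fold s e f : (s <= Nh)%N -> (e <= Nh)%N -> (f <= Nh)%N ->
  ~~ even_root s -> [/\ s != f, s != e & f != e] ->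
  bl f e = 0 -> - bl s f = bl s e -> bl s e != 0 ->
  Rz (fold (E s) e f) s /\ Lz s (fold (E s) e f).
Proof.
move=> sN eN fN os ne bfe bsf b0; have bs := bil_odd n_ge sN os.
have Es := E_sq sN os.
have Lse : (br (E s) (br (E s) (E e))).2 = 0.
  rewrite /= (chiDl chiP) chi_odd // mulrBr mulrBl -!scalerAr -!scalerAl !mulrA.
  rewrite Es mul0r -(mulrA (E0 e)) Es mulr0 !scaler0 subr0 sub0r mulN1r invrN scaleNr.
  by rewrite opprK addNr.
have L0 : Lz s (fold (E s) e f).
  by rewrite /Lz /fold (br_assoc chiP) //; apply: (rel_super rels).
split=> //; apply: (br_sym0 _ L0).
rewrite /= !(chi2Dr chiP) !chi2_al // bs -!expfzDr // -bsf.
by rewrite (_ : _ + _ = 0) ?expr0z //; ring.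
Qed.

(** For k different from n this is [commute_even]. For k = n the innermost fold is handled by
    [super_fold], and the outer layers consist of E_j that are not adjacent to n. *)
Lemma B_inner i k : (i.+1 < k)%N -> (k < N - i.+1)%N -> Rz (gB i) k /\ Lz k (gB i).
Proof.
move=> ik kN; have i_n : (i < n)%N by ilia.
have k_Nh : (k <= Nh)%N by ilia.
have [kn|kn] := eqVneq k n; last first.
  have ek : even_root k by rewrite !even_rootE kn; case: (ty) => //; lia.
  apply: commute_even => //; [exact: wt_B|exact: nil_B|apply: D_B => //; ilia|].
  by rewrite chi2_B // wB_mid ?mulr0 ?expr0z //; ilia.
subst k; elim/gB_ind: i / i_n ik kN => [|i i_n IHi] ik kN; first by ilia.
have [eN fN] : (i.+1 <= Nh)%N /\ (N - i.+1 <= Nh)%N by split; ilia.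
rewrite gB_step //; have [i2|i2] := ltnP i.+2 n.
  have [||||Re Le] := @E_far i.+1 n; try by ilia.
  have [||||Rf Lf] := @E_far (N - i.+1) n; try by ilia.
  have [|||RB LB] := IHi i.+1; try by ilia.
  by split; [exact: Rz_fold|exact: Lz_fold].
have [b1 b2 b3] := bil_n_neighbours n_ge.
have -> : i.+1 = n.-1 by lia.
have -> : (N - n.-1 = n.+1)%N by ilia.
rewrite gB_last; apply: super_fold => //; try by ilia.
  by rewrite !even_rootE eqxx.
by split; lia.
Qed.

Lemma lowest_neg k X : (k <= Nh)%N -> even_root k -> wt X -> nil_at k X -> D k X.2 = 0 ->
  chi2 (al k) X.1 = q ^ (- bl k k) ->
  if (k < n)%N then (br (br X (E k)) (E k)).2 = 0 else (br (E k) (br (E k) X)).2 = 0.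
Proof.
rewrite /nil_at => kN ek wX nX DX sX; have sX0 : chi2 (al k) X.1 = q ^ (bl k k * -1).
  by rewrite sX mulrN1.
case: ifP nX => _ nX; first exact: (lowestR (m := 2) kN ek wX nX DX sX0 isT).
exact: (lowestL (m := 2) kN ek wX nX DX sX0 isT).
Qed.

Lemma even_mid j : (0 < j < n)%N -> even_root j /\ even_root (N - j).
Proof.
by move=> jn; rewrite !even_rootE; split; case: (ty) => //; ilia.
Qed.

(** B_(i+1) has weight -1 at alpha_e, and [[B_(i+1), E_e]] has weight -1 at alpha_f, so both are
    instances of the lowest weight argument with m = 2. *)
Lemma B_serre i : (i.+1 < n)%N -> let e := i.+1 in let f := (N - e)%N in
  (br (br (gB i.+1) (E e)) (E e)).2 = 0 /\
  (br (E f) (br (E f) (br (gB i.+1) (E e)))).2 = 0.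
Proof.
move=> i1 e f; have jn : (0 < e < n)%N by rewrite /e; lia.
have [ee ef] := even_mid jn; have [we wf] := wB_diag n_ge jn.
have [_ _ wN] := wB_pair n_ge jn.
have [eN fN] : (e <= Nh)%N /\ (f <= Nh)%N by rewrite /f; split; ilia.
have e_f : e != f by rewrite /f; ilia.
have DBe : D e (gB i.+1).2 = 0 by apply: D_B; rewrite /e; ilia.
have DBf : D f (gB i.+1).2 = 0 by apply: D_B; rewrite /f /e; ilia.
split.
  have := lowest_neg eN ee (wt_B i1) (nil_B eN ee i1) DBe; rewrite {1}/e i1; apply.
  by rewrite chi2_B // we.
have fn : (f < n)%N = false by rewrite /f; ilia.
have := @lowest_neg f (br (gB i.+1) (E e)) fN ef; rewrite fn; apply.
- by apply: wt_br; [exact: wt_B|exact: wt_E].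
- by apply: nil_br; [exact: nil_B|exact: nil_E].
- by apply: der_br0 => //; apply: D_E => //; rewrite eq_sym.
- rewrite /= (chi2Dr chiP) chi2_B // chi2_al // bilC e_f_commute // mulr0 expr0z mulr1.
  by rewrite wN mulrN wf.
Qed.

Lemma B_edge i : (i.+1 < n)%N -> Rz (gB i) i.+1 /\ Lz (N - i.+1) (gB i).
Proof.
move=> i1; have [Se Sf] := B_serre i1.
have [Rf _] : Rz (E (N - i.+1)) i.+1 /\ Lz i.+1 (E (N - i.+1)) by apply: E_far; ilia.
by rewrite gB_step //; split=> //; apply: (br_brl0 chiP).
Qed.

(** * The element B_(-1) *)

Lemma wt_Bm1 : ty <> Tau1 -> wt gBm1.
Proof.
move=> tyE; have NN : (N <= Nh)%N by rewrite Nh_eq.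
by rewrite gBm1_fold; apply: wt_fold => //; apply: wt_B; ilia.
Qed.

Lemma nil_Bm1 k : ty <> Tau1 -> (k <= Nh)%N -> even_root k -> nil_at k gBm1.
Proof.
move=> tyE kN ek; have NN : (N <= Nh)%N by rewrite Nh_eq.
by rewrite gBm1_fold; apply: nil_fold => //; [ilia|apply: nil_B => //; ilia].
Qed.

Lemma bil_0N : ty <> Tau1 -> bl 0 N = 0.
Proof.
move=> tyE; apply: (bil_far n_ge); [ilia|by rewrite Nh_eq|by case: (ty) tyE].
Qed.

Lemma D_Bm1 k : ty <> Tau1 -> (0 < k < N)%N -> D k gBm1.2 = 0.
Proof.
move=> tyE kN; have NN := Nh_eq tyE; have [n0 NE _ _] := index_facts.
rewrite gBm1_fold; have [|||_ L0N] := E_far24 (t := 0) (k := N) tyE; try by lia.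
have [k1|k1] := boolP ((k == 1%N) || (k == (N - 1)%N)); last first.
  by apply: D_fold0; rewrite ?NN //; try lia; apply: D_B; rewrite ?NN; lia.
have [n1|n1] := ltnP 1 n; last first.
  have -> : k = n by lia.
  have n1' : n = 1%N by lia.
  have -> : gB 0 = E n by rewrite -gB_last; congr gB; lia.
  by apply: D_fold_E; rewrite ?NN //; lia.
have [|||RB _] := @B_far 1 0; try by rewrite ?NN; lia.
have [|||_ LB] := @B_far 1 N; try by rewrite ?NN; lia.
have [|||R1 _] := E_far24 (t := N - 1) (k := 0) tyE; try by lia.
have [|||_ L1] := E_far24 (t := 1) (k := N) tyE; try by lia.
rewrite gB_step //; apply: D_fold_fold k1 _ _ _ _ _ _ => //.
- by rewrite NN; split; lia.
- by split; lia.
- by apply: e_f_commute; lia.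
- by rewrite bilC; apply: (bil_far n_ge); [lia|rewrite NN; lia|case: (ty) tyE].
- by split; [exact: wt_B|apply: D_B => //; rewrite ?NN; lia..].
Qed.

Lemma Bm1_commute k : ty <> Tau1 -> (0 < k < N)%N -> (ty = Tau2 -> (1 < k < N.-1)%N) ->
  Rz gBm1 k /\ Lz k gBm1.
Proof.
move=> tyE kN k2; have NN := Nh_eq tyE; have [n0 NE _ _] := index_facts.
have k_Nh : (k <= Nh)%N by rewrite NN; lia.
have w0 : bl k N + wB k 0 + bl k 0 = 0.
  have aux t : ty = t -> bl k N + wB k 0 + bl k 0 = 0; last exact: aux.
  case: t => // tE; first by apply: wW_mid => //; exact: k2.
  by apply: wW4 => //; lia.
have [kn|kn] := eqVneq k n; last first.
  have ek : even_root k by rewrite !even_rootE kn; case: (ty) tyE.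
  apply: commute_even => //; [exact: wt_Bm1|exact: nil_Bm1|exact: D_Bm1|].
  have NN' : (N <= Nh)%N by rewrite NN.
  rewrite gBm1_fold /= !(chi2Dr chiP) chi2_B // !chi2_al //.
  by rewrite -!expfzDr // -!mulrDr addrA w0 mulr0 expr0z.
subst k; rewrite gBm1_fold; have [n1|n1] := ltnP 1 n.
  have [|||RN LN] := E_far24 (t := N) (k := n) tyE; try by lia.
  have [|||R0 L0] := E_far24 (t := 0) (k := n) tyE; try by lia.
  have [||RB LB] := @B_inner 0 n; try by lia.
  by split; [exact: Rz_fold|exact: Lz_fold].
have n1' : n = 1%N by lia.
have -> : gB 0 = E n by rewrite -gB_last; congr gB; lia.
have [b1 b2 b3] := bil_n_neighbours n_ge.
have -> : fold (E n) 0 N = fold (E n) n.-1 n.+1 by congr fold; lia.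
apply: super_fold => //; try by rewrite ?NN; lia.
  by rewrite !even_rootE eqxx.
by split; lia.
Qed.

(** * The elements A_i *)

Lemma gA0_Tau1 : ty = Tau1 -> gA0 = E 0.
Proof.
have aux t : t = Tau1 -> match t with
    | Tau1 => E 0 | Tau2 => gBm1 | Tau4 => br (E N) (br gBm1 (E 0)) end = E 0.
  by move=> ->.
exact: aux.
Qed.
Lemma gA0_Tau2 : ty = Tau2 -> gA0 = gBm1.
Proof.
have aux t : t = Tau2 -> match t with
    | Tau1 => E 0 | Tau2 => gBm1 | Tau4 => br (E N) (br gBm1 (E 0)) end = gBm1.
  by move=> ->.
exact: aux.
Qed.
Lemma gA0_Tau4 : ty = Tau4 -> gA0 = fold gBm1 0 N.
Proof.
have aux t : t = Tau4 -> match t with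
    | Tau1 => E 0 | Tau2 => gBm1 | Tau4 => br (E N) (br gBm1 (E 0)) end = fold gBm1 0 N.
  by move=> ->.
exact: aux.
Qed.

Lemma affine_typeP : [\/ ty = Tau1, ty = Tau2 | ty = Tau4].
Proof. by case: (ty); [constructor 1|constructor 2|constructor 3]. Qed.
Lemma Tau2_neq1 : ty = Tau2 -> ty <> Tau1. Proof. by move=> ->. Qed.
Lemma Tau4_neq1 : ty = Tau4 -> ty <> Tau1. Proof. by move=> ->. Qed.
Lemma n_gt1 : ty <> Tau4 -> (1 < n)%N. Proof. by case: (ty) n_ge. Qed.

Lemma wt_A i : (i < n)%N -> wt (gA i).
Proof.
elim: i => [|i IHi] i_n; last first.
  by rewrite gA_step; apply: wt_fold; [ilia..|apply: IHi; lia].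
have [tE|tE|tE] := affine_typeP; rewrite /=.
- by rewrite gA0_Tau1 //; apply: wt_E.
- by rewrite gA0_Tau2 //; apply/wt_Bm1/Tau2_neq1.
- have NN := Nh_eq (Tau4_neq1 tE).
  by rewrite gA0_Tau4 //; apply: wt_fold; rewrite ?NN //; apply/wt_Bm1/Tau4_neq1.
Qed.

Lemma nil_A k i : (k <= Nh)%N -> even_root k -> (i < n)%N -> nil_at k (gA i).
Proof.
move=> kN ek; elim: i => [|i IHi] i_n; last first.
  by rewrite gA_step; apply: nil_fold => //; [ilia..|apply: IHi; lia].
have [tE|tE|tE] := affine_typeP; rewrite /=.
- rewrite gA0_Tau1 //; apply: nil_E => //; rewrite eq_sym.
  by move: ek; rewrite !even_rootE tE => /andP[].
- by rewrite gA0_Tau2 //; apply: nil_Bm1 => //; exact: Tau2_neq1.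
- have NN : (N <= Nh)%N by rewrite Nh_eq // tE.
  rewrite gA0_Tau4 //; apply: nil_fold => //; first by ilia.
  by apply: nil_Bm1 => //; exact: Tau4_neq1.
Qed.

Lemma A_inner i k : (i.+1 < k)%N -> (k < N - i.+1)%N -> Rz (gA i) k /\ Lz k (gA i).
Proof.
elim: i => [|i IHi] ik kN; last first.
  have [||||Re Le] := @E_far i.+1 k; try by ilia.
  have [||||Rf Lf] := @E_far (N - i.+1) k; try by ilia.
  have [||RA LA] := IHi; try by ilia.
  by rewrite gA_step; split; [exact: Rz_fold|exact: Lz_fold].
have [tE|tE|tE] := affine_typeP; rewrite /=.
- by rewrite gA0_Tau1 //; apply: E_far; ilia.
- rewrite gA0_Tau2 //; apply: Bm1_commute; [exact: Tau2_neq1|ilia|move=> _; lia].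
- have n1 := Tau4_neq1 tE.
  have [|||RN LN] := E_far24 (t := N) (k := k) n1; try by lia.
  have [|||R0 L0] := E_far24 (t := 0) (k := k) n1; try by lia.
  have [||RB LB] := Bm1_commute (k := k) n1; [lia|by rewrite tE|].
  by rewrite gA0_Tau4 //; split; [exact: Rz_fold|exact: Lz_fold].
Qed.

Lemma D_A0 k : (0 < k < N)%N -> D k gA0.2 = 0.
Proof.
move=> kN; have k_Nh : (k <= Nh)%N by ilia.
have [tE|tE|tE] := affine_typeP.
- by rewrite gA0_Tau1 //; apply: D_E => //; lia.
- by rewrite gA0_Tau2 //; apply: D_Bm1 => //; exact: Tau2_neq1.
- have n1 := Tau4_neq1 tE; have NN := Nh_eq n1.
  rewrite gA0_Tau4 //; apply: D_fold0; rewrite ?NN //; try lia.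
  exact: D_Bm1.
Qed.

(** For tau = 4, A_0 folds the same pair 0, N twice. The outer E_e contributes nothing because W has
    weight 0 at alpha_e, and it turns the term [[E_f, Y]] L_e of the inner fold back into W L_e by
    [br_assoc]. *)
Lemma D_fold_twice_e Y e f : (e <= Nh)%N -> (f <= Nh)%N -> e != f -> bl e f = 0 ->
  wt Y -> D e Y.2 = 0 -> chi2 (al e) (fold Y e f).1 = 1 ->
  D e (fold (fold Y e f) e f).2 =
    ((1 - (chi2 (al e) Y.1)^-1) / chi (al e) (al e)) *: ((br (E f) (fold Y e f)).2 * ll e).
Proof.
move=> eN fN ef b0 wY DY sW; set W := fold Y e f in sW *; set c := 1 - _.
have DW : D e W.2 = c *: ((br (E f) Y).2 * ll e) := D_fold_e eN fN ef b0 wY DY.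
have wW : wt W by exact: wt_fold.
have dW : W.1 = (br (E f) Y).1 + al e by rewrite /= addrA.
have Wassoc : (br (br (E f) Y) (E e)).2 = W.2.
  by rewrite /W /fold (br_assoc chiP) //; apply: (rel_E2 rels); rewrite // bilC.
have DWe := der_brE_L chiP (D_EE eN) (wt_E eN eN) dW DW (wW e eN).
rewrite sW invr1 subrr scale0r addr0 Wassoc in DWe.
rewrite /D (der_brr_L chiP (T := W) (a := al e) (X := br W (E e)) (erefl _) DWe
              (D_E fN eN ef) (wt_E fN eN)).
by rewrite chi2_far // invr1 mulr1 brE.
Qed.

Lemma D_fold_twice_f Y e f : (e <= Nh)%N -> (f <= Nh)%N -> e != f -> bl e f = 0 ->
  wt Y -> D f Y.2 = 0 -> chi2 (al f) (fold Y e f).1 = 1 ->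
  D f (fold (fold Y e f) e f).2 =
    ((1 - chi2 (al f) (Y.1 + al e)) / chi (Y.1 + al e) (al f) * chi (al f) (al e))
    *: ((br (fold Y e f) (E e)).2 * kk f).
Proof.
move=> eN fN ef b0 wY DY sW; set W := fold Y e f in sW *; set c := _ / _.
have DW : D f W.2 = c *: ((br Y (E e)).2 * kk f) := D_fold_f eN fN ef wY DY.
have wW : wt W by exact: wt_fold.
have dW : W.1 = (br Y (E e)).1 + al f by rewrite /= addrC.
have fe : f != e by rewrite eq_sym.
have sfe : chi2 (al f) (al e) = 1 by rewrite chi2_far // bilC.
have Lfe : (br (E f) (E e)).2 = 0 by apply: (rel_E2 rels); rewrite // bilC.
have DWe := der_brl_K chiP dW DW (D_E eN fN fe) (wt_E eN fN).
rewrite sfe invr1 mulr1 in DWe.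
have dX : (br W (E e)).1 = (br (br Y (E e)) (E e)).1 + al f.
  by rewrite br_deg dW -addrA [al f + _]addrC addrA.
have wX : wt (br W (E e)) by apply: wt_br => //; exact: wt_E.
have -> : D f (fold W e f).2 = _ :=
  der_Ebr_K chiP (D_EE fN) (wt_E fN fN) dX DWe (wX f fN).
rewrite (br_assoc chiP) // -/(fold Y e f) -/W [X in chi2 _ X]br_deg (chi2Dr chiP) sW.
by rewrite sfe mulr1 subrr mul0r scale0r addr0.
Qed.

Lemma chi2_Bm1_Tau4 k : ty = Tau4 -> (k <= Nh)%N -> chi2 (al k) gBm1.1 = 1.
Proof.
move=> tE kN; have NN := Nh_eq (Tau4_neq1 tE); have NN' : (N <= Nh)%N by rewrite NN.
rewrite gBm1_fold /= !(chi2Dr chiP) chi2_B //; last by ilia.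
by rewrite !chi2_al // -!expfzDr // -!mulrDr addrA wW4 ?mulr0 ?expr0z // -NN.
Qed.

Lemma D0_A0_Tau4 : ty = Tau4 -> D 0 gA0.2 =
  ((1 - (chi2 (al 0) (gB 0).1)^-1) / chi (al 0) (al 0)) *: ((br (E N) gBm1).2 * ll 0).
Proof.
move=> tE; have n1 := Tau4_neq1 tE; have NN := Nh_eq n1.
have [n0 NE _ _] := index_facts; have NN' : (N <= Nh)%N by rewrite NN.
rewrite gA0_Tau4 // gBm1_fold; apply: D_fold_twice_e => //; first by lia.
- exact: bil_0N.
- exact: wt_B.
- by apply: D_B => //; lia.
- by rewrite -gBm1_fold chi2_Bm1_Tau4.
Qed.

Lemma DN_A0_Tau4 : ty = Tau4 -> D N gA0.2 =
  ((1 - chi2 (al N) ((gB 0).1 + al 0)) / chi ((gB 0).1 + al 0) (al N) * chi (al N) (al 0))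
    *: ((br gBm1 (E 0)).2 * kk N).
Proof.
move=> tE; have n1 := Tau4_neq1 tE; have NN := Nh_eq n1.
have [n0 NE _ _] := index_facts; have NN' : (N <= Nh)%N by rewrite NN.
rewrite gA0_Tau4 // gBm1_fold; apply: D_fold_twice_f => //; first by lia.
- exact: bil_0N.
- exact: wt_B.
- by apply: D_B => //; lia.
- by rewrite -gBm1_fold chi2_Bm1_Tau4.
Qed.

Lemma D_A i k : (i.+1 < n)%N -> (k <= Nh)%N -> k != i.+1 -> k != (N - i.+1)%N ->
  D k (gA i.+1).2 = 0.
Proof.
have [n0 NE N1 NhN] := index_facts.
elim/ltn_ind: i k => -[_|i IHi] k i_n kN ke kf; last first.
  have [||||_ Le] := @E_far i.+2 (N - i.+2); try by lia.
  have [||||_ Le2] := @E_far i.+1 (N - i.+2); try by lia.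
  have [||||Rf2 _] := @E_far (N - i.+1) i.+2; try by lia.
  have [k2|k2] := boolP ((k == i.+1) || (k == (N - i.+1)%N)); last first.
    by rewrite gA_step; apply: D_fold0; rewrite -?gA_step //; try lia; apply: (IHi i); lia.
  have DT m : (m == i.+1) || (m == (N - i.+1)%N) -> D m (gA i).2 = 0.
    by case: (i) IHi i_n => [|j] IHj i_n mi; [apply: D_A0; lia|apply: (IHj j); lia].
  have [||RT _] := @A_inner i i.+2; try by lia.
  have [||_ LT] := @A_inner i (N - i.+2); try by lia.
  rewrite gA_step [gA i.+1]gA_step; apply: D_fold_fold k2 _ _ _ _ _ _ => //.
  - by split; lia.
  - by split; lia.
  - by apply: e_f_commute; lia.
  - by rewrite bilC; apply: (bil_far n_ge); [lia..|case: (ty) => //; lia].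
  - by split; [apply: wt_A; lia|apply: DT; rewrite eqxx ?orbT..].
have [||||_ L1f] := @E_far 1 (N - 1); try by lia.
have [k0|k0] := boolP (0 < k < N)%N.
  by rewrite gA_step; apply: D_fold0; rewrite ?D_A0 //=; lia.
have {}k0 : (k == 0%N) || (k == N) by lia.
(* Only 0 and N are left, the indices that enter through A_0; its shape depends on tau. *)
have [tE|tE|tE] := affine_typeP.
- have kE : k = 0%N by case/orP: k0 => /eqP // kE; move: kN; rewrite kE /rkNhat tE; lia.
  by rewrite gA_step /= gA0_Tau1 // kE; apply: D_fold_E => //; lia.
- have n1 := Tau2_neq1 tE; have NN := Nh_eq n1; have bN1 : bl N 1 = 0.
    by rewrite bilC; apply: (bil_far n_ge); [lia|rewrite NN; lia|case: (ty) n1].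
  have [|||RN _] := E_far24 (t := N) (k := 1) n1; try by lia.
  have [|||_ L0] := E_far24 (t := 0) (k := N - 1) n1; try by lia.
  have [|RB LB] := @B_edge 0; first by lia.
  rewrite gA_step /= gA0_Tau2 // gBm1_fold; apply: D_fold_fold k0 _ _ _ _ _ _ => //.
  + by rewrite NN; split; lia.
  + by split; lia.
  + exact: bil_0N.
  + by split; [exact: wt_B|apply: D_B; rewrite ?NN; lia..].
- have n1 := Tau4_neq1 tE; have NN := Nh_eq n1; have bN1 : bl N 1 = 0.
    by rewrite bilC; apply: (bil_far n_ge); [lia|rewrite NN; lia|case: (ty) n1].
  have [|||RN _] := E_far24 (t := N) (k := 1) n1; try by lia.
  have [|||_ L0] := E_far24 (t := 0) (k := N - 1) n1; try by lia.
  have [||RB _] := Bm1_commute (k := 1) n1; [lia|by rewrite tE|].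
  have [||_ LB] := Bm1_commute (k := N - 1) n1; [lia|by rewrite tE|].
  have NN' : (N <= Nh)%N by rewrite NN.
  rewrite gA_step; case/orP: k0 => /eqP kE; rewrite kE in kN ke kf *.
    apply: (D_fold_L (T := br (E N) gBm1) _ _ _ _ _ _ (D0_A0_Tau4 tE)) => //; try lia.
      by rewrite gA0_Tau4 //; move: gBm1 => W; rewrite /= addrA.
    exact: (br_brl0 chiP).
  apply: (D_fold_K (T := br gBm1 (E 0)) _ _ _ _ _ _ (DN_A0_Tau4 tE)) => //; try lia.
    by rewrite gA0_Tau4 //; move: gBm1 => W; rewrite /= [LHS]addrC.
  exact: (br_brr0 chiP).
Qed.

(** * Cancellation between adjacent summands *)

(** The difference of the two sides is the twisted commutator of f with the vanishing element xy - p
    yx; in effect f is moved from x to y. *)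
Lemma bracket_swap_L (x y f : A) (xf yf p : K) : xf != 0 -> yf != 0 -> p != 0 ->
  x * y = p *: (y * x) ->
  (f * x - xf^-1 *: (x * f)) * y - (p / yf) *: (y * (f * x - xf^-1 *: (x * f))) =
  - xf^-1 *: (x * (f * y - yf^-1 *: (y * f)) - (xf * p) *: ((f * y - yf^-1 *: (y * f)) * x)).
Proof.
move=> x0 y0 p0 /eqP; rewrite -subr_eq0 => /eqP r0.
have : f * (x * y - p *: (y * x)) - (xf * yf)^-1 *: ((x * y - p *: (y * x)) * f) = 0.
  by rewrite r0 mulr0 mul0r scaler0 subr0.
move=> H; apply/eqP; rewrite -subr_eq0 -H; apply/eqP.
by nc_coefs K A; field; rewrite ?x0 ?y0.
Qed.

(** To be applied to X = A_(j-1) and Y = B_j, whose folds are A_j and B_(j-1). The two derivatives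
    contain E_f bracketed with X and with Y respectively; as [[X, Y]] = 0, [bracket_swap_L] makes
    them proportional. *)
Lemma D_pair_e X Y e f (a a' : K) : (e <= Nh)%N -> (f <= Nh)%N -> e != f -> bl e f = 0 ->
  wt X -> wt Y -> D e X.2 = 0 -> D e Y.2 = 0 -> (br X Y).2 = 0 ->
  chi2 (al e) X.1 = chi2 (al e) Y.1 -> chi2 (al e) X.1 * chi2 (al f) X.1 = 1 ->
  a = a' * chi X.1 (al f) * chi Y.1 (al e) ->
  D e (a *: (br (fold X e f) Y).2 + a' *: (br X (fold Y e f)).2) = 0.
Proof.
move=> eN fN ef b0 wX wY DX DY XY sXY sX aE.
have DfX := D_fold_e eN fN ef b0 wX DX.
have DfY := D_fold_e eN fN ef b0 wY DY.
have dX : (fold X e f).1 = (br (E f) X).1 + al e by rewrite /= addrA.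
have dY : (fold Y e f).1 = (br (E f) Y).1 + al e by rewrite /= addrA.
have H1 := der_brl_L chiP dX DfX DY (wY e eN).
have H2 := der_brr_L chiP dY DfY DX (wX e eN).
rewrite /D derD !derZ H1 H2 -sXY aE.
have -> : (chi (br (E f) Y).1 X.1)^-1 * (chi2 (al e) X.1)^-1 =
    chi X.1 (al f) * (chi Y.1 X.1)^-1.
  have sE : (chi2 (al e) X.1)^-1 = chi (al f) X.1 * chi X.1 (al f).
    by rewrite -[RHS](mulKf (chi2_neq0 chiP (al e) X.1)) -/(chi2 _ _) sX mulr1.
  by rewrite sE /= (chiDl chiP); field; rewrite !(chi_neq0 chiP).
have -> : (br (br (E f) X) Y).2 = - (chi X.1 (al f))^-1 *: (X.2 * (br (E f) Y).2 -
    (chi X.1 (al f) * (chi Y.1 X.1)^-1) *: ((br (E f) Y).2 * X.2)).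
  rewrite -(@bracket_swap_L X.2 Y.2 (E0 f) _ (chi Y.1 (al f))) ?invr_eq0 ?(chi_neq0 chiP) //.
    by rewrite /= (chiDr chiP) invfM mulrC.
  exact/br_eq0.
rewrite -!scalerAl !scalerA -scalerDl.
rewrite (_ : _ + _ = 0) ?scale0r //.
by field; rewrite !(chi_neq0 chiP) (chi2_neq0 chiP).
Qed.

Lemma bracket_swap_K (x y e : A) (ye ex p : K) : ye != 0 -> ex != 0 -> p != 0 ->
  x * y = p *: (y * x) ->
  x * (y * e - ye^-1 *: (e * y)) - (p / ex) *: ((y * e - ye^-1 *: (e * y)) * x) =
  - ye^-1 *: ((x * e - ex^-1 *: (e * x)) * y - (ye * p) *: (y * (x * e - ex^-1 *: (e * x)))).
Proof.
move=> x0 y0 p0 /eqP; rewrite -subr_eq0 => /eqP r0.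
have : (x * y - p *: (y * x)) * e - (ye * ex)^-1 *: (e * (x * y - p *: (y * x))) = 0.
  by rewrite r0 mulr0 mul0r scaler0 subr0.
move=> H; apply/eqP; rewrite -subr_eq0 -H; apply/eqP.
by nc_coefs K A; field; rewrite ?x0 ?y0.
Qed.

Lemma D_pair_f X Y e f (a a' : K) : (e <= Nh)%N -> (f <= Nh)%N -> e != f -> bl e f = 0 ->
  wt X -> wt Y -> D f X.2 = 0 -> D f Y.2 = 0 -> (br X Y).2 = 0 ->
  chi2 (al f) X.1 = chi2 (al f) Y.1 -> chi2 (al e) Y.1 * chi2 (al f) Y.1 = 1 ->
  a = a' * chi X.1 (al f) * chi Y.1 (al e) ->
  D f (a *: (br (fold X e f) Y).2 + a' *: (br X (fold Y e f)).2) = 0.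
Proof.
move=> eN fN ef b0 wX wY DX DY XY sXY sY aE.
have DfX := D_fold_f eN fN ef wX DX.
have DfY := D_fold_f eN fN ef wY DY.
have dX : (fold X e f).1 = (br X (E e)).1 + al f by rewrite /= addrC.
have dY : (fold Y e f).1 = (br Y (E e)).1 + al f by rewrite /= addrC.
have H1 := der_brl_K chiP dX DfX DY (wY f fN).
have H2 := der_brr_K chiP dY DfY DX (wX f fN).
have sfY : (chi2 (al f) Y.1)^-1 = chi (al e) Y.1 * chi Y.1 (al e).
  by rewrite -[RHS](mulfK (chi2_neq0 chiP (al f) Y.1)) -/(chi2 _ _) sY mul1r.
have sfX : (chi2 (al f) X.1)^-1 = chi (al e) Y.1 * chi Y.1 (al e) by rewrite sXY.
rewrite /D derD !derZ H1 H2 aE sfY.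
have -> : (chi Y.1 (br X (E e)).1)^-1 * (chi (al e) Y.1 * chi Y.1 (al e)) =
    chi (al e) Y.1 * (chi Y.1 X.1)^-1.
  by rewrite /= (chiDr chiP); field; rewrite !(chi_neq0 chiP).
have -> : (br X (br Y (E e))).2 = - (chi (al e) Y.1)^-1 *: ((br X (E e)).2 * Y.2 -
    (chi (al e) Y.1 * (chi Y.1 X.1)^-1) *: (Y.2 * (br X (E e)).2)).
  rewrite -(@bracket_swap_K X.2 Y.2 (E0 e) _ (chi (al e) X.1)) ?invr_eq0 ?(chi_neq0 chiP) //.
    by rewrite /= (chiDl chiP) invfM.
  exact/br_eq0.
rewrite -!scalerAl !scalerA -scalerDl.
rewrite (_ : _ + _ = 0) ?scale0r //.
have s0 := chi2_neq0 chiP (al f) Y.1.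
have -> : chi2 (al f) (X.1 + al e) = chi2 (al f) (Y.1 + al e).
  by rewrite !(chi2Dr chiP) sXY.
have xy : chi (al f) Y.1 * chi Y.1 (al e) * (chi (al e) Y.1 * chi Y.1 (al f)) = 1.
  by rewrite -sY !chi2E; ring.
have -> : chi (al f) Y.1 = (chi Y.1 (al e) * chi (al e) Y.1 * chi Y.1 (al f))^-1.
  rewrite -[RHS]mul1r -xy; field; rewrite !(chi_neq0 chiP) //.
rewrite !(chiDl chiP).
by field; rewrite !(chi_neq0 chiP).
Qed.

(* The recursion for the scalars a_i is exactly the hypothesis of D_pair_e and D_pair_f:
   the contributions of A_j, B_j and of A_(j-1), B_(j-1) cancel. *)
Lemma a_coef_step j : (0 < j < n)%N ->
  a_coef chi j = a_coef chi j.-1 * chi (gA j.-1).1 (al (N - j)) * chi (gB j).1 (al j).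
Proof.
case: j => // j /= jn; have [n0 NE _ _] := index_facts.
rewrite -!mulrA; congr (_ * _).
have dB : \sum_(j.+2 <= t < N - j.+1) al t = (gB j.+1).1.
  by rewrite gB_deg -(deg_B chi) //; lia.
rewrite [in X in chi X (- _)]big_ltn; last by lia.
rewrite dB; have jj : (0 < j.+1 < n)%N by lia.
have [eN fN] : (j.+1 <= Nh)%N /\ (N - j.+1 <= Nh)%N by split; ilia.
have [ee ef] := even_mid jj.
have [we wf] := wB_diag n_ge jj.
(* The degree of A_(j+1) contains alpha_f with f = N - j - 1. The resulting diagonal value
   chi(alpha_f, alpha_f) is what converts chi(alpha_e, deg B)^-1 into chi(deg B, alpha_e), for e = j
   + 1 and B = B_(j+1). *)
have ff : chi (al (N - j.+1)) (al (N - j.+1)) = chi2 (al j.+1) (gB j.+1).1.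
  by rewrite chi2_B // wf chi_even.
rewrite -(deg_gAB jn) gA_step /fold !br_deg /= !(chiDl chiP) !(chiNl chiP) !(chiNr chiP).
rewrite ff !chi2E.
by field; rewrite !(chi_neq0 chiP).
Qed.

(** * Z commutes with every F_k *)

Definition gZ : A :=
  (if ty is Tau4 then a_minus1 chi *: gBm1.2 ^+ 2 else 0)
    + \sum_(i < n) a_coef chi i *: (br (gA i) (gB i)).2.

Lemma br_B0 X i : (i < n)%N ->
  (forall k, (i < k)%N -> (k < N - i)%N -> Rz X k) -> (br X (gB i)).2 = 0.
Proof.
move=> i_n; elim/gB_ind: i / i_n => [|i i_n IHi] XE.
  by rewrite gB_last; apply: XE; ilia.
rewrite gB_step //; apply: (br_brr0 chiP); first by apply: XE; ilia.
apply: (br_brr0 chiP); last by apply: XE; ilia.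
by apply: IHi => [|k ik kN]; [lia|apply: XE; lia].
Qed.

Lemma AB_commute j : (0 < j < n)%N -> (br (gA j.-1) (gB j)).2 = 0.
Proof.
move=> jn; apply: br_B0 => [|k jk kN]; first by lia.
by have [||RA _ //] := @A_inner j.-1 k; ilia.
Qed.

Lemma chi2_pair j : (0 < j < n)%N ->
  let e := j in let f := (N - j)%N in let X := gA j.-1 in let Y := gB j in
  [/\ chi2 (al e) X.1 = chi2 (al e) Y.1, chi2 (al e) X.1 * chi2 (al f) X.1 = 1,
      chi2 (al f) X.1 = chi2 (al f) Y.1 & chi2 (al e) Y.1 * chi2 (al f) Y.1 = 1].
Proof.
move=> jn e f X Y; have [w1 w2 w3] := wB_pair n_ge jn.
have [eN fN] : (e <= Nh)%N /\ (f <= Nh)%N by split; ilia.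
have [j1 j2] : (j.-1 < n)%N /\ (j < n)%N by lia.
rewrite !chi2_A // !chi2_B // w1 w2 w3 !mulrN !opprK -!expfzDr //.
by split=> //; rewrite ?subrr ?addNr ?expr0z.
Qed.

Lemma D_Z_sum k : D k gZ = (if ty is Tau4 then a_minus1 chi *: D k (gBm1.2 ^+ 2) else 0)
  + \sum_(i < n) a_coef chi i *: D k (br (gA i) (gB i)).2.
Proof.
rewrite /gZ /D derD der_sum; congr (_ + _); last by apply: eq_bigr => i _; rewrite derZ.
have aux t : der (F k) (if t is Tau4 then a_minus1 chi *: gBm1.2 ^+ 2 else 0) =
    if t is Tau4 then a_minus1 chi *: der (F k) (gBm1.2 ^+ 2) else 0.
  by case: t; rewrite ?derZ // /der mul0r mulr0 subrr.
exact: aux.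
Qed.

Lemma D_Bm1_sq k : (0 < k < N)%N ->
  (if ty is Tau4 then a_minus1 chi *: D k (gBm1.2 ^+ 2) else 0) = 0.
Proof.
move=> kN; have aux t : ty = t ->
    (if t is Tau4 then a_minus1 chi *: D k (gBm1.2 ^+ 2) else 0) = 0; last exact: aux.
case: t => // tE; have := D_Bm1 (Tau4_neq1 tE) kN; rewrite expr2 /D derM => ->.
by rewrite mul0r mulr0 addr0 scaler0.
Qed.

Lemma D_A_pos i k : (i < n)%N -> (0 < k < N)%N -> k != i -> k != (N - i)%N ->
  D k (gA i).2 = 0.
Proof.
case: i => [|i] i_n kN ke kf; first exact: D_A0.
by apply: D_A => //; ilia.
Qed.

Lemma D_Z_mid j k : (0 < j < n)%N -> (k == j) || (k == (N - j)%N) -> D k gZ = 0.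
Proof.
move=> jn kj; have [j1 j2] : (j.-1 < n)%N /\ (j < n)%N by lia.
have kN : (0 < k < N)%N by ilia.
rewrite D_Z_sum D_Bm1_sq // add0r (bigD1 (Ordinal j2)) //= (bigD1 (Ordinal j1)) /=; last first.
  by rewrite -val_eqE /=; lia.
rewrite big1 ?addr0 => [|[i i_n]]; last first.
  rewrite -!val_eqE /= => /andP[ij ij1]; rewrite /D der_br0 ?scaler0 //.
    by apply: D_A_pos => //; ilia.
  by apply: D_B => //; ilia.
have jE : j = j.-1.+1 by lia.
have -> : gA j = fold (gA j.-1) j (N - j) by rewrite {1 3 4}jE gA_step -jE.
have -> : gB j.-1 = fold (gB j) j (N - j) by rewrite gB_step -?jE.
rewrite /D -!derZ -derD -/(D k _).
have [s1 s2 s3 s4] := chi2_pair jn.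
have [eN fN] : (j <= Nh)%N /\ (N - j <= Nh)%N by split; ilia.
case/orP: kj => /eqP ->.
  apply: D_pair_e => //; try exact: wt_A; try exact: wt_B.
  - by ilia.
  - exact: e_f_commute.
  - by apply: D_A_pos; ilia.
  - by apply: D_B; ilia.
  - exact: AB_commute.
  - exact: a_coef_step.
apply: D_pair_f => //; try exact: wt_A; try exact: wt_B.
- by ilia.
- exact: e_f_commute.
- by apply: D_A_pos; ilia.
- by apply: D_B; ilia.
- exact: AB_commute.
- exact: a_coef_step.
Qed.

(** Only the summand with B_(n-1) = E_n can contribute. Its derivative is A_(n-1) L_n times 1 - 1,
    since A_(n-1) has weight 0 at alpha_n. *)
Lemma D_Z_n : D n gZ = 0.
Proof.
have [n0 NE N1 NhN] := index_facts; have nN : (0 < n < N)%N by lia.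
rewrite D_Z_sum D_Bm1_sq // add0r big1 // => -[i i_n] _ /=.
rewrite (_ : D n _ = 0) ?scaler0 //.
have DA : D n (gA i).2 = 0 by apply: D_A_pos => //; lia.
have [i1|i1] := ltnP i.+1 n; first by apply: der_br0 => //; apply: D_B; lia.
have iE : i = n.-1 by lia.
have n_Nh : (n <= Nh)%N by lia.
have wA : wt (gA i) by exact: wt_A.
have -> : gB i = E n by rewrite iE gB_last.
have -> : D n (br (gA i) (E n)).2 = _ :=
  der_brE chiP (D_EE n_Nh) (wt_E n_Nh n_Nh) DA (wA n n_Nh).
by rewrite chi2_A // iE wB_n // mulr0 oppr0 expr0z invr1 subrr scale0r.
Qed.

Lemma D_AB_outer k : (k <= Nh)%N -> (k == 0%N) || (k == N) ->
  \sum_(i < n) a_coef chi i *: D k (br (gA i) (gB i)).2 = D k (br gA0 (gB 0)).2.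
Proof.
move=> kN k0; have [n0 NE N1 NhN] := index_facts.
rewrite (bigD1 (Ordinal n0)) //= scale1r big1 ?addr0 // => -[i i_n].
rewrite -val_eqE /= => i0; rewrite /D der_br0 ?scaler0 //.
  by case: i i_n i0 => // i i_n _; apply: D_A => //; lia.
by apply: D_B => //; lia.
Qed.

Lemma D_Z_0_Tau1 : ty = Tau1 -> D 0 gZ = 0.
Proof.
move=> tE; have [n0 NE N1 NhN] := index_facts.
have N0 : (0 <= Nh)%N by []; have n1 : (1 < n)%N by apply: n_gt1; rewrite tE.
rewrite D_Z_sum D_AB_outer // gA0_Tau1 //.
have -> : (if ty is Tau4 then a_minus1 chi *: D 0 (gBm1.2 ^+ 2) else 0) = 0.
  have aux t : t = Tau1 -> (if t is Tau4 then a_minus1 chi *: D 0 (gBm1.2 ^+ 2) else 0) = 0.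
    by move=> ->.
  exact: aux.
have DB : D 0 (gB 0).2 = 0 by apply: D_B => //; lia.
have wB0 : wt (gB 0) by exact: wt_B.
rewrite add0r; have -> : D 0 (br (E 0) (gB 0)).2 = _ :=
  der_Ebr chiP (D_EE N0) (wt_E N0 N0) DB (wB0 0%N N0).
by rewrite chi2_B // wB_00_Tau1 // mulr0 expr0z subrr mul0r scale0r.
Qed.

(** Multiplying the Serre-type relation by y on the left and on the right and discarding the terms
    with y^2 yields 1 + r times the square. *)
Lemma bracket_sq_R (y e : A) (p r : K) : p != 0 -> 1 + r != 0 -> y * y = 0 ->
  (y * e - p *: (e * y)) * e - (p * r) *: (e * (y * e - p *: (e * y))) = 0 ->
  (y * e - p *: (e * y)) * (y * e - p *: (e * y)) = 0.
Proof.
move=> p0 r0 yy R0; apply: (scalerI r0); rewrite scaler0.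
have : - p^-1 *: (y * ((y * e - p *: (e * y)) * e - (p * r) *: (e * (y * e - p *: (e * y)))))
  - p *: (((y * e - p *: (e * y)) * e - (p * r) *: (e * (y * e - p *: (e * y)))) * y)
  + p^-1 *: (y * y * e * e) + (p ^+ 3 * r) *: (e * e * (y * y))
  - ((1 + r) * p) *: (e * (y * y) * e) = 0.
  by rewrite R0 yy !(mul0r, mulr0, scaler0, subr0, addr0).
by move=> H; rewrite -[RHS]H; nc_coefs K A; field; rewrite ?p0.
Qed.

Lemma bracket_sq_L (x f : A) (p r : K) : p != 0 -> 1 + r != 0 -> x * x = 0 ->
  f * (f * x - p *: (x * f)) - (p * r) *: ((f * x - p *: (x * f)) * f) = 0 ->
  (f * x - p *: (x * f)) * (f * x - p *: (x * f)) = 0.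
Proof.
move=> p0 r0 xx R0; apply: (scalerI r0); rewrite scaler0.
have : - p^-1 *: ((f * (f * x - p *: (x * f)) - (p * r) *: ((f * x - p *: (x * f)) * f)) * x)
  - p *: (x * (f * (f * x - p *: (x * f)) - (p * r) *: ((f * x - p *: (x * f)) * f)))
  + p^-1 *: (f * f * (x * x)) + (p ^+ 3 * r) *: (x * x * f * f)
  - ((1 + r) * p) *: (f * (x * x) * f) = 0.
  by rewrite R0 xx !(mul0r, mulr0, scaler0, subr0, addr0).
by move=> H; rewrite -[RHS]H; nc_coefs K A; field; rewrite ?p0.
Qed.

Lemma chi_even_neqN1 k : (k <= Nh)%N -> even_root k -> 1 + (chi (al k) (al k))^-1 != 0.
Proof.
move=> kN ek; have := chi_even_not_root1 kN ek (isT : (0 < 2)%N).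
apply: contra; rewrite addrC addr_eq0 => /eqP cE.
by rewrite -[chi _ _]invrK cE invrN invr1 sqrrN expr1n.
Qed.

Lemma br_sq_R X k : (k <= Nh)%N -> even_root k -> X.2 * X.2 = 0 ->
  (br (br X (E k)) (E k)).2 = 0 -> (br X (E k)).2 * (br X (E k)).2 = 0.
Proof.
move=> kN ek XX H; apply: (bracket_sq_R _ (chi_even_neqN1 kN ek) XX).
  by rewrite invr_eq0 (chi_neq0 chiP).
by rewrite -invfM -(chiDr chiP).
Qed.

Lemma br_sq_L X k : (k <= Nh)%N -> even_root k -> X.2 * X.2 = 0 ->
  (br (E k) (br (E k) X)).2 = 0 -> (br (E k) X).2 * (br (E k) X).2 = 0.
Proof.
move=> kN ek XX H; apply: (bracket_sq_L _ (chi_even_neqN1 kN ek) XX).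
  by rewrite invr_eq0 (chi_neq0 chiP).
by rewrite -invfM mulrC -(chiDl chiP).
Qed.

(** B_i is attached to the isotropic vector epsilon_(i+1) - epsilon_(N-i). Square zero passes from
    E_n outwards through each fold, the relations of [B_serre] being the hypotheses needed at its
    two brackets. *)
Lemma B_sq i : (i < n)%N -> (gB i).2 * (gB i).2 = 0.
Proof.
elim/gB_ind=> {i} [|i i_n IHi].
  by rewrite gB_last; apply: E_sq; [ilia|rewrite !even_rootE eqxx].
have [Se Sf] := B_serre i_n; have jn : (0 < i.+1 < n)%N by lia.
have [ee ef] := even_mid jn.
have [eN fN] : (i.+1 <= Nh)%N /\ (N - i.+1 <= Nh)%N by split; ilia.
rewrite gB_step //; apply: br_sq_L => //; apply: br_sq_R => //; apply: IHi; lia.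
Qed.

Lemma chi_B i : (i < n)%N -> chi (gB i).1 (gB i).1 = -1.
Proof.
elim/gB_ind=> {i} [|i i_n IHi].
  by rewrite gB_last chi_odd //; [ilia|rewrite !even_rootE eqxx].
have jn : (0 < i.+1 < n)%N by lia.
have [ee ef] := even_mid jn; have [we wf] := wB_diag n_ge jn.
have [_ _ wN] := wB_pair n_ge jn.
have [eN fN] : (i.+1 <= Nh)%N /\ (N - i.+1 <= Nh)%N by split; ilia.
have BB : chi (gB i.+1).1 (gB i.+1).1 = -1 by apply: IHi; lia.
have sef := chi2_far eN fN (e_f_commute jn).
have se := chi2_B eN i_n; have sf := chi2_B fN i_n.
have ce := chi_even eN ee; have cf := chi_even fN ef.
rewrite gB_step // /fold !br_deg /= !(chiDl chiP) !(chiDr chiP).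
transitivity (chi (gB i.+1).1 (gB i.+1).1 * chi2 (al i.+1) (al (N - i.+1))
  * (chi2 (al i.+1) (gB i.+1).1 * chi (al i.+1) (al i.+1))
  * (chi2 (al (N - i.+1)) (gB i.+1).1 * chi (al (N - i.+1)) (al (N - i.+1)))).
  by rewrite !chi2E; ring.
rewrite BB sef se sf ce cf -!expfzDr // we wN mulrN wf !addNr expr0z !mulr1 //.
Qed.

Lemma chi2_B0_0N : ty <> Tau1 -> chi2 (al 0) (gB 0).1 * chi2 (al N) (gB 0).1 = 1.
Proof.
move=> n1; have NN := Nh_eq n1; have [n0 _ _ _] := index_facts.
by rewrite !chi2_B ?NN // wB_0N // -expfzDr // mulrN subrr expr0z.
Qed.

(** Only [[A_0, B_0]] contributes, and A_0 is a fold of B_0 itself. As chi(deg B_0, deg B_0) = -1,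
    the mixed terms B_0 E B_0 cancel in the derivative and each remaining term contains B_0^2. *)
Lemma D_Z_0_Tau2 : ty = Tau2 -> D 0 gZ = 0 /\ D N gZ = 0.
Proof.
move=> tE; have [n0 NE N1 NhN] := index_facts; have n1 := Tau2_neq1 tE.
have NN := Nh_eq n1; have NN' : (N <= Nh)%N by rewrite NN.
have sq0 k : (if ty is Tau4 then a_minus1 chi *: D k (gBm1.2 ^+ 2) else 0) = 0.
  have aux t : t = Tau2 -> (if t is Tau4 then a_minus1 chi *: D k (gBm1.2 ^+ 2) else 0) = 0.
    by move=> ->.
  exact: aux.
rewrite !D_Z_sum !sq0 !add0r !D_AB_outer ?eqxx ?orbT //.
rewrite gA0_Tau2 // gBm1_fold; set Y := gB 0.
have YY : Y.2 * Y.2 = 0 by exact: B_sq.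
have cY : chi Y.1 Y.1 = -1 by exact: chi_B.
have DY0 : D 0 Y.2 = 0 by apply: D_B => //; lia.
have DYN : D N Y.2 = 0 by apply: D_B => //; lia.
have wY : wt Y by exact: wt_B.
have ef : 0%N != N by lia.
have dY0 : (fold Y 0 N).1 = (br (E N) Y).1 + al 0 by rewrite /= addrA.
have dYN : (fold Y 0 N).1 = (br Y (E 0)).1 + al N by rewrite /= addrC.
have D0 := D_fold_e (leq0n _) NN' ef (bil_0N n1) wY DY0.
have DN := D_fold_f (leq0n _) NN' ef wY DYN.
have -> : D 0 (br (fold Y 0 N) Y).2 = _ := der_brl_L chiP dY0 D0 DY0 (wY 0%N (leq0n _)).
have -> : D N (br (fold Y 0 N) Y).2 = _ := der_brl_K chiP dYN DN DYN (wY N NN').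
have -> : (br (br (E N) Y) Y).2 = 0.
  rewrite /= (chiDr chiP) cY.
  have u0 := chi_neq0 chiP Y.1 (al N); move: (chi Y.1 (al N)) u0 => u u0.
  have -> : (E0 N * Y.2 - u^-1 *: (Y.2 * E0 N)) * Y.2
      - (u * -1)^-1 *: (Y.2 * (E0 N * Y.2 - u^-1 *: (Y.2 * E0 N)))
      = E0 N * (Y.2 * Y.2) - u^-1 ^+ 2 *: (Y.2 * Y.2 * E0 N).
    by nc_coefs K A; field; rewrite ?u0 ?oppr_eq0 ?oner_eq0.
  by rewrite YY mul0r mulr0 !scaler0 subrr.
split; first by rewrite mul0r scaler0.
have sfe : chi2 (al N) Y.1 = (chi2 (al 0) Y.1)^-1.
  by rewrite -[LHS](mulKf (chi2_neq0 chiP (al 0) Y.1)) chi2_B0_0N // mulr1.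
rewrite sfe invrK /= (chiDr chiP) cY.
set c := _ * chi2 _ _.
have -> : c = - chi (al 0) Y.1.
  by rewrite /c !chi2E; field; rewrite ?(chi_neq0 chiP) ?oppr_eq0 ?oner_eq0.
have u0 := chi_neq0 chiP (al 0) Y.1; move: (chi (al 0) Y.1) u0 => u u0.
have -> : (Y.2 * E0 0 - u^-1 *: (E0 0 * Y.2)) * Y.2
    - (- u) *: (Y.2 * (Y.2 * E0 0 - u^-1 *: (E0 0 * Y.2)))
    = u *: (Y.2 * Y.2 * E0 0) - u^-1 *: (E0 0 * (Y.2 * Y.2)).
  by nc_coefs K A; field; rewrite ?u0 ?oner_eq0.
by rewrite YY mul0r mulr0 !scaler0 subrr mul0r scaler0.
Qed.

(** * The case tau = 4: B_(-1)^2 against [[A_0, B_0]] *)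

Section Tau4Sum.
Variables (Y : hom) (e f : nat) (c : K).
Let W := fold Y e f.
Hypotheses (eN : (e <= Nh)%N) (fN : (f <= Nh)%N) (ef : e != f) (bef : bl e f = 0).
Hypotheses (wY : wt Y) (WY : (br W Y).2 = 0).
Hypotheses (seW : chi2 (al e) W.1 = 1) (sfW : chi2 (al f) W.1 = 1).
Hypotheses (cWW : chi W.1 W.1 = -1).
Hypothesis sY : chi2 (al e) Y.1 * chi2 (al f) Y.1 = 1.
Hypothesis cef : chi (al e) (al e) * chi (al f) (al f) = 1.
Hypothesis cE : c = chi (al f) (al e) * chi (al e) W.1 * chi (al f) W.1.

Let cWe : chi W.1 (al e) = (chi (al e) W.1)^-1.
Proof. by rewrite -[LHS](mulKf (chi_neq0 chiP (al e) W.1)) -/(chi2 _ _) seW mulr1. Qed.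
Let cWf : chi W.1 (al f) = (chi (al f) W.1)^-1.
Proof. by rewrite -[LHS](mulKf (chi_neq0 chiP (al f) W.1)) -/(chi2 _ _) sfW mulr1. Qed.
Let cYW : chi Y.1 W.1 = - (chi (al e) W.1 * chi (al f) W.1)^-1.
Proof.
rewrite -mulN1r -cWW [chi W.1 W.1](chiDl chiP (al f) (Y.1 + al e)) (chiDl chiP).
by field; rewrite !(chi_neq0 chiP).
Qed.
Let wW : wt W. Proof. exact: wt_fold. Qed.
Let WYE : W.2 * Y.2 = - (chi (al e) W.1 * chi (al f) W.1) *: (Y.2 * W.2).
Proof. by move/br_eq0: WY => ->; rewrite cYW invrN invrK. Qed.

(** Here Y = B_0, W = B_(-1), the fold of W is A_0, and e, f are 0 and N. With T = [[E_f, Y]], the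
    derivative of W^2 consists of T W L_e and W T L_e; commuting W past Y rewrites that of
    [[A_0, Y]] in the same two products, and c is the scalar for which both coefficients cancel. *)
Lemma D_tau4_e : D e Y.2 = 0 ->
  D e (c *: (W.2 * W.2) + (br (fold W e f) Y).2) = 0.
Proof.
move=> DY; have DW := D_fold_e eN fN ef bef wY DY.
have DA := D_fold_twice_e eN fN ef bef wY DY seW.
have dA : (fold W e f).1 = (br (E f) W).1 + al e by rewrite [LHS]addrA.
have DAY := der_brl_L chiP dA DA DY (wY eN).
have [_ lW] := wW eN.
rewrite /D derD derZ derM -/(D e W.2) DW DAY -/W.
set T := (br (E f) Y).2; set d := 1 - _.
have -> : (br (br (E f) W) Y).2 = - (chi (al e) W.1 * chi (al f) W.1) *: (T * W.2)
    - chi (al f) W.1 *: (W.2 * T).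
  rewrite {1}brE [(br (E f) W).1]br_deg (chiDr chiP) cYW [(br (E f) W).2]brE /T brE.
  rewrite -[(E f).1]/(al f) -[(E f).2]/(E0 f) cWf invrK.
  have ew := chi_neq0 chiP (al e) W.1; have fw := chi_neq0 chiP (al f) W.1.
  have yf := chi_neq0 chiP Y.1 (al f).
  move: WYE => /eqP; rewrite -subr_eq0.
  move: (chi (al e) W.1) (chi (al f) W.1) (chi Y.1 (al f)) ew fw yf => u v y u0 v0 y0.
  move=> /eqP R0.
  (* The commutation relation of W and Y, twisted-commuted with E_f, as in [bracket_swap_L]. *)
  have H : E0 f * (W.2 * Y.2 - - (u * v) *: (Y.2 * W.2))
     - (v / y) *: ((W.2 * Y.2 - - (u * v) *: (Y.2 * W.2)) * E0 f) = 0 :> A.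
    by rewrite R0 mulr0 mul0r scaler0 subr0.
  apply/eqP; rewrite -subr_eq0 -[X in _ == X]H; apply/eqP.
  by nc_coefs K A; field; rewrite ?u0 ?v0 ?y0 ?oppr_eq0 ?oner_eq0.
have u0 := chi_neq0 chiP (al e) W.1; have v0 := chi_neq0 chiP (al f) W.1.
have ee := chi_neq0 chiP (al e) (al e); have fe := chi_neq0 chiP (al f) (al e).
have cYe : chi Y.1 (al e) = (chi (al f) (al e) * chi (al e) (al e) * chi (al e) W.1)^-1.
  have := cWe; rewrite [chi W.1 _](chiDl chiP (al f) (Y.1 + al e)) (chiDl chiP) => H.
  rewrite invfM -H; field; by rewrite !(chi_neq0 chiP).
rewrite cYe cE -(scalerAl d) -(mulrA T) lW cWe.
move: (chi (al e) W.1) (chi (al f) W.1) (chi (al e) (al e)) (chi (al f) (al e)) u0 v0 ee fe.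
move=> u v w y u0 v0 w0 y0.
by nc_coefs K A; field; rewrite ?u0 ?v0 ?w0 ?y0 ?oppr_eq0 ?oner_eq0.
Qed.

Lemma D_tau4_f : D f Y.2 = 0 ->
  D f (c *: (W.2 * W.2) + (br (fold W e f) Y).2) = 0.
Proof.
move=> DY; have DW := D_fold_f eN fN ef wY DY.
have DA := D_fold_twice_f eN fN ef bef wY DY sfW.
have dA : (fold W e f).1 = (br W (E e)).1 + al f by rewrite [LHS]addrC.
have DAY := der_brl_K chiP dA DA DY (wY fN).
have [kW _] := wW fN.
rewrite /D derD derZ derM -/(D f W.2) DW DAY -/W.
set T := (br Y (E e)).2; set d := (1 - _) / _.
have sf : (chi2 (al f) Y.1)^-1 = chi2 (al e) Y.1.
  by rewrite -[RHS](mulfK (chi2_neq0 chiP (al f) Y.1)) sY mul1r.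
have ew := chi_neq0 chiP (al e) W.1; have fw := chi_neq0 chiP (al f) W.1.
have ey := chi_neq0 chiP (al e) Y.1; have ye := chi_neq0 chiP Y.1 (al e).
have -> : (br W (E e)).2 * Y.2 - ((chi Y.1 (br W (E e)).1)^-1 * (chi2 (al f) Y.1)^-1)
      *: (Y.2 * (br W (E e)).2)
    = - (chi (al f) W.1 * chi (al e) Y.1) *: (T * W.2) - chi (al e) Y.1 *: (W.2 * T).
  rewrite sf [(br W (E e)).1]br_deg (chiDr chiP) cYW [(br W (E e)).2]brE /T brE.
  rewrite -[(E e).1]/(al e) -[(E e).2]/(E0 e) !chi2E.
  move: WYE => /eqP; rewrite -subr_eq0.
  move: (chi (al e) W.1) (chi (al f) W.1) (chi (al e) Y.1) (chi Y.1 (al e)) ew fw ey ye.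
  move=> u v y y' u0 v0 y0 y0' /eqP R0.
  have H : - u^-1 *: (E0 e * (W.2 * Y.2 - - (u * v) *: (Y.2 * W.2)))
     + y *: ((W.2 * Y.2 - - (u * v) *: (Y.2 * W.2)) * E0 e) = 0 :> A.
    by rewrite R0 mulr0 mul0r !scaler0 addr0.
  apply/eqP; rewrite -subr_eq0 -[X in _ == X]H; apply/eqP.
  by nc_coefs K A; field; rewrite ?u0 ?v0 ?y0 ?y0' ?oppr_eq0 ?oner_eq0.
rewrite cE -(scalerAl d) -(mulrA T) kW.
have s1 : chi (al e) (al f) = (chi (al f) (al e))^-1.
  by rewrite -[LHS](mulfK (chi_neq0 chiP (al f) (al e))) -/(chi2 _ _) chi2_far // mul1r.
have cY : chi (al f) Y.1 * chi (al e) Y.1 = chi (al e) W.1 * chi (al f) W.1.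
  have fe := chi_neq0 chiP (al f) (al e).
  rewrite ![chi _ W.1](chiDr chiP _ (al f) (Y.1 + al e)) !(chiDr chiP) s1.
  by rewrite -[LHS]mul1r -cef; field; exact: fe.
have -> : chi (al f) Y.1 = chi (al e) W.1 * chi (al f) W.1 / chi (al e) Y.1.
  by rewrite -cY mulfK.
have fe := chi_neq0 chiP (al f) (al e).
move: (chi (al e) W.1) (chi (al f) W.1) (chi (al f) (al e)) (chi (al e) Y.1) ew fw fe ey.
move=> u v y w u0 v0 y0 w0.
by nc_coefs K A; field; rewrite ?u0 ?v0 ?w0 ?y0 ?oppr_eq0 ?oner_eq0.
Qed.

End Tau4Sum.

Lemma deg_Bm1_Tau4 : ty = Tau4 -> gBm1.1 = delta ty n.
Proof.
move=> tE; have [n0 NE _ _] := index_facts; have n1 := Tau4_neq1 tE.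
have -> : delta ty n = \sum_(i : idx ty n) alpha ty n i.
  rewrite /delta; have aux t (u v : Vhat ty n) : t = Tau4 -> (if t is Tau2 then u else v) = v.
    by move=> ->.
  exact: aux.
rewrite (@sum_alpha ty n N.+1) ?Nh_eq // big_nat_recr //= big_ltn; last by lia.
rewrite gB_deg (deg_B chi) // subn0.
by rewrite [RHS]addrC [X in _ + X]addrC.
Qed.

Lemma D_Z_0_Tau4 : ty = Tau4 -> D 0 gZ = 0 /\ D N gZ = 0.
Proof.
move=> tE; have [n0 NE N1 NhN] := index_facts; have n1 := Tau4_neq1 tE.
have NN := Nh_eq n1; have NN' : (N <= Nh)%N by rewrite NN.
have sq0 k : (if ty is Tau4 then a_minus1 chi *: D k (gBm1.2 ^+ 2) else 0) =
    a_minus1 chi *: D k (gBm1.2 * gBm1.2).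
  have aux t (u v : A) : t = Tau4 -> (if t is Tau4 then u else v) = u by move=> ->.
  by rewrite -expr2; exact: aux.
rewrite !D_Z_sum !sq0 !D_AB_outer ?eqxx ?orbT //.
rewrite /D -!derZ -!derD -/(D 0 _) -/(D N _) gA0_Tau4 //.
have WY : (br gBm1 (gB 0)).2 = 0.
  apply: br_B0 => // k k0 kN; have [||//] := @Bm1_commute k n1; first by lia.
  by rewrite tE.
have s0 := chi2_Bm1_Tau4 tE (leq0n _); have sN := chi2_Bm1_Tau4 tE NN'.
have sY := chi2_B0_0N n1.
have e0 : even_root 0 by rewrite !even_rootE tE; lia.
have eN : even_root N by rewrite !even_rootE tE; lia.
have cef : chi (al 0) (al 0) * chi (al N) (al N) = 1.
  by rewrite !chi_even // -expfzDr // bil_0N_Tau4 // addNr expr0z.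
have s0N := chi2_far (leq0n _) NN' (bil_0N n1).
have cWW : chi gBm1.1 gBm1.1 = -1.
  have := chi_B n0; rewrite gBm1_fold /fold !br_deg /=.
  move: (gB 0) sY => Y sY YY; rewrite !(chiDl chiP) !(chiDr chiP).
  transitivity (chi Y.1 Y.1 * chi2 (al 0) (al N) * (chi2 (al 0) Y.1 * chi2 (al N) Y.1)
     * (chi (al 0) (al 0) * chi (al N) (al N))); first by rewrite !chi2E; ring.
  by rewrite YY s0N sY cef !mulr1.
have cE : a_minus1 chi = chi (al N) (al 0) * chi (al 0) gBm1.1 * chi (al N) gBm1.1.
  by rewrite deg_Bm1_Tau4.
have ef : 0%N != N by lia.
have DY0 : D 0 (gB 0).2 = 0 by apply: D_B => //; lia.
have DYN : D N (gB 0).2 = 0 by apply: D_B => //; lia.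
have wY : wt (gB 0) by exact: wt_B.
by split; [apply: D_tau4_e|apply: D_tau4_f] => //; exact: bil_0N.
Qed.

Lemma D_Z k : (k <= Nh)%N -> D k gZ = 0.
Proof.
move=> kN; have [n0 NE N1 NhN] := index_facts.
have [->|kn] := eqVneq k n; first exact: D_Z_n.
have [k0|k0] := boolP (0 < k < N)%N.
  have [kn'|kn'] := ltnP k n; first by apply: (D_Z_mid (j := k)); rewrite ?eqxx //; lia.
  apply: (D_Z_mid (j := N - k)); first by lia.
  by apply/orP; right; apply/eqP; lia.
have {}k0 : (k == 0%N) || (k == N) by lia.
have [tE|tE|tE] := affine_typeP.
- case/orP: k0 => /eqP kE; first by rewrite kE; exact: D_Z_0_Tau1.
  by move: kN; rewrite kE /rkNhat tE; lia.
- by have [D0 DN] := D_Z_0_Tau2 tE; case/orP: k0 => /eqP ->.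
- by have [D0 DN] := D_Z_0_Tau4 tE; case/orP: k0 => /eqP ->.
Qed.

(** * The bracket of Z with E_k *)

Lemma gZ_ind (P : A -> Prop) : P 0 ->
  (forall c x y, P x -> P y -> P (c *: x + y)) ->
  (forall i, (i < n)%N -> P (br (gA i) (gB i)).2) ->
  (ty = Tau4 -> P (gBm1.2 * gBm1.2)) -> P gZ.
Proof.
move=> P0 PD PAB PW; rewrite /gZ.
have PS : P (\sum_(i < n) a_coef chi i *: (br (gA i) (gB i)).2).
  elim/big_ind: _ => // [x y Px Py|i _]; first by rewrite -[x]scale1r; apply: PD.
  by rewrite -[_ *: _]addr0; apply: PD => //; exact: PAB.
have aux t : ty = t -> P ((if t is Tau4 then a_minus1 chi *: gBm1.2 ^+ 2 else 0) +
    \sum_(i < n) a_coef chi i *: (br (gA i) (gB i)).2); last exact: aux.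
case: t => tE; rewrite ?add0r // expr2.
by apply: PD => //; exact: PW.
Qed.

Definition Zh : hom := (sdelta ty n, gZ).

Lemma deg_Bm1_sq : ty = Tau4 -> gBm1.1 + gBm1.1 = sdelta ty n.
Proof.
move=> tE; rewrite deg_Bm1_Tau4 // /sdelta.
have -> : delta_mult ty = 2%N by rewrite /delta_mult tE.
by rewrite mulr2n.
Qed.

Lemma AB_pair i : (i < n)%N ->
  (sdelta ty n, (br (gA i) (gB i)).2) = br (gA i) (gB i).
Proof. by move=> i_n; rewrite -(deg_gAB i_n). Qed.

Lemma wt_Z : wt Zh.
Proof.
move=> k kN; apply: (gZ_ind (P := fun x => weightv chi (al k) (kk k) (ll k) (_, x))).
- by split; rewrite /= !(mulr0, mul0r) scaler0.
- by move=> c x y wx wy; apply: weightvD => //; exact: weightvZ.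
- by move=> i i_n; rewrite AB_pair //; apply: wt_br; [exact: wt_A|exact: wt_B|].
- move=> tE; rewrite -deg_Bm1_sq //.
  by apply: (weightvM chiP); apply: wt_Bm1 => //; exact: Tau4_neq1.
Qed.

Lemma nil_Z k : (k <= Nh)%N -> even_root k -> nil_at k Zh.
Proof.
move=> kN ek; apply: (gZ_ind (P := fun x => nil_at k (_, x))).
- by rewrite /nil_at; case: ifP => _; exists 0%N.
- move=> c x y; rewrite /nil_at; case: ifP => _.
    exact: nilR_lin.
  exact: nilL_lin.
- by move=> i i_n; rewrite AB_pair //; apply: nil_br; [exact: nil_A|exact: nil_B].
- move=> tE; rewrite -deg_Bm1_sq //; have := nil_Bm1 (Tau4_neq1 tE) kN ek.
  rewrite /nil_at; case: ifP => _ nW; first exact: (nilRM chiP).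
  exact: (nilLM chiP).
Qed.

(** Since chi(alpha_k, alpha_k) = -1, the terms E_k X E_k cancel and the others contain E_k^2. With
    E_k on the left, as in [Rz_odd_sym], that cancellation requires X to have weight 0. *)
Lemma Rz_odd k X : (k <= Nh)%N -> ~~ even_root k -> Rz (br X (E k)) k.
Proof.
move=> kN ok; have EE := E_sq kN ok; have c0 := chi_neq0 chiP (al k) X.1.
rewrite /Rz brE /= (chiDr chiP) chi_odd //.
have -> : (X.2 * E0 k - (chi (al k) X.1)^-1 *: (E0 k * X.2)) * E0 k
   - (chi (al k) X.1 * -1)^-1 *:
   (E0 k * (X.2 * E0 k - (chi (al k) X.1)^-1 *: (E0 k * X.2))) =
   X.2 * (E0 k * E0 k) - (chi (al k) X.1)^-1 ^+ 2 *: (E0 k * E0 k * X.2).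
  by nc_coefs K A; field; rewrite ?c0 ?oppr_eq0 ?oner_eq0.
by rewrite EE mulr0 mul0r scaler0 subrr.
Qed.

Lemma Rz_odd_sym k X : (k <= Nh)%N -> ~~ even_root k -> chi2 (al k) X.1 = 1 ->
  Rz (br (E k) X) k.
Proof.
move=> kN ok sX; have EE := E_sq kN ok; have c0 := chi_neq0 chiP (al k) X.1.
have cX : chi X.1 (al k) = (chi (al k) X.1)^-1.
  by rewrite -[LHS](mulKf c0) -/(chi2 _ _) sX mulr1.
rewrite /Rz brE /= (chiDr chiP) chi_odd // cX invrK.
have -> : (E0 k * X.2 - chi (al k) X.1 *: (X.2 * E0 k)) * E0 k
   - (-1 * chi (al k) X.1)^-1 *:
   (E0 k * (E0 k * X.2 - chi (al k) X.1 *: (X.2 * E0 k))) =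
   (chi (al k) X.1)^-1 *: (E0 k * E0 k * X.2) - chi (al k) X.1 *: (X.2 * (E0 k * E0 k)).
  by nc_coefs K A; field; rewrite ?c0 ?oppr_eq0 ?oner_eq0.
by rewrite EE mulr0 mul0r !scaler0 subrr.
Qed.

Lemma RzM X Y k : Rz X k -> Rz Y k -> Rz (X.1 + Y.1, X.2 * Y.2) k.
Proof.
move=> /br_eq0 RX /br_eq0 RY; apply/br_eq0.
by rewrite -mulrA RY -scalerAr mulrA RX -scalerAl scalerA mulrA /= (chiDr chiP) invfM mulrC.
Qed.

(** A_1 is the fold of E_0 by its two neighbours 1 and N - 1, so [super_fold] applies; further folds
    do not involve neighbours of 0. *)
Lemma Rz_A0 i : ty = Tau1 -> (0 < i < n)%N -> Rz (gA i) 0.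
Proof.
move=> tE; case: i => // i; elim: i => [|i IHi] i_n; rewrite gA_step.
  have [b1 b2 b3] := bil_0_neighbours n_ge tE.
  have [n0 NE N1 NhN] := index_facts.
  rewrite /= gA0_Tau1 //; rewrite -subn1 in b1 b2.
  have [] := @super_fold 0 1 (N - 1) => //; try lia.
    by rewrite !even_rootE tE eqxx andbF.
  by split; lia.
have [||||Re _] := @E_far i.+2 0; try by ilia.
have [||||Rf _] := @E_far (N - i.+2) 0; try by ilia.
by apply: Rz_fold => //; apply: IHi; lia.
Qed.

Lemma Z_bracket k : (k <= Nh)%N -> Rz Zh k.
Proof.
move=> kN; have [ek|ok] := boolP (even_root k).
  have [] := commute_even kN ek wt_Z (nil_Z kN ek) (D_Z kN) => //.
  exact: chi2_sdelta.
apply: (gZ_ind (P := fun x => Rz (_, x) k)).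
- exact: br0l.
- move=> c x y /br_eq0 /= Rx /br_eq0 /= Ry; apply/br_eq0 => /=.
  by rewrite mulrDl mulrDr -scalerAl -scalerAr Rx Ry !scalerA scalerDr scalerA mulrC.
- move=> i i_n; rewrite AB_pair //.
  have [kE|kn] := eqVneq k n.
    have [i1|i1] := ltnP i.+1 n.
      have [||RA _] := @A_inner i k; try by ilia.
      have [||RB _] := @B_inner i k; try by ilia.
      exact: (br_brl0 chiP).
    have -> : gB i = E k by rewrite kE -gB_last; congr gB; lia.
    exact: Rz_odd.
  have [tE k0] : ty = Tau1 /\ k = 0%N.
    move: ok; rewrite !even_rootE kn /=.
    by have aux t : ~~ (if t is Tau1 then k != 0%N else true) -> t = Tau1 /\ k = 0%N;
      [case: t => //; rewrite negbK => /eqP|exact: aux].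
  subst k; case: i i_n => [|i] i_n.
    by rewrite /= gA0_Tau1 //; apply: Rz_odd_sym; rewrite // chi2_B // wB_00_Tau1 // mulr0 expr0z.
  apply: (br_brl0 chiP); first by apply: Rz_A0 => //; lia.
  by have [|||RB _ //] := @B_far i.+1 0; ilia.
- move=> tE; rewrite -deg_Bm1_sq //.
  have kE : k = n by move: ok; rewrite !even_rootE tE andbT negbK => /eqP.
  have [||RW _] := @Bm1_commute k (Tau4_neq1 tE); [ilia|by rewrite tE|].
  exact: RzM.
Qed.

(** * Z on the loop module *)

Section LoopPath.
Local Notation P := (rkN' ty n).
Variables (W : lmodType K) (vec : 'I_P -> int -> W) (Psi : alg_rep A W).
Variables (lab : 'I_P -> nat) (ep ph : 'I_P -> K).
Local Notation prev := (@ord_pred P).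
Hypothesis ep_neq0 : forall c, ep c != 0.
Hypothesis ph_neq0 : forall c, ph c != 0.
Hypothesis labE : forall c, lab c = path_label ty n c.
Hypothesis lab_le : forall c, (lab c <= Nh)%N.
Hypothesis vec_neq0 : forall c m, vec c m != 0.
Hypothesis PsiE : forall k c m, (k <= Nh)%N ->
  Psi (E0 k) (vec c m) = (if lab c == k then ep c else 0) *: vec (prev c) ((k == 0%N)%:Z + m).
Hypothesis PsiF : forall k c m, (k <= Nh)%N ->
  Psi (F k) (vec (prev c) m) =
    (if lab c == k then ph c else 0) *: vec c (- (k == 0%N)%:Z + m).

Definition deg0 (a : Vhat ty n) : int := a.1 ord0.
Definition height (a : Vhat ty n) : int := \sum_(i : idx ty n) a.1 i.

Lemma deg0D a b : deg0 (a + b) = deg0 a + deg0 b.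
Proof. by rewrite /deg0 /= ffunE. Qed.
Lemma heightD a b : height (a + b) = height a + height b.
Proof. by rewrite /height -big_split; apply: eq_bigr => i _; rewrite /= ffunE. Qed.
Lemma deg0_al k : deg0 (al k) = (k == 0%N)%:Z.
Proof. by rewrite /deg0 /= ffunE eq_sym. Qed.
Lemma height_al k : (k <= Nh)%N -> height (al k) = 1.
Proof.
move=> kN; rewrite /height (bigD1 (inord k)) //= ffunE inordK // eqxx big1 // => i ik.
by rewrite ffunE; move: ik; rewrite -val_eqE /= inordK // => /negPf ->.
Qed.

(* Psi X maps e_c t^m to a multiple zeta(c) of the vector e_(c-h) t^(m+d), where h is
   the height of X and d the coefficient of alpha_0 in its degree. *)
Definition shift h X (zeta : 'I_P -> K) :=
  height X.1 = h%:Z /\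
  forall c m, Psi X.2 (vec c m) = zeta c *: vec (iter h prev c) (deg0 X.1 + m).

Definition ext h X := exists zeta, shift h X zeta.

Definition br_zeta (p : K) h1 (z1 : 'I_P -> K) h2 (z2 : 'I_P -> K) : 'I_P -> K :=
  fun c => z1 (iter h2 prev c) * z2 c - p * (z2 (iter h1 prev c) * z1 c).

Definition E_zeta k (c : 'I_P) : K := if lab c == k then ep c else 0.

Lemma shift_E k : (k <= Nh)%N -> shift 1 (E k) (E_zeta k).
Proof.
move=> kN; split=> [|c m]; first exact: height_al.
by rewrite -[X in vec _ (X + m)]/(deg0 (al k)) deg0_al; exact: PsiE.
Qed.

Lemma shiftM h1 h2 X Y z1 z2 : shift h1 X z1 -> shift h2 Y z2 ->
  shift (h1 + h2) (X.1 + Y.1, X.2 * Y.2) (fun c => z1 (iter h2 prev c) * z2 c).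
Proof.
move=> [hX sX] [hY sY]; split=> [|c m] /=; first by rewrite heightD hX hY.
by rewrite rep_mul sY linearZ sX /= scalerA iterD deg0D addrA mulrC.
Qed.

Lemma shift_lin h d c x y z1 z2 : shift h (d, x) z1 -> shift h (d, y) z2 ->
  shift h (d, c *: x + y) (fun j => c * z1 j + z2 j).
Proof.
move=> [hx sx] [_ sy]; split=> // j m.
by rewrite rep_linear sx sy scalerA -scalerDl.
Qed.

Lemma shift_br h1 h2 X Y z1 z2 : shift h1 X z1 -> shift h2 Y z2 ->
  shift (h1 + h2) (br X Y) (br_zeta (chi Y.1 X.1)^-1 h1 z1 h2 z2).
Proof.
move=> sX sY; have [hXY sXY] := shiftM sX sY; have [_ sYX] := shiftM sY sX.
split=> // c m; rewrite brE addrC -scaleNr rep_linear /=.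
have := sXY c m; have := sYX c m => /= -> ->.
have -> : deg0 (Y.1 + X.1) = deg0 (X.1 + Y.1) by congr deg0; exact: addrC.
by rewrite addnC scalerA -scalerDl addrC mulNr.
Qed.

Definition fold_zeta e f Y h z : 'I_P -> K :=
  br_zeta (chi (Y.1 + al e) (al f))^-1 1 (E_zeta f) (h + 1)
    (br_zeta (chi (al e) Y.1)^-1 h z 1 (E_zeta e)).

Lemma shift_fold h Y z e f : (e <= Nh)%N -> (f <= Nh)%N -> shift h Y z ->
  shift h.+2 (fold Y e f) (fold_zeta e f Y h z).
Proof.
move=> eN fN sY; have -> : h.+2 = (1 + (h + 1))%N by rewrite add1n addn1.
exact: shift_br (shift_E fN) (shift_br sY (shift_E eN)).
Qed.

(** Of the four products in a fold, only E_f Y E_e survives on e_c, as E_f and Y both kill it. In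
    [fold_zeta_desc] the path is read in the opposite order and only E_e Y E_f survives. *)
Lemma fold_zeta_asc e f Y h z c : e != f -> lab c = e -> lab (iter h.+1 prev c) = f ->
  z c = 0 -> z (prev c) != 0 -> fold_zeta e f Y h z c != 0.
Proof.
move=> ef ce cf z0 z1; rewrite /fold_zeta /br_zeta /E_zeta addn1 cf eqxx /= ce eqxx.
by rewrite (negPf ef) z0 !mulr0 !subr0 !mulf_neq0.
Qed.

Lemma fold_zeta_desc e f Y h z c : e != f -> lab c = f -> lab (prev c) != e ->
  lab (iter h.+1 prev c) = e -> z c = 0 -> z (prev c) != 0 ->
  fold_zeta e f Y h z c != 0.
Proof.
move=> ef cf ce ch z0 z1; have fe : (f == e) = false by rewrite eq_sym; exact: negPf.
rewrite /fold_zeta /br_zeta /E_zeta /= cf eqxx fe z0 (negPf ce) -iterSr ch eqxx.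
rewrite !mulr0 subr0 mulr0 !sub0r mulNr mulrN opprK.
by rewrite !mulf_neq0 // invr_neq0 // (chi_neq0 chiP).
Qed.

(** Only the first and the last label of a path of h steps are recorded; this is enough to see that
    B_i can neither begin nor end at an edge whose label is out of its range. *)
Definition supp (S : pred nat) h (z : 'I_P -> K) :=
  forall c, z c != 0 -> S (lab c) /\ S (lab (iter h.-1 prev c)).

Lemma supp_br S p h1 z1 h2 z2 : (0 < h1)%N -> (0 < h2)%N ->
  supp S h1 z1 -> supp S h2 z2 -> supp S (h1 + h2) (br_zeta p h1 z1 h2 z2).
Proof.
move=> h1_0 h2_0 S1 S2 c; rewrite /br_zeta => zc.
have [/eqP|] := boolP (z1 (iter h2 prev c) * z2 c == 0); last first.
  rewrite mulf_eq0 negb_or => /andP[/S1[_ L1] /S2[F2 _]]; split=> //.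
  by rewrite -iterD in L1; have -> : (h1 + h2).-1 = (h1.-1 + h2)%N by lia.
move=> z0; move: zc; rewrite z0 sub0r oppr_eq0 mulf_eq0 negb_or => /andP[_].
rewrite mulf_eq0 negb_or => /andP[/S2[_ L2] /S1[F1 _]]; split=> //.
by rewrite -iterD in L2; have -> : (h1 + h2).-1 = (h2.-1 + h1)%N by lia.
Qed.

Lemma supp_E (S : pred nat) k : S k -> supp S 1 (E_zeta k).
Proof.
by move=> Sk c; rewrite /E_zeta /=; case: (eqVneq (lab c) k) => [->|]; rewrite ?eqxx.
Qed.

Lemma supp_weaken (S S' : pred nat) h z : subpred S S' -> supp S h z -> supp S' h z.
Proof. by move=> SS Sz c /Sz[F1 F2]; split; exact: SS. Qed.

Definition asc (a l : nat) (c : 'I_P) :=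
  forall t, (t < l)%N -> lab (iter t prev c) = (a + t)%N.
Definition desc (a l : nat) (c : 'I_P) :=
  forall t, (t < l)%N -> lab (iter t prev c) = (a - t)%N.

Lemma B_zeta i : (i < n)%N -> exists2 z, shift (N - i.*2.+1) (gB i) z &
  [/\ supp (fun k => (i < k < N - i)%N) (N - i.*2.+1) z,
      forall c, asc i.+1 (N - i.*2.+1) c -> z c != 0 &
      forall c, desc (N - i.+1) (N - i.*2.+1) c -> z c != 0].
Proof.
have [n0 NE N1 NhN] := index_facts.
elim/gB_ind=> {i} [|i i_n IHi].
  have -> : (N - (n.-1).*2.+1 = 1)%N by lia.
  exists (E_zeta n); first by rewrite gB_last; apply: shift_E; lia.
  split; first by apply: supp_E; lia.
  - move=> c /(_ 0%N isT) /= cE; rewrite /E_zeta cE.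
    by have -> : ((n.-1).+1 + 0)%N == n by lia.
  - move=> c /(_ 0%N isT) /= cE; rewrite /E_zeta cE.
    by have -> : (N - (n.-1).+1 - 0)%N == n by lia.
have [|z sz [Sz az dz]] := IHi i.+1; first by lia.
have [eN fN] : (i.+1 <= Nh)%N /\ (N - i.+1 <= Nh)%N by split; lia.
set h := (N - (i.+1).*2.+1)%N in sz Sz az dz.
have hE : (N - i.*2.+1 = h.+2)%N by rewrite /h; lia.
exists (fold_zeta i.+1 (N - i.+1) (gB i.+1) h z); rewrite hE.
  by rewrite gB_step //; exact: shift_fold.
have zc c : ~~ (i.+1 < lab c < N - i.+1)%N -> z c = 0.
  by move=> lc; apply/eqP; apply: contraNT lc => /Sz[].
have ef : (i.+1 != N - i.+1)%N by lia.
split.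
- rewrite (_ : h.+2 = (1 + (h + 1))%N); last by rewrite add1n addn1.
  apply: supp_br => //; first by rewrite addn1.
  + by apply: supp_E; lia.
  + apply: supp_br => //; first by rewrite /h; lia.
      by apply: supp_weaken Sz => k; lia.
    by apply: supp_E; lia.
- move=> c ac; apply: fold_zeta_asc => //.
  + by rewrite -[c]/(iter 0 prev c) ac // addn0.
  + by rewrite ac // /h; lia.
  + by apply: zc; rewrite -[c]/(iter 0 prev c) ac //; lia.
  + by apply: az => t th; rewrite -iterSr ac //; lia.
- move=> c dc; apply: fold_zeta_desc => //.
  + by rewrite -[c]/(iter 0 prev c) dc // subn0.
  + by rewrite -[prev c]/(iter 1 prev c) dc //; lia.
  + by rewrite dc // /h; lia.
  + by apply: zc; rewrite -[c]/(iter 0 prev c) dc //; lia.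
  + by apply: dz => t th; rewrite -iterSr dc //; lia.
Qed.

Lemma Bm1_zeta : ty <> Tau1 -> exists2 z, shift N.+1 gBm1 z &
  forall c, (asc 0 N.+1 c -> z c != 0) /\ (desc N N.+1 c -> z c != 0).
Proof.
move=> n1; have [n0 NE N1 NhN] := index_facts; have NN := Nh_eq n1.
have [z] := B_zeta n0; set h := (N - _)%N => sz [Sz az dz].
have hE : N = h.+1 by rewrite /h; lia.
have zc c : ~~ (0 < lab c < N)%N -> z c = 0.
  by move=> lc; apply/eqP; apply: contraNT lc => /Sz[]; rewrite subn0.
have ef : 0%N != N by lia.
exists (fold_zeta 0 N (gB 0) h z).
  have -> : N.+1 = h.+2 by lia.
  by rewrite gBm1_fold; apply: shift_fold; rewrite ?NN.
move=> c; split=> [ac|dc].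
  apply: fold_zeta_asc => //.
  + by rewrite -[c]/(iter 0 prev c) ac.
  + by rewrite -hE ac.
  + by apply: zc; rewrite -[c]/(iter 0 prev c) ac.
  + by apply: az => t th; rewrite -iterSr ac //; lia.
apply: fold_zeta_desc => //.
+ by rewrite -[c]/(iter 0 prev c) dc // subn0.
+ by rewrite -[prev c]/(iter 1 prev c) dc //; lia.
+ by rewrite -hE dc // subnn.
+ by apply: zc; rewrite -[c]/(iter 0 prev c) dc // subn0 ltnn andbF.
+ by apply: dz => t th; rewrite -iterSr dc //; lia.
Qed.

Lemma height_sum a b : (b <= N)%N -> height (\sum_(a <= i < b) al i) = (b - a)%N.
Proof.
move=> bN; have [n0 NE N1 NhN] := index_facts.
have h0 : height 0 = 0 by rewrite /height big1 // => i _; rewrite /= ffunE.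
rewrite (big_morph height heightD h0) big_nat.
rewrite (eq_bigr (fun=> 1)) => [|i ib]; last by apply: height_al; lia.
by rewrite -big_nat big_const_nat iter_addr_0 natz.
Qed.

(** The height of s delta is the length of the cycle, so Z makes exactly one full turn and brings
    each basis vector back to its place. *)
Lemma height_sdelta : height (sdelta ty n) = P.
Proof.
have [n0 NE N1 NhN] := index_facts; rewrite sdeltaE // /rkN'.
have S1 : height (\sum_(1 <= i < N) al i) = (N - 1)%N by exact: height_sum.
have h0 : height (al 0) = 1 by exact: height_al.
have hN : ty <> Tau1 -> height (al N) = 1 by move=> n1; rewrite height_al ?Nh_eq.
have aux t : ty = t -> height match t with
   | Tau1 => al 0 + \sum_(1 <= t < N) al t
   | Tau2 => al 0 + (\sum_(1 <= t < N) al t) *+ 2 + al N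
   | Tau4 => (al 0 + \sum_(1 <= t < N) al t + al N) *+ 2 end =
   Posz (match t with Tau1 => N | Tau2 => N.*2 | Tau4 => N.*2.+2 end)%N; last exact: (aux ty).
by case: t => tE; rewrite ?mulr2n !heightD S1 h0 ?hN ?tE //; lia.
Qed.

Lemma deg0_sum a b : (0 < a)%N -> deg0 (\sum_(a <= i < b) al i) = 0.
Proof.
move=> a0; have d0 : deg0 0 = 0 by rewrite /deg0 /= ffunE.
rewrite (big_morph deg0 deg0D d0) big_nat big1 // => i /andP[ai _].
by rewrite deg0_al; case: i ai => //; lia.
Qed.

Lemma deg0_sdelta : deg0 (sdelta ty n) = delta_mult ty.
Proof.
have [n0 NE N1 NhN] := index_facts; rewrite sdeltaE // /delta_mult.
have S1 : deg0 (\sum_(1 <= i < N) al i) = 0 by exact: deg0_sum.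
have h0 : deg0 (al 0) = 1 by rewrite deg0_al.
have hN : deg0 (al N) = 0 by rewrite deg0_al; case: N NE => //; lia.
have aux t : deg0 match t with
   | Tau1 => al 0 + \sum_(1 <= t < N) al t
   | Tau2 => al 0 + (\sum_(1 <= t < N) al t) *+ 2 + al N
   | Tau4 => (al 0 + \sum_(1 <= t < N) al t + al N) *+ 2 end =
   Posz (if t is Tau4 then 2 else 1)%N; last exact: (aux ty).
by case: t; rewrite ?mulr2n !deg0D S1 h0 ?hN.
Qed.

Lemma ext_A i : (i < n)%N -> exists h, ext h (gA i).
Proof.
have [n0 NE N1 NhN] := index_facts.
elim: i => [|i IHi] i_n; last first.
  have [|h [z sz]] := IHi; first by lia.
  by exists h.+2, (fold_zeta i.+1 (N - i.+1) (gA i) h z); apply: shift_fold => //; lia.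
have [tE|tE|tE] := affine_typeP; rewrite /=.
- by rewrite gA0_Tau1 //; exists 1%N, (E_zeta 0); exact: shift_E.
- have [z sz _] := Bm1_zeta (Tau2_neq1 tE).
  by rewrite gA0_Tau2 //; exists N.+1, z.
- have [z sz _] := Bm1_zeta (Tau4_neq1 tE); have NN := Nh_eq (Tau4_neq1 tE).
  rewrite gA0_Tau4 //; exists N.+3, (fold_zeta 0 N gBm1 N.+1 z).
  by apply: shift_fold; rewrite ?NN.
Qed.

Lemma shift_AB i hA zA hB zB : (i < n)%N -> shift hA (gA i) zA -> shift hB (gB i) zB ->
  (hA + hB)%N = P.
Proof.
move=> i_n [hAE _] [hBE _]; apply/eqP; rewrite -eqz_nat -height_sdelta -(deg_gAB i_n).
by rewrite heightD hAE hBE.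
Qed.

Lemma shift0 h d : height d = h%:Z -> shift h (d, 0) (fun=> 0).
Proof.
move=> hd; split=> // c m /=; rewrite scale0r.
by have := rep_linear Psi (-1) 0 0 (vec c m); rewrite scaler0 addr0 scaleN1r addNr.
Qed.

Lemma ext_Z : ext P Zh.
Proof.
apply: (gZ_ind (P := fun x => ext P (_, x))).
- by exists (fun=> 0); apply: shift0; exact: height_sdelta.
- move=> c x y [z1 s1] [z2 s2]; exists (fun j => c * z1 j + z2 j).
  exact: shift_lin.
- move=> i i_n; have [hA [zA sA]] := ext_A i_n; have [zB sB _] := B_zeta i_n.
  rewrite AB_pair // -(shift_AB i_n sA sB).
  by eexists; exact: (shift_br sA sB).
- move=> tE; have [z sz _] := Bm1_zeta (Tau4_neq1 tE); rewrite -deg_Bm1_sq //.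
  have -> : P = (N.+1 + N.+1)%N.
    have aux t : t = Tau4 -> match t with
      Tau1 => N | Tau2 => N.*2 | Tau4 => N.*2.+2 end = (N.+1 + N.+1)%N.
      by move=> ->; lia.
    exact: aux.
  by eexists; exact: (shiftM sz sz).
Qed.

Lemma Z_zeta_prev z c : shift P Zh z -> z (prev c) = z c.
Proof.
move=> [_ sz]; have kN := lab_le c; set k := lab c.
have := D_Z kN; rewrite /D /der => /eqP; rewrite subr_eq0 => /eqP ZF.
set d0 := (k == 0%N)%:Z.
have L1 : Psi (gZ * F k) (vec (prev c) 0) =
    (ph c * z c) *: vec c (deg0 (sdelta ty n) + (- d0 + 0)).
  rewrite rep_mul PsiF // eqxx linearZ /= -/d0; have := sz c (- d0 + 0) => /= ->.
  by rewrite scalerA iter_ord_pred_period.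
have R1 : Psi (F k * gZ) (vec (prev c) 0) =
    (z (prev c) * ph c) *: vec c (- d0 + (deg0 (sdelta ty n) + 0)).
  rewrite rep_mul; have := sz (prev c) 0 => /= ->.
  by rewrite iter_ord_pred_period linearZ /= PsiF // eqxx scalerA.
move: R1; rewrite -ZF L1 addrCA => /eqP.
rewrite -subr_eq0 -scalerBl scaler_eq0 (negPf (vec_neq0 _ _)) orbF subr_eq0 mulrC.
by move/eqP/(mulIf (ph_neq0 c)).
Qed.

Section BasePoint.
Variable c0 : 'I_P.
Hypothesis c0_0 : c0 = 0%N :> nat.

Lemma Z_zeta_const z c : shift P Zh z -> z c = z c0.
Proof.
move=> sz; have zi h : z (iter h prev c) = z c.
  by elim: h => //= h IHh; rewrite (Z_zeta_prev _ sz).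
rewrite -(zi c); congr z; apply: val_inj.
by rewrite /= val_iter_ord_pred_le // subnn c0_0.
Qed.

Lemma lab_c0 : lab c0 = 0%N.
Proof. by rewrite labE c0_0 path_label0. Qed.

Lemma lab_iter t : (0 < t <= P)%N -> lab (iter t prev c0) = path_label ty n (P - t).
Proof. by move=> tP; rewrite labE val_iter_ord_pred_gt c0_0 ?addn0. Qed.

Lemma P_gt1 : (1 < P)%N.
Proof.
have [n0 NE N1 NhN] := index_facts.
have aux t : (1 < match t with Tau1 => N | Tau2 => N.*2 | Tau4 => N.*2.+2 end)%N.
  by case: t; lia.
exact: (aux ty).
Qed.

(** The turn from e_1 begins at label 0 and ends with the step from e_2 to e_1, whose label is 1, or
    0 for tau = 4. So B_i can act neither first nor last. *)
Lemma AB_zeta_c0 i : (i < n)%N -> (0 < i)%N \/ ty = Tau4 ->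
  forall m, Psi (br (gA i) (gB i)).2 (vec c0 m) = 0.
Proof.
move=> i_n it m; have [hA [zA sA]] := ext_A i_n; have [zB sB [SB _ _]] := B_zeta i_n.
have hP := shift_AB i_n sA sB; have P1 := P_gt1; have [n0 NE N1 NhN] := index_facts.
have [_ ->] := shift_br sA sB; rewrite /br_zeta.
have -> : zB c0 = 0.
  by apply/eqP/negPn/negP => /SB[]; rewrite lab_c0.
have -> : zB (iter hA prev c0) = 0.
  apply/eqP/negPn/negP => /SB[_]; rewrite -iterD.
  have -> : ((N - i.*2.+1).-1 + hA = P.-1)%N by lia.
  rewrite lab_iter; last by lia.
  have -> : (P - P.-1 = 1)%N by lia.
  rewrite path_label1 //; case: it => [i0|->] //.
  by case: (ty); lia.
by rewrite mulr0 mul0r mulr0 subrr scale0r.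
Qed.

(* Only one summand of Z acts nontrivially on the vectors e_1 t^m. *)
Lemma Psi_Z m : Psi gZ (vec c0 m) =
  (if ty is Tau4 then a_minus1 chi *: Psi (gBm1.2 * gBm1.2) (vec c0 m)
   else Psi (br (gA 0) (gB 0)).2 (vec c0 m)).
Proof.
set w := vec c0 m; have [n0 _ _ _] := index_facts.
have Psi0 : Psi 0 w = 0.
  by have := rep_linear Psi (-1) 0 0 w; rewrite scaler0 addr0 scaleN1r addNr.
have PsiD x y : Psi (x + y) w = Psi x w + Psi y w.
  by rewrite -{1}[x]scale1r rep_linear scale1r.
have PsiZ c x : Psi (c *: x) w = c *: Psi x w.
  by rewrite -[c *: x]addr0 rep_linear Psi0 addr0.
rewrite /gZ PsiD (big_morph (Psi^~ w) PsiD Psi0) (bigD1 (Ordinal n0)) //= PsiZ.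
rewrite big1 ?addr0 => [|[i i_n]]; last first.
  rewrite -val_eqE /= => i0; rewrite PsiZ AB_zeta_c0 ?scaler0 //.
  by left; rewrite lt0n.
have aux t : ty = t -> Psi (if t is Tau4 then a_minus1 chi *: gBm1.2 ^+ 2 else 0) w +
    1 *: Psi (br gA0 (gB 0)).2 w =
    (if t is Tau4 then a_minus1 chi *: Psi (gBm1.2 * gBm1.2) w
     else Psi (br gA0 (gB 0)).2 w); last exact: (aux ty).
case: t => tE; rewrite ?Psi0 ?scale1r ?add0r //.
by rewrite PsiZ expr2 (AB_zeta_c0 n0 (or_intror tE)) addr0.
Qed.

(** For tau = 4 the first factor B_(-1) ascends through the labels 0, ..., N and the second descends
    from N to 0. Otherwise A_0 acts first, by label 0 alone for tau = 1 and ascending from 0 to N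
    for tau = 2, and B_0 then descends from N - 1 to 1. *)
Lemma Psi_Z_neq0 m : Psi gZ (vec c0 m) != 0.
Proof.
have [n0 NE N1 NhN] := index_facts; have P1 := P_gt1.
have PN : (N <= P)%N by rewrite /rkN'; case: (ty); lia.
have asc0 : ty <> Tau1 -> asc 0 N.+1 c0.
  move=> n1 [|t] tN; first by rewrite lab_c0.
  have tP : (t.+1 <= P)%N.
    have aux u : u <> Tau1 ->
      (t.+1 <= match u with Tau1 => N | Tau2 => N.*2 | Tau4 => N.*2.+2 end)%N.
      by case: u => //; lia.
    exact: (aux ty).
  by rewrite lab_iter // path_label_asc.
have B0_desc hA : ty <> Tau4 -> (hA + (N - 1) = P)%N -> desc (N - 1) (N - 1) (iter hA prev c0).
  move=> n4 hP t tN; rewrite -iterD lab_iter; last by lia.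
  have -> : (P - (t + hA) = N.-1 - t)%N by lia.
  by rewrite path_label_desc // ?subn1 //; lia.
have main4 : ty = Tau4 -> a_minus1 chi *: Psi (gBm1.2 * gBm1.2) (vec c0 m) != 0.
  move=> tE; have n1 := Tau4_neq1 tE; have [z sz zn] := Bm1_zeta n1.
  have PE : P = N.*2.+2 by rewrite tE.
  rewrite scaler_eq0 negb_or /a_minus1 !mulf_neq0 ?(chi_neq0 chiP) //=.
  have [_ ->] := shiftM sz sz; rewrite scaler_eq0 negb_or vec_neq0 andbT mulf_neq0 //.
    have [_] := zn (iter N.+1 prev c0); apply=> t tN.
    rewrite -iterD lab_iter; last by rewrite PE; lia.
    have -> : (P - (t + N.+1) = N.+1 - t)%N by rewrite PE; lia.
    by rewrite {1}tE path_label_desc4.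
  by have [] := zn c0; move/(_ (asc0 n1)).
have main12 : ty <> Tau4 -> Psi (br (gA 0) (gB 0)).2 (vec c0 m) != 0.
  move=> n4; have [zB sB [SB _ dB]] := B_zeta n0.
  have zB0 : zB c0 = 0 by apply/eqP/negPn/negP => /SB[]; rewrite lab_c0.
  suff [hA [zA sA zA0]] : exists hA, exists2 zA, shift hA (gA 0) zA & zA c0 != 0.
    have hP := shift_AB n0 sA sB.
    have [_ ->] := shift_br sA sB; rewrite scaler_eq0 negb_or vec_neq0 andbT.
    (* B_0 kills e_1, so only the product B_0 A_0 of the bracket remains. *)
    rewrite /br_zeta zB0 mulr0 sub0r oppr_eq0 !mulf_neq0 ?invr_neq0 ?(chi_neq0 chiP) //.
    by apply: dB; exact: B0_desc.
  have [tE|tE|tE] := affine_typeP; rewrite /=; last by case: n4.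
    rewrite gA0_Tau1 //; exists 1%N, (E_zeta 0); first exact: shift_E.
    by rewrite /E_zeta lab_c0 eqxx ep_neq0.
  have [z sz zn] := Bm1_zeta (Tau2_neq1 tE); rewrite gA0_Tau2 //.
  by exists N.+1, z => //; have [+ _] := zn c0; apply; exact/asc0/Tau2_neq1.
rewrite Psi_Z; have aux t : ty = t -> (if t is Tau4 then
    a_minus1 chi *: Psi (gBm1.2 * gBm1.2) (vec c0 m)
    else Psi (br (gA 0) (gB 0)).2 (vec c0 m)) != 0; last exact: (aux ty).
by case: t => tE; [apply: main12; rewrite tE..|exact: main4].
Qed.

Lemma Psi_Z_scalar : exists b : K, b != 0 /\
  forall c m, Psi gZ (vec c m) = b *: vec c ((delta_mult ty)%:Z + m).
Proof.
have [z sz] := ext_Z; have [_ szE] := sz; exists (z c0); split.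
  have := Psi_Z_neq0 0; have /= -> := szE c0 0.
  by rewrite scaler_eq0 negb_or => /andP[].
move=> c m; have /= -> := szE c m.
by rewrite iter_ord_pred_period deg0_sdelta (Z_zeta_const _ sz).
Qed.

End BasePoint.

End LoopPath.
End Generic.

(** * Back to the quotient algebra *)

Section Instance.
Variables (K : fieldType) (ty : affine_type) (n : nat) (q : K).
Variables (chi : Vhat ty n -> Vhat ty n -> K) (chiP : bichar q chi).
Local Notation al := (alpha ty n).

Definition Ek (k : nat) : Unat chi := nE chi (inord k).

Lemma Unat_rels : nat_rels chi Ek (nFk chi) (nKk chi) (nLk chi)
  (fun k => nK chi (- al k)) (fun k => nL chi (- al k)).
Proof.
split.
- exact: nKV.
- exact: nLV.
- by move=> k i kN iN; rewrite /nKk nKE inordK.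
- by move=> k i kN iN; rewrite /nLk (nLE chiP) inordK.
- exact: nEF_eq.
- exact: E_commute.
- exact: E_serre3.
- exact: E_serre4.
- exact: E_super.
Qed.

Lemma gZ_Znat : gZ chi Ek = Znat chi. Proof. reflexivity. Qed.

End Instance.

Lemma acts_as_single (K : fieldType) (d : nat)
    (f : {linear loop_module K d -> loop_module K d}) (M : 'M[K]_d) (l : int)
    (a c : 'I_d) (m : int) (x : K) (l' : int) :
  acts_as f M l -> M a c = x -> l = l' -> (forall b, b != a -> M b c = 0) ->
  f (loop_vec K c m) = x *: loop_vec K a (l' + m).
Proof.
move=> fM <- <- M0; rewrite fM (bigD1 a) //= big1 => [|b ba]; first by rewrite addr0.
by rewrite M0 // scale0r.
Qed.

Lemma acts_as_scalar (K : fieldType) (d : nat)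
    (f : {linear loop_module K d -> loop_module K d}) (b : K) (l : int) :
  (forall c m, f (loop_vec K c m) = b *: loop_vec K c (l + m)) -> acts_as f b%:M l.
Proof.
move=> fb c m; rewrite fb (bigD1 c) //= mxE eqxx big1 => [|a ac]; first by rewrite addr0.
by rewrite mxE (negPf ac) scale0r.
Qed.

Theorem theorem3p4
    (K : fieldType) (char0 : [pchar K] =i pred0)
    (sqrt_minus1 : exists j : K, j ^+ 2 = -1)
    (tau : affine_type) (n : nat)
    (n_ge : (if tau is Tau4 then 1 <= n else 2 <= n)%N)
    (q : K) (q_neq0 : q != 0)
    (q_not_root1 : forall m : nat, (0 < m)%N -> q ^+ m != 1)
    (chi : Vhat tau n -> Vhat tau n -> K) (chiP : bichar q chi) :
  (forall i : idx tau n,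
     Znat chi * nF chi i - nF chi i * Znat chi = 0 /\
     (qbr chi (Znath chi) (alpha tau n i, nE chi i)).2 = 0) /\
  ((forall i : idx tau n, chi (alpha tau n i) (sdelta tau n) = 1) ->
   forall z u : idx tau n -> K,
     (forall i, z i != 0) -> (forall i, u i != 0) ->
   forall Psi : alg_rep (Unat chi) (loop_module K (rkN' tau n)),
     is_Psi q z u Psi ->
   exists b : K, b != 0 /\ acts_as (Psi (Znat chi)) b%:M (delta_mult tau)%:Z).
Proof.
have rels := Unat_rels chiP; have n0 := n_gt0 n_ge.
split=> [i|_ z u z0 u0 Psi PsiP].
  have iN : (i <= rkNhat tau n)%N by rewrite -ltnS ltn_ord.
  have := D_Z char0 n_ge q_neq0 q_not_root1 chiP rels iN.
  have := Z_bracket char0 n_ge q_neq0 q_not_root1 chiP rels iN.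
  by rewrite /Rz /Zh /D /der /E /nFk /Ek gZ_Znat inord_val => ZE ZF; split.
pose lab (c : 'I_(rkN' tau n)) := path_label tau n c.
have lab_le c : (lab c <= rkNhat tau n)%N by exact: path_label_le.
pose ep c := psiE q chi z u (inord (lab c)) (ord_pred c) c.
pose ph c := psiF u (inord (lab c)) c (ord_pred c).
have ep0 c : ep c != 0.
  apply: psiE_neq0 => //; first exact: chi_neq0 chiP.
    by rewrite inordK ?ltnS ?lab_le.
  exact: val_ord_pred.
have ph0 c : ph c != 0.
  by apply: psiF_neq0 => //; [rewrite inordK ?ltnS ?lab_le|exact: val_ord_pred].
have eq_pred (a c : 'I_(rkN' tau n)) : (a == prevn (rkN' tau n) c :> nat) = (a == ord_pred c).
  by rewrite -(inj_eq val_inj) /= -[X in _ = (_ == X)]/(nat_of_ord (ord_pred c)) val_ord_pred.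
have PsiE k c m : (k <= rkNhat tau n)%N -> Psi (Ek chi k) (loop_vec K c m) =
    (if lab c == k then ep c else 0) *: loop_vec K (ord_pred c) ((k == 0%N)%:Z + m).
  move=> kN; have ik : (inord k : idx tau n) = k :> nat by rewrite inordK.
  have H := Psi_E PsiP (inord k); rewrite ik in H.
  apply: (acts_as_single m H); [|by case: (k == 0%N)|] => [|b bc].
    case: eqP => [<- //|/eqP ck]; apply: psiE_off => //.
    by rewrite ik negb_and ck.
  by apply: psiE_off => //; rewrite eq_pred (negPf bc) andbF.
have PsiF k c m : (k <= rkNhat tau n)%N -> Psi (nFk chi k) (loop_vec K (ord_pred c) m) =
    (if lab c == k then ph c else 0) *: loop_vec K c (- (k == 0%N)%:Z + m).
  move=> kN; have ik : (inord k : idx tau n) = k :> nat by rewrite inordK.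
  have H := Psi_F PsiP (inord k); rewrite ik in H.
  apply: (acts_as_single m H); [|by case: (k == 0%N)|] => [|b bc].
    case: eqP => [<- //|/eqP ck]; apply: psiF_off => //.
    by rewrite ik negb_and ck.
  apply: psiF_off => //; rewrite eq_pred negb_and orbC.
  by rewrite (inj_eq (can_inj (@ord_predK _))) eq_sym bc.
have P0 : (0 < rkN' tau n)%N by rewrite /rkN' /rkN; case: (tau); lia.
have [b [b0 bZ]] := Psi_Z_scalar char0 n_ge q_neq0 q_not_root1 chiP rels ep0 ph0
  (fun c => erefl) lab_le (@loop_vec_neq0 _ _) PsiE PsiF (c0 := Ordinal P0) erefl.
exists b; split=> //; apply: acts_as_scalar => c m; rewrite -gZ_Znat; exact: bZ.
Qed.
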